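(* Let $N\ge1$ and, for $i\in\{1,\dots,N\}$, let $f^{(i)}_j(x)=\lambda_iR_{\alpha_i}x+t^i_j$, $j=1,\dots,k_i$, be maps on $\mathbb{R}^2$ with $\lambda_i\in(0,1)$, $R_{\alpha_i}$ the rotation of angle $\alpha_i\in[0,2\pi)$ and $t^i_j\in\mathbb{R}^2$. Let $R>0$ be such that the closed ball $B=B[0,R]$ satisfies $f^{(i)}_j(B)\subset B$ for all $i,j$, and suppose that for each $i\in\{1,\dots,N\}$ the disks $f^{(i)}_1(B),\dots,f^{(i)}_{k_i}(B)$ are pairwise disjoint. For each $i$ let $p_i=(p_{i,1},\dots,p_{i,k_i})$ be a probability vector, and for $\omega\in Y=\{1,\dots,N\}^{\mathbb{N}}$ let $\overline{\eta}^{(\omega)}=\prod_{n=1}^\infty p_{\omega_n}$, a product measure on $\mathbb{X}^{(\omega)}_\infty=\prod_{n=1}^\infty\{1,\dots,k_{\omega_n}\}$, and $\eta^{(\omega)}=\Delta_\omega\overline{\eta}^{(\omega)}$ its push-forward under the coding map $\Delta_\omega$. Let $r=(r_1,\dots,r_N)$ be a probability vector and let $\mu$ be the $r$-Bernoulli measure on $Y$. Finally, assume that $\alpha_i/\pi$ is irrational for some $i$ with $r_i>0$. Then for each $q\in(1,2]$ and each $\mu$-generic $\omega$, $$D_q(\Pi_v\eta^{(\omega)})=\min(D(q),1)\quad\text{for all } v\in S^1,$$ where $$D(q)=\frac{\sum_{i=1}^N r_i\log(p_{i,1}^q+\cdots+p_{i,k_i}^q)}{(q-1)\sum_{i=1}^N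 r_i\log(\lambda_i)}.$$ Furthermore, the convergence of $-\frac{\log\mathcal{C}^q_{\Pi_v\eta^{(\omega)}}(n)}{(q-1)n}$ to $\min(D(q),1)$ as $n\to\infty$ is uniform in $v\in S^1$.
   Context: The coding map $\Delta_\omega:\mathbb{X}^{(\omega)}_\infty\to\mathbb{R}^2$ is given by $\{\Delta_\omega(u)\}=\bigcap_{n\ge1}f^{(\omega_1)}_{u_1}\circ\cdots\circ f^{(\omega_n)}_{u_n}(B)$. For $v\in S^1\subset\mathbb{R}^2$, $\Pi_v(x)=\langle x,v\rangle$, and $\Pi_v\eta$ is the push-forward. A point $\omega\in Y$ is $\mu$-generic if $\frac1n\sum_{i=1}^n\delta_{\mathbf{T}^i\omega}\to\mu$ weakly, where $\mathbf{T}$ is the left shift on $Y$. Logarithms are to base $2$. For a Borel probability measure $\rho$ on $\mathbb{R}$, $\mathcal{C}^q_\rho(n)=\sum_{I\in\mathfrak{D}_n}\rho(I)^q$, where $\mathfrak{D}_n=\{[2^{-n}j,2^{-n}(j+1)): j\in\mathbb{Z}\}$, and for $q>1$ the $L^q$ dimension is $D_q(\rho)=\lim_{n\to\infty}\frac{\log\mathcal{C}^q_\rho(n)}{-n(q-1)}$ when the limit exists (existence is part of the conclusion). *)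

(* Defs.v *)
From HB Require Import structures.
From mathcomp Require Export all_boot all_order all_algebra.
From mathcomp Require Export all_classical all_reals all_analysis.
Export numFieldNormedType.Exports.

Set Implicit Arguments.
Unset Strict Implicit.
Unset Printing Implicit Defensive.

Import Order.TTheory GRing.Theory Num.Theory.

Local Open Scope classical_set_scope.
Local Open Scope ring_scope.

Section plane.
Context {R : realType}.
Implicit Types (x y v : R * R).

(* The library norm on R * R is the sup norm, so the Euclidean structure is
   spelled out. *)
Definition dot x y : R := x.1 * y.1 + x.2 * y.2.

Definition enorm x : R := Num.sqrt (dot x x).

Definition edisk (rad : R) : set (R * R) := [set x | enorm x <= rad].

Definition ecircle : set (R * R) := [set v | enorm v = 1].

Definition rot (a : R) x : R * R :=
  (cos a * x.1 - sin a * x.2, sin a * x.1 + cos a * x.2).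

Definition simil (lam a : R) (t x : R * R) : R * R := lam *: rot a x + t.

Definition proj_dir v x : R := dot x v.

End plane.

Section Lq_dimension.
Context {R : realType}.
Implicit Types (rho : set R -> \bar R).

Definition log2 (x : R) : R := ln x / ln 2.

Definition dyadic (n : nat) (j : int) : set R :=
  `[2 ^- n * j%:~R, 2 ^- n * (j + 1)%:~R[%classic.

Definition Cq rho (q : R) (n : nat) : \bar R :=
  (\esum_(j in [set: int]) (rho (dyadic n j) `^ q))%E.

Definition Lq_quotient rho (q : R) (n : nat) : R :=
  log2 (fine (Cq rho q n)) / (- (n%:R * (q - 1))).

(* D_q(rho) exists and equals d *)
Definition is_Lq_dim rho (q d : R) : Prop := Lq_quotient rho q @ \oo --> d.

Definition prob_vector n (p : 'I_n -> R) : Prop :=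
  (forall j, 0 <= p j) /\ \sum_j p j = 1.

End Lq_dimension.

HB.instance Definition _ n := isPointed.Build 'I_n.+1 ord0.

Definition borel (T : ptopologicalType) := g_sigma_algebraType (@open T).

(* [tree_of A] is the product of the discrete spaces [A n].  In the instances
   below the alphabets are finite, so its Borel sets are also the product
   sigma-algebra, and the cylinder condition determines the measure. *)
Definition is_product_measure (R : realType) (A : nat -> pointedType)
    (P : forall n, A n -> R) (m : probability (borel (tree_of A)) R) : Prop :=
  forall (n : nat) (a : tree_of A),
    m [set x | forall i, (i < n)%N -> x i = a i] = (\prod_(i < n) P i (a i))%:E.

Definition weak_cvg (R : realType) (T : ptopologicalType)
    (nu : nat -> {measure set (borel T) -> \bar R})
    (m : {measure set (borel T) -> \bar R}) : Prop :=
  forall g : T -> R, continuous g -> (exists M, forall x, `|g x| <= M) ->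
    (fun n => \int[nu n]_x (g x)%:E)%E @ \oo --> (\int[m]_x (g x)%:E)%E.

(* Sequences are indexed from 0, and the alphabets {1..N}, {1..k_i} are encoded
   by 'I_N.+1 and 'I_(k i).+1, nonempty because they carry probability
   vectors. *)
Definition driving (N : nat) := tree_of (fun=> 'I_N.+1 : pointedType).

Definition shift N (omega : driving N) : driving N := fun n => omega n.+1.

Definition empirical (R : realType) N (omega : driving N) (n : nat) :
    {measure set (borel (driving N)) -> \bar R} :=
  mscale (n%:R^-1)%:nng
    (msum (fun i => dirac (iter i.+1 (@shift N) omega : borel (driving N))) n).

Definition generic (R : realType) N (mu : probability (borel (driving N)) R)
    (omega : driving N) : Prop :=
  weak_cvg (empirical R omega) mu.

Definition coding N (k : 'I_N.+1 -> nat) (omega : driving N) :=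
  tree_of (fun n => 'I_(k (omega n)).+1 : pointedType).

Section model.
Context {R : realType} (N : nat) (k : 'I_N.+1 -> nat).
Variables (f : forall i, 'I_(k i).+1 -> R * R -> R * R).

Fixpoint iter_maps (omega : driving N) (u : coding k omega) (n : nat) :
    R * R -> R * R :=
  if n is m.+1 then iter_maps u m \o f (u m) else id.

(* The intersection is a singleton under the hypotheses of the theorem. *)
Definition coding_map (rad : R) (omega : driving N) (u : coding k omega) :
    R * R :=
  get (\bigcap_(n in [set n | (0 < n)%N]) (iter_maps u n @` edisk rad)).

Definition eta_proj (rad : R) (omega : driving N)
    (etabar : probability (borel (coding k omega)) R) (v : R * R) :
    set R -> \bar R :=
  let eta := pushforward etabar
    (coding_map rad (omega := omega) : borel (coding k omega) -> R * R) in
  pushforward eta (proj_dir v).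

End model.

Definition similarity_dim (R : realType) N (k : 'I_N.+1 -> nat)
    (lam r : 'I_N.+1 -> R) (p : forall i, 'I_(k i).+1 -> R) (q : R) : R :=
  (\sum_i r i * log2 (\sum_j p i j `^ q)) /
  ((q - 1) * \sum_i r i * log2 (lam i)).

(* Main.v *)
Require Import Defs.
From mathcomp Require Import ring lra zify.
Import Order.TTheory GRing.Theory Num.Theory.

Set Implicit Arguments.
Unset Strict Implicit.
Unset Printing Implicit Defensive.

Local Open Scope classical_set_scope.
Local Open Scope ring_scope.

(** Write [q = 1 + s] with [0 < s <= 1]. All maps driven by the same letter
    have the same linear part, so the projected measure is described at
    scale [ratios w], [w] a prefix of the driving sequence, by the weighted
    family of the projections of the points [act w u 0], [u] ranging over
    words. Its [q]-energy [Lq_energy] sums the [q]-th powers of the masses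
    of the cells of length [ratios w]; up to a constant factor it bounds the
    dyadic sum at the dyadic scale next to [ratios w] ([Cq_upper]).

    Lower bounds for the dyadic sum are soft. One is the number of dyadic
    intervals that a bounded set needs ([Cq_lower_cover]), the other lets
    every word contribute the [q]-th power of its own mass
    ([Cq_lower_words]). By the frequencies of the letters in a generic
    sequence they have exponential rates [s] times the mean of the
    logarithms of the ratios, and the mean of the logarithms of the moments
    [sum_a p_a ^ q]. The larger rate is the asserted one, divided by the
    first rate it is [min (D(q), 1)].

    The work lies in the upper bound, uniformly in the direction
    ([orbit_growth]). Energies are submultiplicative up to a constant along
    the driving sequence, the direction being rotated by the letters that
    have been read ([Lq_energy_submul]). Hence the exponential rate of the
    energy of a long word is at most that of the geometric average, over all
    windows of a fixed length [L] in that word, of the energies of these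
    windows seen from the rotated directions ([subadditive_average]), up to
    an error that vanishes as [L] grows. Jensen's inequality for the
    logarithm replaces this geometric average by arithmetic averages of the
    energies normalized by [energy_bound] ([average_energy_ratio]).

    These averages are bounded by an averaging argument in the manner of
    Marstrand and Kaufman ([close_energy_le]): two words that separate after
    a prefix of ratio [rho] give points at distance at least [gap * rho], so
    they are projected into one cell only when the direction lies in a strip
    whose width is of the order of the quotient of the length of the cell by
    [rho]. Equidistributed directions spend no more than a constant times
    that proportion of time in the strip. The power [s] of the masses is
    pulled out of the average over directions by concavity, which is where
    [q <= 2] enters.

    Directions are equidistributed along the occurrences of every fixed
    word, uniformly in the initial direction ([strip_count]). By Fejer
    kernels this reduces to the vanishing of averages of cosines of multiples of
    the rotation over the occurrences of a word ([twisted_word_mean]).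
    Irrationality makes the mean of the rotations differ from [1]; replacing
    the letters by their means one at a time produces errors that are sums
    of martingale differences, and these are small on average because their
    second moments grow only linearly in the length ([martingale_small]).
    The same estimate gives the law of large numbers that bounds
    [energy_bound] ([average_log_bound]). Genericity enters through the
    frequencies of finite words ([generic_word_frequencies]). *)

(** * Power sums and Jensen inequalities *)

Lemma eqW (R : realType) (x y : R) : x = y -> x <= y.
Proof. by move=> ->. Qed.

Section power_sums.
Context {R : realType} (s : R).
Hypothesis s01 : 0 < s <= 1.

Let s_gt0 : 0 < s. Proof. by case/andP: s01. Qed.
Let s_le1 : s <= 1. Proof. by case/andP: s01. Qed.
Let s1_gt0 : 0 < 1 + s. Proof. by rewrite addr_gt0. Qed.

Lemma powR1D (x : R) : 0 <= x -> x `^ (1 + s) = x * x `^ s.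
Proof. by move=> x0; rewrite -(mulr_powRB1 x0 s1_gt0) addrAC subrr add0r. Qed.

Lemma ler_powRs (x y : R) : 0 <= x -> x <= y -> x `^ s <= y `^ s.
Proof.
move=> x0 xy; apply: ge0_ler_powR => //; rewrite ?nnegrE //; first exact: ltW.
exact: le_trans xy.
Qed.

Lemma ler_powR1s (x y : R) : 0 <= x -> x <= y -> x `^ (1 + s) <= y `^ (1 + s).
Proof.
move=> x0 xy; apply: ge0_ler_powR => //; rewrite ?nnegrE //; first exact: ltW.
exact: le_trans xy.
Qed.

(** Comparison of [t ^ s] with [t] on the unit interval, cleared of
    denominators so that it also covers the value [0]. *)
Lemma mul_powR_mono (x z : R) : 0 <= x -> x <= z -> x * z `^ s <= z * x `^ s.
Proof.
rewrite le_eqVlt => /predU1P[<- _|x0 xz].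
  by rewrite mul0r powR0 ?gt_eqF // mulr0.
have z0 : 0 < z by apply: lt_le_trans xz.
have a0 : 0 < x / z by rewrite divr_gt0.
have a1 : x / z <= 1 by rewrite ler_pdivrMr // mul1r.
have /andP a01 := conj a0 a1.
have h := ger1_powR a01 s_le1.
have -> : x `^ s = (x / z) `^ s * z `^ s.
  by rewrite -powRM ?divfK ?gt_eqF // ltW.
rewrite mulrA ler_wpM2r ?powR_ge0 // mulrC -ler_pdivrMr //.
Qed.

Lemma powR_subadd (x y : R) : 0 <= x -> 0 <= y ->
  (x + y) `^ s <= x `^ s + y `^ s.
Proof.
move=> x0 y0; have [/eqP|xy0] := eqVneq (x + y) 0.
  by rewrite paddr_eq0 // => /andP[/eqP-> /eqP->]; rewrite addr0 powR0 ?gt_eqF // addr0.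
have z0 : 0 < x + y by rewrite lt_neqAle eq_sym xy0 addr_ge0.
have h1 : x * (x + y) `^ s <= (x + y) * x `^ s by apply: mul_powR_mono; rewrite ?lerDl.
have h2 : y * (x + y) `^ s <= (x + y) * y `^ s by apply: mul_powR_mono; rewrite ?lerDr.
by rewrite -(ler_pM2l z0) mulrDl mulrDr lerD.
Qed.

Lemma powR_sum_subadd (T : Type) (r : seq T) (Q : pred T) (x : T -> R) :
  (forall i, 0 <= x i) ->
  (\sum_(i <- r | Q i) x i) `^ s <= \sum_(i <- r | Q i) x i `^ s.
Proof.
move=> x0; elim: r => [|i r IH]; first by rewrite !big_nil powR0 ?gt_eqF.
rewrite !big_cons; case: ifP => // _.
by rewrite (le_trans (powR_subadd _ _)) ?sumr_ge0 // lerD2l.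
Qed.

Lemma powR_sum_superadd (T : Type) (r : seq T) (Q : pred T) (x : T -> R) :
  (forall i, 0 <= x i) ->
  \sum_(i <- r | Q i) x i `^ (1 + s) <= (\sum_(i <- r | Q i) x i) `^ (1 + s).
Proof.
move=> x0; elim: r => [|i r IH]; first by rewrite !big_nil powR_ge0.
rewrite !big_cons; case: ifP => // _.
have S0 : 0 <= \sum_(i <- r | Q i) x i by rewrite sumr_ge0.
apply: (@le_trans _ _ (x i `^ (1 + s) + (\sum_(j <- r | Q j) x j) `^ (1 + s))).
  by rewrite lerD2l.
rewrite !powR1D ?addr_ge0 // mulrDl lerD //.
  by rewrite ler_wpM2l // ler_powRs // lerDl.
by rewrite ler_wpM2l // ler_powRs // lerDr.
Qed.

Lemma bernoulli_concave (a : R) : 0 <= a -> a `^ s <= 1 - s + s * a.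
Proof.
move=> a0; move: s_le1; rewrite le_eqVlt => /predU1P[->|s1].
  by rewrite powRr1 // subrr add0r mul1r.
have p0 : 0 < s^-1 by rewrite invr_gt0.
have q0 : 0 < (1 - s)^-1 by rewrite invr_gt0 subr_gt0.
have pq : s^-1^-1 + (1 - s)^-1^-1 = 1 by rewrite !invrK addrC subrK.
have := conjugate_powR (powR_ge0 a s) ler01 p0 q0 pq.
rewrite !invrK mulr1 -powRrM mulfV ?gt_eqF // powRr1 // powR1 mul1r.
by rewrite addrC [s * a]mulrC.
Qed.

Lemma bernoulli_convex (a : R) : 0 <= a -> (1 + s) * a <= a `^ (1 + s) + s.
Proof.
move=> a0.
have i0 : (1 + s)^-1 < 1 by rewrite invf_lt1 // ltrDl.
have q0 : 0 < (1 - (1 + s)^-1)^-1 by rewrite invr_gt0 subr_gt0.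
have pq : (1 + s)^-1 + (1 - (1 + s)^-1)^-1^-1 = 1 by rewrite invrK addrC subrK.
have := conjugate_powR a0 ler01 s1_gt0 q0 pq.
rewrite invrK mulr1 powR1 mul1r => h.
have := ler_wpM2l (ltW s1_gt0) h => /le_trans; apply; apply/eqW.
by field; rewrite gt_eqF.
Qed.

(** Sum the tangent line inequality at the weighted mean. *)
Lemma jensen_convex (T : Type) (r : seq T) (Q : pred T) (w x : T -> R) :
  (forall i, 0 <= w i) -> (forall i, 0 <= x i) ->
  (\sum_(i <- r | Q i) w i * x i) `^ (1 + s) <=
  (\sum_(i <- r | Q i) w i) `^ s * \sum_(i <- r | Q i) w i * x i `^ (1 + s).
Proof.
move=> w0 x0; set W := \sum_(i <- r | Q i) w i; set X := \sum_(i <- r | Q i) w i * x i.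
have W_ge0 : 0 <= W by rewrite sumr_ge0.
have X_ge0 : 0 <= X by rewrite sumr_ge0 // => i _; rewrite mulr_ge0.
have RHS0 : 0 <= W `^ s * \sum_(i <- r | Q i) w i * x i `^ (1 + s).
  by rewrite mulr_ge0 ?powR_ge0 // sumr_ge0 // => i _; rewrite mulr_ge0 ?powR_ge0.
have [->|X0] := eqVneq X 0; first by rewrite powR0 ?gt_eqF.
have {X0}X_gt0 : 0 < X by rewrite lt_neqAle eq_sym X0.
have W_gt0 : 0 < W.
  rewrite lt_neqAle W_ge0 andbT; apply/negP => /eqP W0.
  suff : X <= 0 by rewrite leNgt X_gt0.
  rewrite /X; have : W = 0 by []; rewrite /W; elim: (r) => [|i r' IH]; rewrite ?big_nil //.
  rewrite !big_cons; case: ifP => // _ /eqP; rewrite paddr_eq0 ?sumr_ge0 //.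
  by move=> /andP[/eqP-> /eqP/IH]; rewrite mul0r add0r.
set m := X / W; have m0 : 0 < m by rewrite divr_gt0.
have tangent i : w i * ((1 + s) * m `^ s * x i) <= w i * (x i `^ (1 + s) + s * m `^ (1 + s)).
  rewrite ler_wpM2l //.
  have := bernoulli_convex (divr_ge0 (x0 i) (ltW m0)).
  move=> /(ler_wpM2l (powR_ge0 m (1 + s))); rewrite mulrDr -powRM ?(ltW m0) //; last first.
    by rewrite divr_ge0 // ltW.
  rewrite [m * (_ / _)]mulrC divfK ?gt_eqF // [_ * s]mulrC; apply: le_trans.
  rewrite (powR1D (ltW m0)); apply/eqW; rewrite [m * _]mulrC.
  by field; rewrite gt_eqF.
have := @ler_sum _ _ r Q _ _ (fun i _ => tangent i).
rewrite (eq_bigr (fun i => (1 + s) * m `^ s * (w i * x i))); last by move=> i _; ring.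
rewrite -mulr_sumr -/X => h.
have {}h : (1 + s) * m `^ s * X <=
   \sum_(i <- r | Q i) w i * x i `^ (1 + s) + s * m `^ (1 + s) * W.
  apply: le_trans h _; rewrite /W mulr_sumr -big_split /=; apply/eqW/eq_bigr => i _; ring.
have XmW : X = m * W by rewrite /m divfK ?gt_eqF.
have {h} : m `^ (1 + s) * W <= \sum_(i <- r | Q i) w i * x i `^ (1 + s).
  move: h; rewrite XmW (powR1D (ltW m0)); set z := m `^ s; set Y := \sum_(_ <- _ | _) _.
  move=> h; rewrite -subr_ge0.
  have -> : Y - m * z * W = Y + s * (m * z) * W - (1 + s) * z * (m * W) by ring.
  by rewrite subr_ge0.
move=> /(ler_wpM2l (powR_ge0 W s)); apply: le_trans.
by rewrite XmW powRM ?(ltW m0) // (powR1D W_ge0); apply/eqW; ring.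
Qed.

Lemma powR_sum_le (T : Type) (r : seq T) (x : T -> R) : (forall i, 0 <= x i) ->
  (\sum_(i <- r) x i) `^ (1 + s) <= (size r)%:R `^ s * \sum_(i <- r) x i `^ (1 + s).
Proof.
move=> x0; have := @jensen_convex T r predT (fun=> 1) x (fun=> ler01) x0.
rewrite (eq_bigr x) => [|i _]; last by rewrite mul1r.
rewrite [X in _ <= _ * X -> _](eq_bigr (fun i => x i `^ (1 + s))) => [|i _]; last by rewrite mul1r.
by rewrite big_const_seq iter_addr_0 count_predT.
Qed.

(** The normalizations [c] and [t * c] are only upper bounds, so the lemma
    applies to averages whose total weight is known up to a small excess. *)
Lemma jensen_concave (T : Type) (r : seq T) (w x : T -> R) (c t : R) :
  (forall i, 0 <= w i) -> (forall i, 0 <= x i) -> 0 <= t ->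
  \sum_(i <- r) w i <= c -> \sum_(i <- r) w i * x i <= t * c ->
  \sum_(i <- r) w i * x i `^ s <= c * t `^ s.
Proof.
move=> w0 x0; rewrite le_eqVlt => /predU1P[<-|t0] hw hx.
  rewrite powR0 ?gt_eqF // mulr0.
  move: hx; rewrite mul0r; elim: r {hw} => [|i r IH]; rewrite ?big_nil // !big_cons => h.
  have S0 : 0 <= \sum_(j <- r) w j * x j by rewrite sumr_ge0 // => j _; rewrite mulr_ge0.
  have wx0 : 0 <= w i * x i by rewrite mulr_ge0.
  have /IH h1 : \sum_(j <- r) w j * x j <= 0 by lra.
  have /eqP : w i * x i = 0 by lra.
  by rewrite mulf_eq0 => /orP[/eqP->|/eqP->]; rewrite ?mul0r ?powR0 ?gt_eqF ?mulr0 ?add0r.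
have tangent i : w i * x i `^ s <= t `^ s * (1 - s) * w i + t `^ s * s / t * (w i * x i).
  have := bernoulli_concave (divr_ge0 (x0 i) (ltW t0)).
  move=> /(ler_wpM2l (powR_ge0 t s)) /(ler_wpM2l (w0 i)).
  rewrite -powRM ?divr_ge0 ?(ltW t0) // [t * _]mulrC divfK ?gt_eqF //.
  by move/le_trans; apply; apply/eqW; field; rewrite gt_eqF.
apply: (le_trans (@ler_sum _ _ r predT _ _ (fun i _ => tangent i))).
rewrite big_split /= -!mulr_sumr.
have -> : c * t `^ s = t `^ s * (1 - s) * c + t `^ s * s / t * (t * c).
  by field; rewrite gt_eqF.
by rewrite lerD // ler_wpM2l // ?mulr_ge0 ?powR_ge0 ?subr_ge0 ?invr_ge0 ?(ltW t0) // ltW.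
Qed.

End power_sums.

(** Sum the tangent line inequality for [ln] at [t]. *)
Lemma jensen_ln (R : realType) (T : Type) (r : seq T) (x : T -> R) (t : R) :
  0 < t -> (forall i, 0 < x i) -> \sum_(i <- r) x i <= t * (size r)%:R ->
  \sum_(i <- r) ln (x i) <= (size r)%:R * ln t.
Proof.
move=> t0 x0 h.
have tangent i : ln (x i) <= ln t - 1 + t^-1 * x i.
  have xt : 0 < x i / t by rewrite divr_gt0.
  have := @le_ln1Dx R (x i / t - 1).
  have -> : 1 + (x i / t - 1) = x i / t by ring.
  have -> : (-1 < x i / t - 1) = (0 < x i / t) by rewrite ltrBrDl subrr.
  rewrite xt => /(_ isT); by rewrite ln_div ?posrE // [_ * x i]mulrC; lra.
apply: (le_trans (@ler_sum _ _ r predT _ _ (fun i _ => tangent i))).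
rewrite big_split /= -mulr_sumr big_const_seq iter_addr_0 count_predT.
have := ler_wpM2l (ltW (etrans (invr_gt0 _) t0)) h; rewrite mulrA mulVf ?gt_eqF // mul1r => h'.
by rewrite -[(ln t - 1) *+ _]mulr_natl mulrBr; lra.
Qed.

(** * Energies of partitions into cells *)

Section cell_energy.
Context {R : realType} (s : R).
Hypothesis s01 : 0 < s <= 1.
Context {T : eqType} (X : seq T) (pi : T -> R).
Hypothesis pi_ge0 : forall u, 0 <= pi u.

Definition cell_mass (c : T -> int) (j : int) : R := \sum_(u <- X | c u == j) pi u.

(** The sum over the cells of the masses to the power [1 + s], written as the
    mean of the [s]-th power of the mass of the cell of a point: this form needs
    no list of the cells ([energy_cells] compares the two). *)
Definition energy (c : T -> int) : R :=
  \sum_(u <- X) pi u * cell_mass c (c u) `^ s.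

Lemma cell_mass_ge0 c j : 0 <= cell_mass c j.
Proof. by rewrite sumr_ge0. Qed.

Lemma energy_ge0 c : 0 <= energy c.
Proof. by rewrite sumr_ge0 // => u _; rewrite mulr_ge0 ?powR_ge0. Qed.

Lemma sum_cells (S : seq int) (c : T -> int) (F : T -> R) : uniq S ->
  \sum_(j <- S) \sum_(u <- X | c u == j) F u = \sum_(u <- X | c u \in S) F u.
Proof.
move=> uS; rewrite (exchange_big_dep predT) //= [RHS]big_mkcond /=.
apply: eq_bigr => u _; rewrite big_const_seq iter_addr_0.
have -> : count (fun j => c u == j) S = count_mem (c u) S.
  by apply: eq_count => j /=; rewrite eq_sym.
by rewrite count_uniq_mem //; case: (_ \in _); rewrite ?mulr1n ?mulr0n.
Qed.

Lemma cell_mass_powR c j : cell_mass c j `^ (1 + s) =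
  \sum_(u <- X | c u == j) pi u * cell_mass c (c u) `^ s.
Proof.
rewrite (powR1D s01) ?cell_mass_ge0 // {1}/cell_mass mulr_suml.
by apply: eq_bigr => u /eqP->.
Qed.

Lemma energy_cells c :
  energy c = \sum_(j <- undup (map c X)) cell_mass c j `^ (1 + s).
Proof.
under eq_bigr do rewrite cell_mass_powR.
rewrite sum_cells ?undup_uniq // /energy big_seq [RHS]big_seq_cond.
by apply: eq_bigl => u; rewrite mem_undup andb_idr // => uX; rewrite map_f.
Qed.

Lemma le_energy c (S : seq int) : uniq S ->
  \sum_(j <- S) cell_mass c j `^ (1 + s) <= energy c.
Proof.
move=> uS; under eq_bigr do rewrite cell_mass_powR.
rewrite sum_cells // big_mkcond; apply: ler_sum => u _.
by case: ifP => // _; rewrite mulr_ge0 ?powR_ge0.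
Qed.

Lemma powR_nat_le (M : nat) : (M%:R : R) `^ s <= M%:R.
Proof.
case: M => [|M]; first by rewrite powR0 ?gt_eqF //; case/andP: s01.
by apply: ler1_powR; rewrite ?ler1n //; case/andP: s01.
Qed.

(** Merging boundedly many consecutive cells multiplies the energy by at most a
    constant.  Injectivity of [a] keeps a cell from being counted for two values
    of [j] at the same offset. *)
Lemma sum_window_le c (S : seq int) (a : int -> int) (M : nat) :
  uniq S -> injective a ->
  \sum_(j <- S) (\sum_(k <- iota 0 M) cell_mass c (a j + k%:Z)) `^ (1 + s) <=
  M%:R ^+ 2 * energy c.
Proof.
move=> uS ia.
have step j : (\sum_(k <- iota 0 M) cell_mass c (a j + k%:Z)) `^ (1 + s) <=
    M%:R * \sum_(k <- iota 0 M) cell_mass c (a j + k%:Z) `^ (1 + s).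
  apply: le_trans (powR_sum_le s01 _ (fun k => cell_mass_ge0 c _)) _.
  rewrite size_iota ler_wpM2r ?powR_nat_le //.
  by rewrite sumr_ge0 // => k _; rewrite powR_ge0.
apply: (le_trans (@ler_sum _ _ S predT _ _ (fun j _ => step j))).
rewrite -mulr_sumr expr2 -mulrA ler_wpM2l // exchange_big /=.
have col k : \sum_(j <- S) cell_mass c (a j + k%:Z) `^ (1 + s) <= energy c.
  rewrite -(big_map (fun j => a j + k%:Z) predT (fun j => cell_mass c j `^ (1 + s))).
  by apply: le_energy; rewrite map_inj_uniq // => x y /addIr /ia.
apply: (le_trans (@ler_sum _ _ (iota 0 M) predT _ _ (fun k _ => col k))).
by rewrite big_const_seq iter_addr_0 count_predT size_iota mulr_natl.
Qed.

Lemma mass_le_window c (B : pred T) (a : int) (M : nat) :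
  (forall u, u \in X -> B u -> a <= c u < a + M%:Z) ->
  \sum_(u <- X | B u) pi u <= \sum_(k <- iota 0 M) cell_mass c (a + k%:Z).
Proof.
move=> h.
rewrite -(big_map (fun k : nat => a + k%:Z) predT (fun j => cell_mass c j)).
rewrite sum_cells; last by rewrite map_inj_uniq ?iota_uniq // => x y /addrI [].
rewrite big_seq_cond [leRHS]big_mkcond [leRHS]big_seq /= big_mkcondr /=.
apply: ler_sum => u uX; case: ifP => Bu; last by case: ifP.
have /andP[h1 h2] := h _ uX Bu.
suff -> : c u \in [seq a + k%:Z | k <- iota 0 M] by [].
apply/mapP; exists `|c u - a|%N; last by rewrite gez0_abs ?subr_ge0 // subrKC.
by rewrite mem_iota /= add0n -ltz_nat gez0_abs ?subr_ge0 // ltrBlDl.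
Qed.

(** Two partitions whose indices differ, up to an injective relabelling, by a
    bounded amount have comparable energies. *)
Lemma energy_le_window c c' (a : int -> int) (M : nat) : injective a ->
  (forall u, u \in X -> a (c' u) <= c u < a (c' u) + M%:Z) ->
  energy c' <= M%:R ^+ 2 * energy c.
Proof.
move=> ia h; rewrite energy_cells.
apply: le_trans (sum_window_le c M (undup_uniq (map c' X)) ia).
apply: ler_sum => j _; apply: ler_powR1s => //; first exact: cell_mass_ge0.
by apply: mass_le_window => u uX /eqP <-; apply: h.
Qed.

(** A product of the mass of a cell and the [s]-th power of the mass of another
    is at most the sum of the [1 + s]-th powers of both masses. *)
Lemma neighbor_energy_le c (k0 : int) (M : nat) :
  \sum_(u <- X) pi u * (\sum_(k <- iota 0 M) cell_mass c (c u + k0 + k%:Z)) `^ s <=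
  (2 * M)%:R * energy c.
Proof.
have one (d : int) : \sum_(u <- X) pi u * cell_mass c (c u + d) `^ s <= 2 * energy c.
  have -> : \sum_(u <- X) pi u * cell_mass c (c u + d) `^ s =
     \sum_(j <- undup (map c X)) cell_mass c j * cell_mass c (j + d) `^ s.
    under [RHS]eq_bigr => j _.
      rewrite {1}/cell_mass mulr_suml (eq_bigr (fun u => pi u * cell_mass c (c u + d) `^ s)).
        over.
      by move=> u /eqP->.
    rewrite sum_cells ?undup_uniq // big_seq [RHS]big_seq_cond.
    by apply: eq_bigl => u; rewrite mem_undup andb_idr // => uX; rewrite map_f.
  have step j : cell_mass c j * cell_mass c (j + d) `^ s <=
      cell_mass c j `^ (1 + s) + cell_mass c (j + d) `^ (1 + s).
    rewrite !(powR1D s01) ?cell_mass_ge0 //.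
    have [le|lt] := leP (cell_mass c (j + d)) (cell_mass c j).
      rewrite ler_wpDr ?mulr_ge0 ?powR_ge0 ?cell_mass_ge0 //.
      by rewrite ler_wpM2l ?cell_mass_ge0 // ler_powRs ?cell_mass_ge0.
    rewrite ler_wpDl ?mulr_ge0 ?powR_ge0 ?cell_mass_ge0 //.
    by rewrite ler_wpM2r ?powR_ge0 // ltW.
  apply: (le_trans (@ler_sum _ _ _ predT _ _ (fun j _ => step j))).
  rewrite big_split /= mulrDl mul1r lerD //; first exact/le_energy/undup_uniq.
  rewrite -(big_map (fun j => j + d) predT (fun j => cell_mass c j `^ (1 + s))).
  by apply: le_energy; rewrite map_inj_uniq ?undup_uniq // => x y /addIr.
apply: (@le_trans _ _ (\sum_(k <- iota 0 M)
    \sum_(u <- X) pi u * cell_mass c (c u + (k0 + k%:Z)) `^ s)).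
  rewrite exchange_big /=; apply: ler_sum => u _; rewrite -mulr_sumr ler_wpM2l //.
  under eq_bigr do rewrite -addrA.
  by apply: powR_sum_subadd => // k; apply: cell_mass_ge0.
apply: (le_trans (@ler_sum _ _ _ predT _ _ (fun k _ => one (k0 + k%:Z)))).
rewrite big_const_seq iter_addr_0 count_predT size_iota natrM -[leLHS]mulr_natr.
by apply: eqW; ring.
Qed.

Lemma energy_ge c : \sum_(u <- X) pi u `^ (1 + s) <= energy c.
Proof.
rewrite /energy big_seq [leRHS]big_seq; apply: ler_sum => u uX.
rewrite (powR1D s01) // ler_wpM2l // ler_powRs //.
by rewrite /cell_mass (big_rem u) //= eqxx lerDl sumr_ge0.
Qed.

Lemma energy_le1 c : \sum_(u <- X) pi u <= 1 -> energy c <= 1.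
Proof.
move=> h; apply: (le_trans _ h); apply: ler_sum => u _; rewrite ler_piMr //.
have [s0 _] := andP s01.
have m1 : cell_mass c (c u) <= 1.
  apply: (le_trans _ h); rewrite /cell_mass big_mkcond; apply: ler_sum => v _.
  by case: ifP.
by apply: le_trans (ler_powRs s01 (cell_mass_ge0 _ _) m1) _; rewrite powR1.
Qed.

End cell_energy.

(** * Plane geometry *)

Lemma int_window (a b : int) (r : nat) : a < b + r%:Z -> b < a + r%:Z ->
  a - r%:Z <= b < a - r%:Z + (2 * r).+1%:Z.
Proof. by move=> h1 h2; apply/andP; split; lia. Qed.

Lemma int_floor_sum (b f g : int) : g < b + f + 2 -> b + f < g + 1 ->
  g - b - 1 <= f < g - b - 1 + 2%:Z.
Proof. by move=> h1 h2; apply/andP; split; lia. Qed.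

Section plane_geometry.
Context {R : realType}.
Implicit Types (x y z : R * R) (th a : R).

Definition dir th : R * R := (cos th, sin th).

Lemma dotDl x y z : dot (x + y) z = dot x z + dot y z.
Proof. by rewrite /dot /=; ring. Qed.

Lemma dotBl x y z : dot (x - y) z = dot x z - dot y z.
Proof. by rewrite /dot /=; ring. Qed.

Lemma dot_simil l a t x th :
  dot (simil l a t x) (dir th) = dot t (dir th) + l * dot x (dir (th - a)).
Proof. by rewrite /dot /simil /rot /dir /= cosB sinB /GRing.scale /=; ring. Qed.

Lemma dot_ge0 x : 0 <= dot x x.
Proof. by rewrite addr_ge0 // -expr2 sqr_ge0. Qed.

Lemma enorm_ge0 x : 0 <= enorm x.
Proof. exact: sqrtr_ge0. Qed.

Lemma sqr_enorm x : enorm x ^+ 2 = dot x x.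
Proof. by rewrite sqr_sqrtr ?dot_ge0. Qed.

Lemma enorm0 : enorm (0 : R * R) = 0.
Proof. by rewrite /enorm /dot /= !mulr0 addr0 sqrtr0. Qed.

Lemma dot_dir_le x th : `|dot x (dir th)| <= enorm x.
Proof.
rewrite -sqrtr_sqr ler_sqrt ?dot_ge0 // /dot /dir /=.
have h := cos2Dsin2 th; rewrite -subr_ge0.
set c := cos th in h *; set d := sin th in h *.
have -> : x.1 * x.1 + x.2 * x.2 - (x.1 * c + x.2 * d) ^+ 2 = (x.1 * d - x.2 * c) ^+ 2.
  have -> : x.1 * x.1 + x.2 * x.2 = (x.1 * x.1 + x.2 * x.2) * (c ^+ 2 + d ^+ 2).
    by rewrite h mulr1.
  by ring.
by rewrite sqr_ge0.
Qed.

Lemma polar x : exists th, x = enorm x *: dir th.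
Proof.
have [x0|x0] := eqVneq (enorm x) 0.
  exists 0; move: (sqr_enorm x); rewrite x0 scale0r expr0n /dot => /esym /eqP.
  rewrite -!expr2 paddr_eq0 ?sqr_ge0 // !sqrf_eq0 => /andP[/eqP h1 /eqP h2].
  by case: x h1 h2 {x0} => /= ? ? -> ->.
set n := enorm x in x0 *.
have h : (x.1 / n) ^+ 2 + (x.2 / n) ^+ 2 = 1.
  rewrite !expr_div_n -mulrDl sqr_enorm /dot -!expr2 divff //.
  by rewrite !expr2 -/(dot x x) -sqr_enorm sqrf_eq0.
have b1 : -1 <= x.1 / n <= 1.
  by rewrite -ler_norml -sqrtr_sqr -sqrtr1 ler_sqrt // -h lerDl sqr_ge0.
have s2 : sin (acos (x.1 / n)) = `|x.2 / n|.
  by rewrite sin_acos // -sqrtr_sqr; congr Num.sqrt; rewrite -h addrAC subrr add0r.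
have c1 : cos (acos (x.1 / n)) = x.1 / n by apply: acosK; rewrite in_itv.
have [y0|y0] := leP 0 (x.2 / n).
  exists (acos (x.1 / n)); rewrite /dir c1 s2 ger0_norm //.
  case: x @n x0 {h b1 s2 c1 y0} => x1 x2 n x0 /=.
  by congr pair; rewrite /GRing.scale /= mulrC divfK.
exists (- acos (x.1 / n)); rewrite /dir cosN sinN c1 s2 ltr0_norm // opprK.
case: x @n x0 {h b1 s2 c1 y0} => x1 x2 n x0 /=.
by congr pair; rewrite /GRing.scale /= mulrC divfK.
Qed.

End plane_geometry.

(** * Words and planar iterated function systems *)

Section words.
Context {R : realType} {I A : finType} (P : I -> A -> R).

Fixpoint words (n : nat) : seq (seq A) :=
  if n is m.+1 then [seq a :: u | a <- index_enum A, u <- words m] else [:: [::]].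

Definition weight (w : seq I) (u : seq A) : R := \prod_(x <- zip w u) P x.1 x.2.

Lemma weight_cons i w a u : weight (i :: w) (a :: u) = P i a * weight w u.
Proof. by rewrite /weight /= big_cons. Qed.

Lemma weight_cat w1 w2 u1 u2 : size u1 = size w1 ->
  weight (w1 ++ w2) (u1 ++ u2) = weight w1 u1 * weight w2 u2.
Proof. by move=> e; rewrite /weight zip_cat // big_cat. Qed.

Lemma size_words n u : u \in words n -> size u = n.
Proof.
elim: n u => [|n IH] u /=; first by rewrite inE => /eqP->.
by move=> /allpairsP[[a v] /= [_ /IH e ->]] /=; rewrite e.
Qed.

Lemma mem_words u : u \in words (size u).
Proof.
elim: u => [|a u IH] /=; first by rewrite inE.
by apply/allpairsP; exists (a, u); rewrite mem_index_enum IH.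
Qed.

Lemma words_uniq n : uniq (words n).
Proof.
elim: n => //= n IH; apply: allpairs_uniq => //; first exact: index_enum_uniq.
by move=> [a u] [b v] _ _ /= [-> ->].
Qed.

Lemma sum_words_cons (V : nmodType) n (F : seq A -> V) :
  \sum_(u <- words n.+1) F u = \sum_a \sum_(u <- words n) F (a :: u).
Proof. by rewrite /= big_allpairs_dep. Qed.

Lemma sum_words_cat n1 n2 (F : seq A -> R) :
  \sum_(u <- words (n1 + n2)) F u =
  \sum_(u1 <- words n1) \sum_(u2 <- words n2) F (u1 ++ u2).
Proof.
elim: n1 F => [|n1 IH] F; first by rewrite /= big_seq1.
by rewrite addSn !sum_words_cons; apply: eq_bigr => a _; rewrite IH.
Qed.

Hypothesis P_ge0 : forall i a, 0 <= P i a.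

Lemma weight_ge0 w u : 0 <= weight w u.
Proof. by rewrite /weight; elim/big_ind: _ => // x y; apply: mulr_ge0. Qed.

Lemma sum_weightX (F : R -> R) (w : seq I) : F 1 = 1 ->
  (forall x y, 0 <= x -> 0 <= y -> F (x * y) = F x * F y) ->
  \sum_(u <- words (size w)) F (weight w u) = \prod_(i <- w) \sum_a F (P i a).
Proof.
move=> F1 FM; elim: w => [|i w IH]; first by rewrite /= big_seq1 /weight !big_nil.
rewrite sum_words_cons big_cons -IH mulr_suml; apply: eq_bigr => a _.
by rewrite mulr_sumr; apply: eq_bigr => u _; rewrite weight_cons FM ?weight_ge0.
Qed.

Lemma sum_weight w : (forall i, \sum_a P i a = 1) ->
  \sum_(u <- words (size w)) weight w u = 1.
Proof.
move=> P1; rewrite (@sum_weightX id) //; elim/big_ind: _ => // x y -> ->.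
by rewrite mulr1.
Qed.

End words.

(** A random homogeneous system: [I] is the alphabet of the driving sequence and
    one alphabet [A] serves all driving letters, so that words are plain
    sequences.  A letter of [A] that does not belong to [i] has [prob i]
    zero, hence the restriction of the separation to positive probabilities;
    [gapP] separates the images of the disk quantitatively. *)
Record planar_ifs (R : realType) (I A : finType) := PlanarIFS {
  ratio : I -> R;
  angle : I -> R;
  trans : I -> A -> R * R;
  prob : I -> A -> R;
  radius : R;
  gap : R;
  ratio_itv : forall i, 0 < ratio i < 1;
  prob_ge0 : forall i a, 0 <= prob i a;
  prob_sum : forall i, \sum_a prob i a = 1;
  radius_gt0 : 0 < radius;
  disk_stable : forall i a z, enorm z <= radius ->
    enorm (simil (ratio i) (angle i) (trans i a) z) <= radius;
  gap_gt0 : 0 < gap;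
  gapP : forall i a b z z', a != b -> 0 < prob i a -> 0 < prob i b ->
    enorm z <= radius -> enorm z' <= radius ->
    gap <= enorm (simil (ratio i) (angle i) (trans i a) z -
                  simil (ratio i) (angle i) (trans i b) z') }.

Section ifs.
Context {R : realType} {I A : finType} (M : planar_ifs R I A) (s : R).
Hypothesis s01 : 0 < s <= 1.
Implicit Types (w : seq I) (u : seq A) (z : R * R) (th : R).

Fixpoint act w u z : R * R :=
  match w, u with
  | i :: w', a :: u' => simil (ratio M i) (angle M i) (trans M i a) (act w' u' z)
  | _, _ => z
  end.

Definition ratios w : R := \prod_(i <- w) ratio M i.

Definition angles w : R := \sum_(i <- w) angle M i.

Definition pos w th u : R := dot (act w u 0) (dir th).

Definition cell w th u : int := Num.floor (pos w th u / ratios w).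

Definition Lq_energy w th : R :=
  energy s (@words A (size w)) (weight (prob M) w) (cell w th).

Lemma ratios_gt0 w : 0 < ratios w.
Proof.
rewrite /ratios; elim/big_ind: _ => // [x y|i _]; first exact: mulr_gt0.
by case/andP: (ratio_itv M i).
Qed.

Lemma ratios_le1 w : ratios w <= 1.
Proof.
rewrite /ratios; elim: w => [|i w IH]; first by rewrite big_nil.
have [i0 i1] := andP (ratio_itv M i).
by rewrite big_cons mulr_ile1 // ?(ltW i0) ?(ltW i1) // ltW // ratios_gt0.
Qed.

Lemma ratios_cat w1 w2 : ratios (w1 ++ w2) = ratios w1 * ratios w2.
Proof. by rewrite /ratios big_cat. Qed.

Lemma act_cat w1 w2 u1 u2 z : size u1 = size w1 ->
  act (w1 ++ w2) (u1 ++ u2) z = act w1 u1 (act w2 u2 z).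
Proof. by elim: w1 u1 => [|i w1 IH] [|a u1] //= [e]; rewrite IH. Qed.

Lemma act_disk w u z : enorm z <= radius M -> enorm (act w u z) <= radius M.
Proof. by move=> zr; elim: w u => [|i w IH] [|a u] //=; apply: disk_stable. Qed.

(** All words over [w] have the linear part of [w], which is moved to the
    direction. *)
Lemma dot_act w u z th : size u = size w ->
  dot (act w u z) (dir th) = pos w th u + ratios w * dot z (dir (th - angles w)).
Proof.
rewrite /pos; elim: w u th => [|i w IH] [|a u] th //=.
  by rewrite /ratios /angles !big_nil subr0 mul1r {2}/dot /= !mul0r !add0r.
move=> [e]; rewrite !dot_simil IH // /ratios /angles !big_cons opprD addrA.
by rewrite mulrDr !mulrA addrA.
Qed.

Lemma pos_cons i w a u th : pos (i :: w) th (a :: u) =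
  dot (trans M i a) (dir th) + ratio M i * pos w (th - angle M i) u.
Proof. by rewrite /pos /= dot_simil. Qed.

Lemma pos_cat w1 w2 u1 u2 th : size u1 = size w1 ->
  pos (w1 ++ w2) th (u1 ++ u2) = pos w1 th u1 + ratios w1 * pos w2 (th - angles w1) u2.
Proof. by move=> e; rewrite {1}/pos act_cat // dot_act. Qed.

Lemma pos_le w u th : `|pos w th u| <= radius M.
Proof.
apply: le_trans (dot_dir_le _ _) _; apply: act_disk.
by rewrite enorm0 ltW // radius_gt0.
Qed.

Let wt_ge0 w u : 0 <= weight (prob M) w u.
Proof. exact/weight_ge0/prob_ge0. Qed.

Lemma Lq_energy_le1 w th : Lq_energy w th <= 1.
Proof.
apply: energy_le1 => //; rewrite (sum_weight (prob_ge0 M)) //.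
exact: prob_sum.
Qed.

Lemma Lq_energy_gt0 w th : 0 < Lq_energy w th.
Proof.
have s1 : 1 + s != 0 by case/andP: s01 => s0 _; rewrite gt_eqF // addr_gt0.
apply: lt_le_trans (energy_ge s01 _ (wt_ge0 w) _).
rewrite (@sum_weightX _ _ _ _ (prob_ge0 M) (fun x => x `^ (1 + s))) ?powR1 //; last first.
  by move=> x y x0 y0; rewrite powRM.
elim/big_ind: _ => // [x y|i _]; first exact: mulr_gt0.
rewrite lt_neqAle sumr_ge0 ?andbT => [|a _]; last exact: powR_ge0.
apply/eqP => /esym /eqP; rewrite psumr_eq0 => [/allP h|a _]; last exact: powR_ge0.
have := prob_sum M i; rewrite big1 => [/esym /eqP|a _]; first by rewrite oner_eq0.
by have := h a (mem_index_enum _); rewrite powR_eq0 => /andP[/eqP].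
Qed.

(** A bound for the distance of the coarse cells of two pieces that meet a common
    fine cell. *)
Definition reach : nat := (Num.truncn (2 * radius M) + 4)%N.

Lemma reachP : 2 * radius M + 2 <= reach%:R - 1.
Proof.
have r0 : 0 <= 2 * radius M by rewrite mulr_ge0 // ltW // radius_gt0.
have := truncn_itv r0; rewrite /reach => /andP[_ h].
by move: h; rewrite -natr1 natrD => h; lra.
Qed.

Definition submul_const : R := 4 * (2 * (2 * reach).+1)%:R.

(** A fine cell receives mass from the pieces of first level that meet it.  Their
    coarse cells are close to each other, so Jensen's inequality with weights the
    masses of these pieces bounds the [1 + s]-th power of the mass of the fine
    cell by the [s]-th power of the mass near one coarse cell times energies of
    single pieces.  The latter are copies of the energy of the second factor,
    up to a translation of the grid. *)
Lemma Lq_energy_submul w1 w2 th :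
  Lq_energy (w1 ++ w2) th <=
  submul_const * Lq_energy w1 th * Lq_energy w2 (th - angles w1).
Proof.
set th' := th - angles w1.
pose X1 := @words A (size w1); pose X2 := @words A (size w2).
pose p1 := weight (prob M) w1; pose p2 := weight (prob M) w2.
have p1_ge0 u : 0 <= p1 u by apply: wt_ge0.
have p2_ge0 u : 0 <= p2 u by apply: wt_ge0.
pose c12 u1 u2 := cell (w1 ++ w2) th (u1 ++ u2).
pose m u1 j := cell_mass X2 p2 (c12 u1) j.
have m_ge0 u1 j : 0 <= m u1 j by apply: cell_mass_ge0.
pose c1 := cell w1 th; pose c2 := cell w2 th'.
have r1 : 0 < ratios w1 := ratios_gt0 w1.
have r2 : 0 < ratios w2 := ratios_gt0 w2.
have c12E u1 u2 : u1 \in X1 ->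
    c12 u1 u2 = Num.floor (pos w1 th u1 / ratios w1 / ratios w2 + pos w2 th' u2 / ratios w2).
  move=> /size_words e1; rewrite /c12 /cell pos_cat // ratios_cat; congr Num.floor.
  by rewrite -/th'; field; rewrite !gt_eqF.
have massE j : cell_mass (@words A (size (w1 ++ w2))) (weight (prob M) (w1 ++ w2))
     (cell (w1 ++ w2) th) j = \sum_(u1 <- X1) p1 u1 * m u1 j.
  rewrite /cell_mass big_mkcond size_cat sum_words_cat.
  rewrite [LHS]big_seq [RHS]big_seq; apply: eq_bigr => u1 /size_words e1.
  rewrite /m /cell_mass mulr_sumr [RHS]big_mkcond; apply: eq_bigr => u2 _.
  by rewrite /c12; case: ifP => // _; rewrite weight_cat.
pose N u1 := \sum_(k <- iota 0 (2 * reach).+1)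
               cell_mass X1 p1 c1 (c1 u1 + - reach%:Z + k%:Z).
have N_ge0 u1 : 0 <= N u1 by rewrite sumr_ge0 // => k _; apply: cell_mass_ge0.
(* two pieces meeting the same fine cell have coarse cells within [reach] *)
have close j u v : u \in X1 -> v \in X1 -> m u j != 0 -> m v j != 0 ->
    c1 u - reach%:Z <= c1 v < c1 u - reach%:Z + (2 * reach).+1%:Z.
  move=> uX vX; rewrite /m.
  have ex (u1 : seq A) : u1 \in X1 -> cell_mass X2 p2 (c12 u1) j != 0 -> exists2 u2,
      c12 u1 u2 = j & `|pos w2 th' u2| <= radius M.
    move=> _ h; case: (boolP (has (fun u2 => c12 u1 u2 == j) X2)).
      by move=> /hasP[u2 _ /eqP e]; exists u2 => //; apply: pos_le.
    rewrite has_count -leqNgt leqn0 => /eqP h0; move: h.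
    by rewrite /cell_mass big_hasC ?eqxx // has_count h0.
  move=> /(ex _ uX)[u2 + bu] /(ex _ vX)[v2 + bv]; rewrite !c12E //.
  set x := pos w1 th u / _; set y := pos w1 th v / _.
  rewrite -!mulrDl => eu ev.
  have := floor_itv ((x + pos w2 th' u2) / ratios w2).
  have := floor_itv ((y + pos w2 th' v2) / ratios w2).
  rewrite eu ev !ler_pdivlMr // !ltr_pdivrMr // intrD => /andP[v_1 v_2] /andP[u_1 u_2].
  have := ratios_le1 w2 => r2_le1.
  have := floor_itv x; have := floor_itv y.
  rewrite -/(cell w1 th u) -/(cell w1 th v) -/(c1 u) -/(c1 v) !intrD => /andP[y1 y2] /andP[x1 x2].
  move: bu bv v_1 v_2 u_1 u_2; rewrite !ler_norml => /andP[? ?] /andP[? ?].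
  rewrite !mulrDl !mul1r => v_1 v_2 u_1 u_2.
  have hr := reachP.
  have uv : c1 u < c1 v + reach%:Z by rewrite -(ltr_int R) intrD -pmulrn; lra.
  have vu : c1 v < c1 u + reach%:Z by rewrite -(ltr_int R) intrD -pmulrn; lra.
  exact: int_window.
rewrite /Lq_energy (energy_cells s01 _ (wt_ge0 _)).
set S := undup _; have uS : uniq S := undup_uniq _.
have step j : cell_mass (@words A (size (w1 ++ w2))) (weight (prob M) (w1 ++ w2))
     (cell (w1 ++ w2) th) j `^ (1 + s) <=
     \sum_(u1 <- X1) p1 u1 * N u1 `^ s * m u1 j `^ (1 + s).
  rewrite massE (bigID (fun u1 => m u1 j != 0)) /= addrC big1 ?add0r; last first.
    by move=> u1 /negPn /eqP ->; rewrite mulr0.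
  apply: le_trans (jensen_convex s01 _ _ p1_ge0 (m_ge0^~ j)) _.
  rewrite mulr_sumr big_mkcond [leLHS]big_seq [leRHS]big_seq.
  apply: ler_sum => u uX; case: ifP => mu; last first.
    by rewrite !mulr_ge0 ?powR_ge0.
  rewrite mulrCA -mulrA ler_wpM2l // ler_wpM2r ?powR_ge0 // ler_powRs // ?sumr_ge0 //.
  rewrite big_seq_cond -big_seq_cond.
  apply: mass_le_window => // v vX mv; exact: close mu mv.
apply: (le_trans (@ler_sum _ _ _ predT _ _ (fun j _ => step j))).
rewrite exchange_big /=.
(* the energy of one piece: the grid of the second factor, translated *)
have inner u1 : u1 \in X1 ->
    \sum_(j <- S) p1 u1 * N u1 `^ s * m u1 j `^ (1 + s) <=
    p1 u1 * N u1 `^ s * (4 * energy s X2 p2 c2).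
  move=> uX; rewrite -mulr_sumr ler_wpM2l ?mulr_ge0 ?powR_ge0 //.
  apply: le_trans (le_energy s01 _ p2_ge0 _ uS) _.
  have -> : 4 = 2%:R ^+ 2 :> R by rewrite -natrX.
  pose b := Num.floor (pos w1 th u1 / ratios w1 / ratios w2).
  apply: (@energy_le_window _ _ s01 _ _ _ p2_ge0 _ _ (fun j => j - b - 1)) => [x y|u2 u2X].
    by move=> /addIr/addIr.
  rewrite c12E //; set x := _ / ratios w2 in b *; set y := _ / ratios w2.
  rewrite -/(cell w2 th' u2) -/(c2 u2).
  have := floor_itv x; have := floor_itv y; have := floor_itv (x + y).
  rewrite -/b; set g := Num.floor (x + y); set f := Num.floor y.
  rewrite !intrD => /andP[? ?] /andP[? ?] /andP[? ?].
  have g1 : g < b + f + 2 by rewrite -(ltr_int R) !intrD; lra.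
  have g2 : b + f < g + 1 by rewrite -(ltr_int R) !intrD; lra.
  exact: int_floor_sum.
rewrite big_seq; apply: le_trans (ler_sum _ inner) _; rewrite -big_seq -mulr_suml.
have := neighbor_energy_le s01 X1 p1_ge0 c1 (- reach%:Z) (2 * reach).+1.
rewrite -/N => /ler_wpM2r -/(_ (4 * energy s X2 p2 c2)) h.
apply: le_trans (h _) _; first by rewrite mulr_ge0 // energy_ge0.
by apply: eqW; rewrite /submul_const; ring.
Qed.

End ifs.

(** * Averaging over directions *)

(** Project to the direction of [x - y]. *)
Lemma enormB (R : realType) (x y : R * R) : enorm (x - y) <= enorm x + enorm y.
Proof.
have [th h] := polar (x - y).
have e1 : dot (dir th) (dir th) = 1 :> R by rewrite /dot /dir /= -!expr2 cos2Dsin2.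
have -> : enorm (x - y) = dot (x - y) (dir th).
  rewrite {2}h; move: e1; rewrite /dot /dir /GRing.scale /= => e1.
  by rewrite -!mulrA -mulrDr e1 mulr1.
rewrite dotBl; apply: le_trans (ler_norm _) _.
by apply: le_trans (ler_normB _ _) _; rewrite lerD ?dot_dir_le.
Qed.

Section averaging.
Context {R : realType} {I A : finType} (M : planar_ifs R I A) (s : R).
Hypothesis s01 : 0 < s <= 1.
Implicit Types (w : seq I) (u : seq A) (z : R * R) (th : R) (Th : seq R).

(** [nh] stands for the number of directions, up to a small excess.  The
    condition concerns strips of relative width at least [eta] only, since
    finitely many directions cannot be equidistributed at all scales.  Rotating
    all directions does not change it, which makes it hereditary along words. *)
Definition strip_equidistributed Th (nh eta : R) : Prop := forall z d a,
  eta * enorm z <= d ->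
  enorm z * (count (fun th => `|dot z (dir (th - a))| <= d) Th)%:R <= 16 * d * nh.

Definition moment i : R := \sum_a prob M i a `^ (1 + s).

(** For [d = ratios w] this is the sum, over the ways to cut [w] into a prefix
    and a suffix, of the product of the moments of the prefix and of the [s]-th
    power of the ratio of the suffix. *)
Fixpoint energy_bound w (d : R) : R :=
  if w is i :: w' then d `^ s + moment i * energy_bound w' (d / ratio M i) else 1.

(** Lying in the same cell is weakened to lying at distance at most [d]: only the
    distance is a condition on the direction that averages well. *)
Definition close_energy Th w d : R := \sum_(th <- Th) \sum_(u <- @words A (size w))
  weight (prob M) w u * (\sum_(v <- @words A (size w) | `|pos M w th u - pos M w th v| <= d)
    weight (prob M) w v) `^ s.

Definition averaging_const : R := 1 + (16 / gap M) `^ s.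

Let wt_ge0 w u : 0 <= weight (prob M) w u.
Proof. exact/weight_ge0/prob_ge0. Qed.

Lemma Lq_energy_le_close Th w :
  \sum_(th <- Th) Lq_energy M s w th <= close_energy Th w (ratios M w).
Proof.
apply: ler_sum => th _; apply: ler_sum => u _; rewrite ler_wpM2l //.
apply: ler_powRs => //; first exact: cell_mass_ge0.
rewrite /cell_mass big_mkcond [leRHS]big_mkcond; apply: ler_sum => v _.
case: ifP => [/eqP|_]; last by case: ifP.
rewrite /cell => e; have r0 := ratios_gt0 M w.
have := floor_itv (pos M w th u / ratios M w).
have := floor_itv (pos M w th v / ratios M w).
rewrite e !ler_pdivlMr // !ltr_pdivrMr // !intrD !mulrDl !mul1r => /andP[v1 v2] /andP[u1 u2].
by rewrite ifT // ler_norml; apply/andP; split; lra.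
Qed.

Lemma moment_ge0 i : 0 <= moment i.
Proof. by rewrite sumr_ge0 // => a _; rewrite powR_ge0. Qed.

Lemma energy_bound_ge0 w d : 0 <= energy_bound w d.
Proof.
elim: w d => //= i w IH d.
by rewrite addr_ge0 ?powR_ge0 // mulr_ge0 ?moment_ge0.
Qed.

(** Induction on [w].  Pairs of words with the same first letter are copies of
    pairs of words over the rest of [w], seen from rotated directions and at a
    larger scale; they give the factor [moment i].  Pairs with different first
    letters are projections of points at distance at least [gap M], so each is
    close for a proportion at most [16 * d / gap M] of the directions;
    concavity of the [s]-th power turns this into the term [d ^ s]. *)
Lemma close_energy_le w Th (nh eta d : R) : (size Th)%:R <= nh ->
  strip_equidistributed Th nh eta -> 0 <= eta -> 0 < d -> eta * (2 * radius M) <= d ->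
  close_energy Th w d <= averaging_const * nh * energy_bound w d.
Proof.
move=> hsz + eta0; have nh0 : 0 <= nh by apply: le_trans hsz.
have C1 : 1 <= averaging_const by rewrite lerDl powR_ge0.
elim: w Th hsz d => [|i w IH] Th hsz d equi d0 hd.
  rewrite /close_energy /= mulr1; apply: (@le_trans _ _ (1 * nh)); last by rewrite ler_wpM2r.
  rewrite mul1r; apply: le_trans hsz; rewrite -sum1_size natr_sum; apply: ler_sum => th _.
  rewrite big_seq1 big_mkcond /= big_seq1 /weight /= big_nil mul1r.
  by case: ifP => _; rewrite ?powR1 // powR0 // gt_eqF //; case/andP: s01.
have [l0 l1] := andP (ratio_itv M i).
pose Th' := map (fun th => th - angle M i) Th.
have equi' : strip_equidistributed Th' nh eta.
  move=> z e a he; rewrite count_map.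
  apply: le_trans (equi z e (angle M i + a) he); rewrite ler_wpM2l ?enorm_ge0 //.
  by apply: eqW; congr (_%:R); apply: eq_count => th /=; rewrite opprD addrA.
have dl : d <= d / ratio M i by rewrite ler_pdivlMr // ler_piMr // ltW.
have {IH} IH : close_energy Th' w (d / ratio M i) <=
    averaging_const * nh * energy_bound w (d / ratio M i).
  by apply: IH => //; rewrite ?size_map // ?divr_gt0 // (le_trans hd).
pose p := prob M i; pose W := weight (prob M) w; pose X := @words A (size w).
have p0 a : 0 <= p a by apply: prob_ge0.
have W0 u : 0 <= W u by apply: wt_ge0.
(* [Y] collects the words with the same first letter, [Z] the others *)
pose Y th u := \sum_(v <- X | `|pos M w (th - angle M i) u - pos M w (th - angle M i) v|
   <= d / ratio M i) W v.
have Y0 th u : 0 <= Y th u by rewrite sumr_ge0.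
pose close th a u b v := `|pos M (i :: w) th (a :: u) - pos M (i :: w) th (b :: v)| <= d.
pose Z th a u := \sum_(b | b != a) \sum_(v <- X) (close th a u b v)%:R * (p b * W v).
have Z0 th a u : 0 <= Z th a u.
  by rewrite !sumr_ge0 // => b _; rewrite sumr_ge0 // => v _; rewrite !mulr_ge0.
have splitE th a u : \sum_(v <- @words A (size w).+1 |
      `|pos M (i :: w) th (a :: u) - pos M (i :: w) th v| <= d)
       weight (prob M) (i :: w) v = p a * Y th u + Z th a u.
  rewrite big_mkcond sum_words_cons (bigD1 a) //=; congr +%R.
    rewrite /Y mulr_sumr [RHS]big_mkcond; apply: eq_bigr => v _.
    rewrite !pos_cons; set x := pos _ _ _ u; set y := pos _ _ _ v.
    have -> : forall c : R, c + ratio M i * x - (c + ratio M i * y) = ratio M i * (x - y).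
      by move=> c; ring.
    rewrite normrM gtr0_norm // ler_pdivlMr // [`|x - y| * _]mulrC.
    by case: ifP => // _; rewrite weight_cons.
  apply: eq_bigr => b _; apply: eq_bigr => v _; rewrite weight_cons /close.
  by case: ifP => _; rewrite ?mul1r ?mul0r.
have powE th a u : (p a * Y th u + Z th a u) `^ s <= p a `^ s * Y th u `^ s + Z th a u `^ s.
  apply: le_trans (powR_subadd s01 _ _) _; rewrite ?mulr_ge0 //.
  by rewrite powRM.
have tail : \sum_(th <- Th) \sum_a \sum_(u <- X) (p a * W u) * (p a `^ s * Y th u `^ s) =
    moment i * close_energy Th' w (d / ratio M i).
  rewrite /close_energy big_map mulr_sumr; apply: eq_bigr => th _.
  rewrite /moment mulr_suml; apply: eq_bigr => a _; rewrite mulr_sumr; apply: eq_bigr => u _.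
  by rewrite (powR1D s01) //; rewrite /p /W /Y /X; ring.
have head : \sum_(th <- Th) \sum_a \sum_(u <- X) (p a * W u) * Z th a u `^ s <=
    nh * (16 * d / gap M) `^ s.
  rewrite exchange_big /=.
  apply: (@le_trans _ _ (\sum_a \sum_(u <- X) (p a * W u) * (nh * (16 * d / gap M) `^ s))).
    apply: ler_sum => a _; rewrite exchange_big /=; apply: ler_sum => u _.
    rewrite -mulr_sumr; have [->|pa] := eqVneq (p a) 0; first by rewrite !mul0r.
    have {}pa : 0 < p a by rewrite lt_neqAle eq_sym pa p0.
    rewrite ler_wpM2l ?mulr_ge0 //.
    rewrite (eq_bigr (fun th => 1 * Z th a u `^ s)) => [|th _]; last by rewrite mul1r.
    apply: (jensen_concave s01) => //.
    - by rewrite !mulr_ge0 ?invr_ge0 ?(ltW d0) ?(ltW (gap_gt0 M)).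
    - by rewrite big_const_seq iter_addr_0 count_predT.
    under eq_bigr do rewrite mul1r.
    rewrite exchange_big /=.
    apply: (@le_trans _ _ (\sum_(b | b != a) \sum_(v <- X) (16 * d / gap M * nh) * (p b * W v))).
      apply: ler_sum => b ba; rewrite exchange_big /=; apply: ler_sum => v _.
      rewrite -mulr_suml; have [->|pb] := eqVneq (p b) 0; first by rewrite mul0r !mulr0.
      have {}pb : 0 < p b by rewrite lt_neqAle eq_sym pb p0.
      rewrite ler_wpM2r ?mulr_ge0 //.
      have r0 : enorm (0 : R * R) <= radius M by rewrite enorm0 ltW ?radius_gt0.
      pose z := act M (i :: w) (a :: u) 0 - act M (i :: w) (b :: v) 0.
      have gz : gap M <= enorm z by apply: gapP => //; rewrite 1?eq_sym //; apply: act_disk.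
      have zr : enorm z <= 2 * radius M.
        by apply: le_trans (enormB _ _) _; rewrite mulrDl mul1r lerD //; apply: act_disk.
      rewrite mulrAC ler_pdivlMr ?gap_gt0 //; have := equi z d 0.
      have -> : (count (fun th => `|dot z (dir (th - 0))| <= d) Th)%:R =
          \sum_(th <- Th) (close th a u b v)%:R :> R.
        rewrite -sum1_count natr_sum big_mkcond; apply: eq_bigr => th _.
        by rewrite subr0 /close /pos -dotBl; case: ifP.
      move=> h; apply: (le_trans _ (h _)).
        by rewrite mulrC ler_wpM2r // sumr_ge0.
      by apply: le_trans hd; rewrite ler_wpM2l.
    have tn0 : 0 <= 16 * d / gap M * nh.
      by rewrite !mulr_ge0 ?invr_ge0 ?(ltW d0) ?(ltW (gap_gt0 M)).
    apply: (@le_trans _ _ (\sum_b \sum_(v <- X) (16 * d / gap M * nh) * (p b * W v))).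
      rewrite big_mkcond; apply: ler_sum => b _; case: ifP => // _.
      by rewrite sumr_ge0 // => v _; apply: mulr_ge0 tn0 _; apply: mulr_ge0.
    under eq_bigr do rewrite -!mulr_sumr; rewrite -mulr_sumr.
    by rewrite -mulr_suml prob_sum mul1r (sum_weight (prob_ge0 M) w (prob_sum M)) mulr1.
  under eq_bigr do rewrite -mulr_suml -mulr_sumr.
  by rewrite -!mulr_suml prob_sum mul1r (sum_weight (prob_ge0 M) w (prob_sum M)) mul1r.
apply: (@le_trans _ _ (moment i * close_energy Th' w (d / ratio M i) +
    nh * (16 * d / gap M) `^ s)).
  rewrite -tail; apply: le_trans (lerD (lexx _) head).
  rewrite -big_split /=; apply: ler_sum => th _; rewrite -big_split /=.
  rewrite big_allpairs_dep; apply: ler_sum => a _; rewrite -big_split /=.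
  apply: ler_sum => u _; rewrite weight_cons splitE -mulrDr.
  by rewrite ler_wpM2l ?mulr_ge0.
rewrite /= mulrDr [leRHS]addrC lerD //.
  by rewrite mulrCA ler_wpM2l ?moment_ge0.
have -> : 16 * d / gap M = 16 / gap M * d by ring.
rewrite powRM ?divr_ge0 ?(ltW d0) ?(ltW (gap_gt0 M)) // mulrA ler_wpM2r ?powR_ge0 //.
by rewrite mulrC ler_wpM2r // /averaging_const lerDr.
Qed.

End averaging.

(** * Averages along a sequence *)

Section cesaro.
Context {R : realType}.
Implicit Types x y : nat -> R.

Definition cesaro_null x : Prop := forall e : R, 0 < e ->
  \forall n \near \oo, `|\sum_(0 <= i < n) x i| <= e * n%:R.

Lemma cesaro_null_ext x y : x =1 y -> cesaro_null x -> cesaro_null y.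
Proof. by move=> xy; have -> : x = y by apply/funext. Qed.

Lemma cesaro_nullD x y : cesaro_null x -> cesaro_null y ->
  cesaro_null (fun i => x i + y i).
Proof.
move=> hx hy e e0; have e20 : 0 < e / 2 by rewrite divr_gt0.
near=> n; rewrite big_split /=; apply: le_trans (ler_normD _ _) _.
rewrite [leRHS](_ : _ = e / 2 * n%:R + e / 2 * n%:R); last by field.
by rewrite lerD //; [near: n; exact: hx|near: n; exact: hy].
Unshelve. all: by end_near. Qed.

Lemma cesaro_nullZ c x : cesaro_null x -> cesaro_null (fun i => c * x i).
Proof.
move=> hx e e0; have c0 : 0 < `|c| + 1 by rewrite ltr_wpDl.
have e20 : 0 < e / (`|c| + 1) by rewrite divr_gt0.
near=> n; rewrite -mulr_sumr normrM.
have h : `|\sum_(0 <= i < n) x i| <= e / (`|c| + 1) * n%:R by near: n; exact: hx.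
apply: le_trans (ler_wpM2l (normr_ge0 c) h) _.
rewrite mulrA ler_wpM2r // mulrCA ler_piMr ?(ltW e0) // ler_pdivrMr // mul1r.
by rewrite lerDl.
Unshelve. all: by end_near. Qed.

Lemma cesaro_null0 : cesaro_null (fun=> 0).
Proof. by move=> e e0; near=> n; rewrite big1 // normr0 mulr_ge0 // ltW.
Unshelve. all: by end_near. Qed.

Lemma cesaro_null_sum (T : Type) (r : seq T) (x : T -> nat -> R) :
  (forall t, cesaro_null (x t)) -> cesaro_null (fun i => \sum_(t <- r) x t i).
Proof.
move=> h; elim: r => [|t r IH].
  by apply: cesaro_null_ext cesaro_null0 => i; rewrite big_nil.
by apply: cesaro_null_ext (cesaro_nullD (h t) IH) => i; rewrite big_cons.
Qed.

Lemma cesaro_null_bounded x (B : R) :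
  (forall n, `|\sum_(0 <= i < n) x i| <= B) -> cesaro_null x.
Proof.
move=> h e e0; near=> n; apply: le_trans (h n) _.
rewrite -ler_pdivrMl //; near: n; exact: nbhs_infty_ger.
Unshelve. all: by end_near. Qed.

Lemma shift_sum_le x (B : R) n k : (forall i, `|x i| <= B) ->
  `|\sum_(0 <= i < n) x i - \sum_(0 <= i < n) x (i + k)%N| <= 2 * B * k%:R.
Proof.
move=> hB; elim: k => [|k IH].
  rewrite mulr0 (eq_bigr (fun i => x (i + 0)%N)) ?subrr ?normr0 // => i _.
  by rewrite addn0.
have -> : \sum_(0 <= i < n) x (i + k.+1)%N =
    \sum_(0 <= i < n) x (i + k)%N + (x (n + k)%N - x k).
  elim: n {IH} => [|n IH]; first by rewrite !big_nil add0r add0n subrr.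
  by rewrite !big_nat_recr //= IH addSnnS; ring.
rewrite opprD addrA; apply: le_trans (ler_normB _ _) _.
rewrite -[k.+1%:R]natr1 mulrDr mulr1 lerD //; apply: le_trans (ler_normB _ _) _.
by rewrite mulrDl mul1r lerD.
Qed.

(** Averaging over windows of length [K] before summing changes the sum by a
    boundary term only; the sum over a window can then be controlled in mean. *)
Lemma smoothing_le x (B : R) n K : (0 < K)%N -> (forall i, `|x i| <= B) ->
  `|\sum_(0 <= i < n) x i| <=
  K%:R^-1 * \sum_(0 <= i < n) `|\sum_(0 <= k < K) x (i + k)%N| + 2 * B * K%:R.
Proof.
move=> K0 hB; have KR : 0 < K%:R :> R by rewrite ltr0n.
have B0 : 0 <= B by apply: le_trans (hB 0%N).
rewrite -(ler_pM2l KR) mulrDr mulrA divff ?gt_eqF // mul1r.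
have -> : K%:R * `|\sum_(0 <= i < n) x i| = `|\sum_(0 <= k < K) \sum_(0 <= i < n) x i|.
  by rewrite big_const_nat iter_addr_0 subn0 normrMn mulr_natl.
rewrite -[X in `|X|](subrK (\sum_(0 <= k < K) \sum_(0 <= i < n) x (i + k)%N)) addrC.
apply: le_trans (ler_normD _ _) _; rewrite lerD //.
  by rewrite exchange_big /= ler_norm_sum.
rewrite -sumrB; apply: le_trans (ler_norm_sum _ _ _) _.
apply: (@le_trans _ _ (\sum_(0 <= k < K) 2 * B * K%:R)).
  rewrite [leLHS]big_nat [leRHS]big_nat; apply: ler_sum => k /= kK.
  apply: le_trans (shift_sum_le _ _ hB) _; rewrite ler_wpM2l ?mulr_ge0 // ler_nat.
  exact: ltnW.
by rewrite big_const_nat iter_addr_0 subn0 -[leLHS]mulr_natl.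
Qed.

End cesaro.

Definition window (I : Type) (omega : nat -> I) (i L : nat) : seq I :=
  [seq omega j | j <- iota i L].

Lemma size_window (I : Type) (omega : nat -> I) i L : size (window omega i L) = L.
Proof. by rewrite size_map size_iota. Qed.

Lemma window_cat (I : Type) (omega : nat -> I) i L1 L2 :
  window omega i (L1 + L2) = window omega i L1 ++ window omega (i + L1) L2.
Proof. by rewrite /window iotaD map_cat. Qed.

Section frequencies.
Context {R : realType} {I : finType} (r : I -> R) (omega : nat -> I).
Hypothesis r_ge0 : forall a, 0 <= r a.
Hypothesis r_sum : \sum_a r a = 1.

Definition has_word_frequencies : Prop := forall w : seq I,
  cesaro_null (fun i => (window omega i (size w) == w)%:R - \prod_(a <- w) r a).

(** The expectation of [Phi] over [K] independent letters with law [r]. *)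
Fixpoint mean (K : nat) (Phi : seq I -> R) : R :=
  if K is K'.+1 then \sum_a r a * mean K' (fun w => Phi (a :: w)) else Phi [::].

Lemma mean_words K Phi :
  mean K Phi = \sum_(w <- @words I K) (\prod_(a <- w) r a) * Phi w.
Proof.
elim: K Phi => [|K IH] Phi; first by rewrite /= big_seq1 big_nil mul1r.
rewrite /= big_allpairs_dep; apply: eq_bigr => a _; rewrite IH mulr_sumr.
by apply: eq_bigr => w _; rewrite big_cons mulrA.
Qed.

Lemma eq_mean K Phi Psi : Phi =1 Psi -> mean K Phi = mean K Psi.
Proof. by move=> e; have -> : Phi = Psi by apply/funext. Qed.

Lemma meanD K Phi Psi : mean K (fun w => Phi w + Psi w) = mean K Phi + mean K Psi.
Proof. by rewrite !mean_words -big_split /=; apply: eq_bigr => w _; rewrite mulrDr. Qed.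

Lemma meanZ K c Phi : mean K (fun w => c * Phi w) = c * mean K Phi.
Proof. by rewrite !mean_words mulr_sumr; apply: eq_bigr => w _; rewrite mulrCA. Qed.

Lemma mean_cst K c : mean K (fun=> c) = c.
Proof.
elim: K => //= K IH; rewrite (eq_bigr (fun a => r a * c)); last by move=> a _; rewrite IH.
by rewrite -mulr_suml r_sum mul1r.
Qed.

Hypothesis freq : has_word_frequencies.

Lemma cesaro_mean K Phi :
  cesaro_null (fun i => Phi (window omega i K) - mean K Phi).
Proof.
apply: (@cesaro_null_ext _ (fun i => \sum_(w <- @words I K)
  Phi w * ((window omega i (size w) == w)%:R - \prod_(a <- w) r a))); last first.
  by apply: cesaro_null_sum => w; apply: cesaro_nullZ.
move=> i; rewrite mean_words; under eq_bigr do rewrite mulrBr; rewrite sumrB; congr (_ - _).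
  have wK : window omega i K \in @words I K by rewrite -{2}(size_window omega i K) mem_words.
  rewrite (bigD1_seq _ wK (@words_uniq I K)) /= size_window eqxx mulr1 big_seq_cond big1 ?addr0 //.
  move=> w /andP[/size_words -> wn]; rewrite eq_sym (negbTE wn) mulr0 //.
by apply: eq_bigr => w _; rewrite mulrC.
Qed.

Section martingale.
Variable D : I -> R.
Hypothesis D_mean0 : \sum_a r a * D a = 0.

(** A martingale transform: the sum over positions [j] of [D] at the letter in
    position [j] times the weight [Q] of the letters before it
    ([martingaleE]). *)
Fixpoint martingale (Q : seq I -> R) (w : seq I) : R :=
  if w is a :: w' then Q [::] * D a + martingale (fun v => Q (a :: v)) w' else 0.

Lemma martingaleE Q (w : seq I) (x0 : I) : martingale Q w =
  \sum_(0 <= j < size w) Q (take j w) * D (nth x0 w j).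
Proof.
elim: w Q => [|a w IH] Q; first by rewrite big_nil.
by rewrite /= big_nat_recl //= IH.
Qed.

Lemma mean_martingale K Q : mean K (martingale Q) = 0.
Proof.
elim: K Q => [|K IH] Q //=.
rewrite (eq_bigr (fun a => Q [::] * (r a * D a))); first by rewrite -mulr_sumr D_mean0 mulr0.
move=> a _.
by rewrite meanD mean_cst IH addr0 mulrCA.
Qed.

(** Orthogonality of martingale differences: conditioning on the first letter,
    the mixed term vanishes by [mean_martingale]. *)
Lemma mean_martingale2 K Q : (forall v, `|Q v| <= 1) ->
  mean K (fun w => martingale Q w ^+ 2) <= K%:R * \sum_a r a * D a ^+ 2.
Proof.
elim: K Q => [|K IH] Q Q1 /=; first by rewrite expr0n mul0r.
set V := \sum_a r a * D a ^+ 2.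
have V0 : 0 <= V by apply: sumr_ge0 => a _; apply: mulr_ge0; rewrite ?r_ge0 ?sqr_ge0.
have step a : r a * mean K (fun w => (Q [::] * D a + martingale (fun v => Q (a :: v)) w) ^+ 2)
    <= r a * D a ^+ 2 + r a * (K%:R * V).
  rewrite -mulrDr ler_wpM2l //.
  rewrite (@eq_mean _ _ (fun w => (Q [::] * D a) ^+ 2 + ((Q [::] * D a) *+ 2) *
    martingale (fun v => Q (a :: v)) w + martingale (fun v => Q (a :: v)) w ^+ 2)); last first.
    by move=> w; rewrite sqrrD mulrnAl.
  rewrite !meanD meanZ mean_cst mean_martingale mulr0 addr0 lerD //; last by apply: IH.
  rewrite exprMn ler_piMl ?sqr_ge0 // -real_normK ?num_real // expr_le1 //.
apply: (le_trans (ler_sum _ (fun a _ => step a))).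
by rewrite big_split /= -mulr_suml r_sum mul1r -/V -[K.+1%:R]natr1 mulrDl mul1r addrC.
Qed.

(** By [mean_martingale2] the root mean square of the transform is of order
    [sqrt K].  The length [K] is chosen before the weights [Q], which may depend
    on it; [l] leaves room for weights that look [l] letters ahead. *)
Lemma martingale_small l (e : R) : 0 < e -> exists2 K, (0 < K)%N &
  forall Q, (forall v, `|Q v| <= 1) -> \forall n \near \oo,
  \sum_(0 <= i < n) `|martingale Q (window omega i (K + l))| <= e * K%:R * n%:R.
Proof.
move=> e0; set V := \sum_a r a * D a ^+ 2.
have V0 : 0 <= V by apply: sumr_ge0 => a _; apply: mulr_ge0; rewrite ?r_ge0 ?sqr_ge0.
pose c := (V * (1 + l%:R) + 1) / (e / 2) ^+ 2.
have c0 : 0 <= c by rewrite divr_ge0 ?sqr_ge0 // addr_ge0 // mulr_ge0 // addr_ge0.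
pose K := (Num.truncn c).+1; exists K => // Q Q1.
have KR : 0 < K%:R :> R by rewrite ltr0n.
have Kc : c <= K%:R by have /andP[_ /ltW] := truncn_itv c0.
have d0 : 0 < e / 2 * K%:R by rewrite mulr_gt0 // divr_gt0.
have h : (K + l)%:R * V + 1 <= (e / 2 * K%:R) ^+ 2.
  have -> : (e / 2 * K%:R) ^+ 2 = (e / 2) ^+ 2 * K%:R * K%:R by ring.
  apply: (@le_trans _ _ ((e / 2) ^+ 2 * c * K%:R)); last first.
    by rewrite ler_wpM2r // ?ler_wpM2l ?sqr_ge0.
  rewrite /c mulrCA divff ?gt_eqF ?exprn_gt0 ?divr_gt0 // mulr1 natrD.
  have K1 : 1 <= K%:R :> R by rewrite ler1n.
  have lV : l%:R * V <= l%:R * V * K%:R by rewrite ler_peMr // mulr_ge0.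
  have -> : (V * (1 + l%:R) + 1) * K%:R = K%:R * V + l%:R * V * K%:R + K%:R by ring.
  by rewrite mulrDl !lerD.
near=> n.
have hn : `|\sum_(0 <= i < n) (martingale Q (window omega i (K + l)) ^+ 2 -
    mean (K + l) (fun w => martingale Q w ^+ 2))| <= 1 * n%:R.
  by near: n; exact: (@cesaro_mean (K + l) (fun w => martingale Q w ^+ 2) 1 ltr01).
have {}hn : \sum_(0 <= i < n) martingale Q (window omega i (K + l)) ^+ 2 <=
    ((K + l)%:R * V + 1) * n%:R.
  move: hn; rewrite sumrB => /(le_trans (ler_norm _)).
  rewrite big_const_nat iter_addr_0 subn0 -[_ *+ n]mulr_natr lerBlDr => /le_trans; apply.
  by rewrite [leRHS]mulrDl addrC lerD2r ler_wpM2r // mean_martingale2.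
have ineq (u : R) : `|u| <= e / 2 * K%:R + u ^+ 2 / (e / 2 * K%:R).
  have [le|lt] := leP `|u| (e / 2 * K%:R).
    by rewrite ler_wpDr // divr_ge0 ?sqr_ge0 // ltW.
  rewrite ler_wpDl ?(ltW d0) // ler_pdivlMr // -real_normK ?num_real // expr2 ler_wpM2l //.
  exact: ltW.
apply: (le_trans (ler_sum _ (fun i _ => ineq _))).
rewrite big_split /= big_const_nat iter_addr_0 subn0 -mulr_suml -[_ *+ n]mulr_natr.
have -> : e * K%:R * n%:R = e / 2 * K%:R * n%:R + e / 2 * K%:R * n%:R by field.
rewrite lerD2l ler_pdivrMr //; apply: le_trans hn _.
have -> : e / 2 * K%:R * n%:R * (e / 2 * K%:R) = (e / 2 * K%:R) ^+ 2 * n%:R by ring.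
by rewrite ler_wpM2r.
Unshelve. all: by end_near. Qed.

End martingale.

End frequencies.

(** * Equidistribution of the rotations *)

Section windows.
Context {I : Type} (omega : nat -> I).

Lemma take_window i j L : (j <= L)%N -> take j (window omega i L) = window omega i j.
Proof. by move=> jL; rewrite /window -map_take take_iota (minn_idPl jL). Qed.

Lemma drop_window i j L : drop j (window omega i L) = window omega (i + j) (L - j).
Proof. by rewrite /window -map_drop drop_iota addnC. Qed.

Lemma nth_window x0 i j L : (j < L)%N -> nth x0 (window omega i L) j = omega (i + j).
Proof. by move=> jL; rewrite (nth_map 0%N) ?size_iota // nth_iota. Qed.

Lemma window_rcons i L : window omega i L.+1 = rcons (window omega i L) (omega (i + L)).
Proof. by rewrite -addn1 window_cat /= cats1. Qed.

End windows.

Section equidistribution.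
Context {R : realType} {I : finType} (r : I -> R) (omega : nat -> I) (alpha : I -> R).
Hypothesis r_ge0 : forall a, 0 <= r a.
Hypothesis r_sum : \sum_a r a = 1.
Hypothesis freq : has_word_frequencies r omega.

Definition turn (i : nat) : R := \sum_(a <- window omega 0 i) alpha a.

Lemma turnD i k : turn (i + k) = turn i + \sum_(a <- window omega i k) alpha a.
Proof. by rewrite /turn window_cat big_cat. Qed.

Lemma turnS i : turn i.+1 = turn i + alpha (omega i).
Proof. by rewrite -addn1 turnD big_seq1. Qed.

Section frequency.
Variable kappa : R.

(** Within a window that starts at [i], the rotation at [i + k] is the rotation
    at [i] followed by one that depends on the letters of the window alone, so a
    window sum is a combination of two martingale transforms, with weights a
    cosine and a sine. *)
Lemma twisted_noise (D : I -> R) (w : seq I) (phi : R) : \sum_a r a * D a = 0 ->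
  cesaro_null (fun i => cos (kappa * turn i + phi) *
     ((window omega i (size w) == w)%:R * D (omega (i + size w)%N))).
Proof.
move=> D0; set l := size w; set x := fun i => _.
pose Bd := \sum_a `|D a|.
have DB a : `|D a| <= Bd by rewrite /Bd (bigD1 a) //= lerDl sumr_ge0.
have xB i : `|x i| <= Bd.
  rewrite /x !normrM; apply: le_trans (DB (omega (i + l)%N)).
  rewrite mulrA ler_piMl // mulr_ile1 ?cos_max //.
  by case: (_ == _); rewrite ?normr1 ?normr0.
move=> e e0; have e4 : 0 < e / 4 by rewrite divr_gt0.
have [K K0 hK] := martingale_small r_ge0 r_sum freq D0 l e4.
(* the weight of a prefix [v]: it vanishes until [v] can end with [w] *)
pose Q (f : R -> R) v := if (size v < l)%N then 0 else
  f (kappa * \sum_(a <- take (size v - l) v) alpha a) * (drop (size v - l) v == w)%:R.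
have Q1 f : (forall y, `|f y| <= 1) -> forall v, `|Q f v| <= 1.
  move=> f1 v; rewrite /Q; case: ifP => _; first by rewrite normr0.
  by rewrite normrM mulr_ile1 //; case: (_ == _); rewrite ?normr1 ?normr0.
have hQ f i : martingale D (Q f) (window omega i (K + l)) =
    \sum_(0 <= k < K) f (kappa * \sum_(a <- window omega i k) alpha a) *
       ((window omega (i + k) l == w)%:R * D (omega (i + k + l)%N)).
  rewrite (martingaleE D _ _ (omega 0%N)) size_window (@big_cat_nat _ _ _ l) ?leq_addl //=.
  rewrite big_nat big1 ?add0r => [|j /= jl]; last first.
    rewrite take_window; last by apply: leq_trans (ltnW jl) _; rewrite leq_addl.
    by rewrite /Q size_window jl mul0r.
  rewrite -{1}(add0n l) big_addn addnK big_nat [RHS]big_nat; apply: eq_bigr => k /= kK.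
  rewrite take_window ?leq_add2r ?(ltnW kK) // nth_window ?ltn_add2r // /Q size_window.
  rewrite ltnNge leq_addl /= addnK take_window ?leq_addr // drop_window addKn.
  by rewrite -mulrA addnCA addnA [(i + k)%N]addnC.
have xE i : \sum_(0 <= k < K) x (i + k)%N =
    cos (kappa * turn i + phi) * martingale D (Q cos) (window omega i (K + l)) -
    sin (kappa * turn i + phi) * martingale D (Q sin) (window omega i (K + l)).
  rewrite !hQ [X in _ = X - _]mulr_sumr [X in _ = _ - X]mulr_sumr -sumrB; apply: eq_bigr => k _.
  rewrite /x turnD mulrDr addrAC cosD; ring.
near=> n.
have hc : \sum_(0 <= i < n) `|martingale D (Q cos) (window omega i (K + l))| <=
   e / 4 * K%:R * n%:R by near: n; apply: hK; apply: Q1; exact: cos_max.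
have hs : \sum_(0 <= i < n) `|martingale D (Q sin) (window omega i (K + l))| <=
   e / 4 * K%:R * n%:R by near: n; apply: hK; apply: Q1; exact: sin_max.
have hn : 2 * Bd * K%:R <= e / 2 * n%:R.
  by rewrite -ler_pdivrMl ?divr_gt0 //; near: n; exact: nbhs_infty_ger.
apply: le_trans (smoothing_le n K0 xB) _.
have -> : e * n%:R = K%:R^-1 * (e / 4 * K%:R * n%:R + e / 4 * K%:R * n%:R) + e / 2 * n%:R.
  by field; rewrite pnatr_eq0 -lt0n.
rewrite lerD // ler_wpM2l ?invr_ge0 //.
apply: le_trans (lerD hc hs); rewrite -big_split /=; apply: ler_sum => i _.
rewrite xE; apply: le_trans (ler_normB _ _) _; rewrite !normrM.
by rewrite lerD // ler_piMl // ?cos_max ?sin_max.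
Unshelve. all: by end_near. Qed.

Hypothesis aperiodic : \sum_a r a * cos (kappa * alpha a) != 1.

(** Replacing one rotation by its mean, the complex number [c1 + i c2], costs a
    null sequence, and so does a shift by one step.  Thus multiplication by
    [1 - (c1 + i c2)] sends the sequence to a null sequence; this number is not
    zero and [d] is its squared modulus. *)
Lemma twisted_mean phi : cesaro_null (fun i => cos (kappa * turn i + phi)).
Proof.
pose c1 := \sum_a r a * cos (kappa * alpha a).
pose c2 := \sum_a r a * sin (kappa * alpha a).
have centered (f : I -> R) : \sum_a r a * (f a - \sum_b r b * f b) = 0.
  by under eq_bigr do rewrite mulrBr; rewrite sumrB -mulr_suml r_sum mul1r subrr.
have step psi : cesaro_null (fun i => (1 - c1) * cos (kappa * turn i + psi) +
    c2 * sin (kappa * turn i + psi)).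
  have tele : cesaro_null (fun i => cos (kappa * turn i.+1 + psi) - cos (kappa * turn i + psi)).
    apply: (@cesaro_null_bounded _ _ 2) => n.
    rewrite (telescope_sumr (fun i => cos (kappa * turn i + psi))) //.
    by apply: le_trans (ler_normB _ _) _; rewrite -natr1 lerD ?cos_max.
  have n1 := twisted_noise [::] psi (centered (fun a => cos (kappa * alpha a))).
  have n2 := twisted_noise [::] (psi - pi / 2) (centered (fun a => sin (kappa * alpha a))).
  apply: cesaro_null_ext (cesaro_nullD (cesaro_nullD n1 (cesaro_nullZ (-1) n2))
    (cesaro_nullZ (-1) tele)) => i /=.
  have -> : kappa * turn i.+1 + psi = kappa * turn i + psi + kappa * alpha (omega i).
    by rewrite turnS; ring.
  rewrite addn0 addrA cosBpihalf [cos (_ + _ + _)]cosD -/c1 -/c2; ring.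
pose d := (1 - c1) ^+ 2 + c2 ^+ 2.
have d0 : d != 0.
  by rewrite gt_eqF // ltr_wpDr ?sqr_ge0 // exprn_even_gt0 //= subr_eq0 eq_sym aperiodic.
apply: cesaro_null_ext (cesaro_nullZ d^-1 (cesaro_nullD (cesaro_nullZ (1 - c1) (step phi))
  (cesaro_nullZ (- c2) (step (phi - pi / 2))))) => i /=.
by rewrite !addrA cosBpihalf sinBpihalf /d; field.
Qed.

(** Letters are removed from the end of [w], each replaced by its probability. *)
Lemma twisted_word_mean (w : seq I) phi : cesaro_null (fun i =>
  cos (kappa * turn i + phi) * (window omega i (size w) == w)%:R).
Proof.
elim/last_ind: w phi => [|w a IH] phi.
  by apply: cesaro_null_ext (twisted_mean phi) => i; rewrite mulr1.
pose D b : R := (b == a)%:R - r a.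
have D0 : \sum_b r b * D b = 0.
  rewrite /D; under eq_bigr do rewrite mulrBr; rewrite sumrB -mulr_suml r_sum mul1r.
  rewrite (bigD1 a) //= eqxx mulr1 big1 ?addr0 ?subrr // => b /negbTE ->.
  by rewrite mulr0.
apply: cesaro_null_ext (cesaro_nullD (cesaro_nullZ (r a) (IH phi)) (twisted_noise w phi D0)) => i.
rewrite size_rcons window_rcons eqseq_rcons /D -mulnb natrM.
by ring.
Qed.

End frequency.

Lemma norm_sin_mul (x : R) (j : nat) : `|sin (j%:R * x)| <= j%:R * `|sin x|.
Proof.
elim: j => [|j IH]; first by rewrite !mul0r sin0 normr0.
rewrite -natr1 !mulrDl !mul1r sinD; apply: le_trans (ler_normD _ _) _.
rewrite !normrM lerD //.
  by apply: le_trans IH; rewrite ler_piMr // cos_max.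
by rewrite ler_piMl // cos_max.
Qed.

Lemma fejer_expand (J : nat) (x : R) :
  (\sum_(0 <= j < J) cos (2 * j%:R * x)) ^+ 2 + (\sum_(0 <= j < J) sin (2 * j%:R * x)) ^+ 2 =
  \sum_(0 <= j < J) \sum_(0 <= k < J) cos (2 * (j%:R - k%:R) * x).
Proof.
rewrite !expr2 !mulr_suml -big_split /=; apply: eq_bigr => j _.
rewrite !mulr_sumr -big_split /=; apply: eq_bigr => k _.
by rewrite mulrBr mulrBl cosB.
Qed.

(** If [|sin x|] is at most [1 / (2 J)], then [cos (2 j x)] is at least one half
    for all [j < J]. *)
Lemma fejer_lower (J : nat) (x : R) : 2 * J%:R * `|sin x| <= 1 ->
  J%:R ^+ 2 / 4 <= \sum_(0 <= j < J) \sum_(0 <= k < J) cos (2 * (j%:R - k%:R) * x).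
Proof.
move=> h; rewrite -fejer_expand.
apply: (@le_trans _ _ ((\sum_(0 <= j < J) cos (2 * j%:R * x)) ^+ 2)); last first.
  by rewrite lerDl sqr_ge0.
have -> : J%:R ^+ 2 / 4 = (J%:R / 2) ^+ 2 :> R by field.
have cos_ge j : (j < J)%N -> 2^-1 <= cos (2 * j%:R * x).
  move=> jJ; have J0 : 0 < J%:R :> R by rewrite ltr0n (leq_ltn_trans _ jJ).
  have -> : 2 * j%:R * x = (j%:R * x) *+ 2 by rewrite mulr2n; ring.
  rewrite cos_mulr2n cos2sin2.
  have sj : `|sin (j%:R * x)| <= 2^-1.
    apply: le_trans (norm_sin_mul _ _) _.
    apply: (@le_trans _ _ (J%:R * `|sin x|)); first by rewrite ler_wpM2r // ler_nat ltnW.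
    by rewrite -[2^-1]mul1r ler_pdivlMr // mulrC mulrA.
  have : sin (j%:R * x) ^+ 2 <= 4^-1.
    have -> : 4^-1 = 2^-1 ^+ 2 :> R by field.
    by rewrite -real_normK ?num_real // ler_sqr ?nnegrE ?invr_ge0.
  have -> : forall y : R, (1 - y) *+ 2 - 1 = 1 - 2 * y by move=> y; ring.
  by move: (sin _ ^+ 2) => y; lra.
have sum_ge : J%:R / 2 <= \sum_(0 <= j < J) cos (2 * j%:R * x).
  apply: (@le_trans _ _ (\sum_(0 <= j < J) 2^-1)).
    by rewrite big_const_nat iter_addr_0 subn0 -[leRHS]mulr_natl.
  rewrite big_nat [leRHS]big_nat; apply: ler_sum => j /= jJ; exact: cos_ge.
have J20 : 0 <= J%:R / 2 :> R by rewrite divr_ge0.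
by rewrite ler_sqr ?nnegrE // (le_trans J20).
Qed.

(** The Fejer kernel of order [J] is at least [J ^ 2 / 4] on the strip, while its
    sum over the occurrences of [w] is [J] times their number, up to the null
    sums of its nonconstant frequencies.  Uniformity in [x] holds because [x]
    only rotates the pairs formed by a sum of cosines and a sum of sines. *)
Lemma strip_count (J : nat) (w : seq I) (e : R) : (0 < J)%N -> 0 < e ->
  (forall m, (0 < m)%N -> \sum_a r a * cos (2 * m%:R * alpha a) != 1) ->
  \forall n \near \oo, forall x : R,
  J%:R * (count (fun i => (window omega i (size w) == w) &&
      (2 * J%:R * `|sin (x - turn i)| <= 1)) (iota 0 n))%:R <=
  4 * ((count (fun i => window omega i (size w) == w) (iota 0 n))%:R + e * n%:R).
Proof.
move=> J0 e0 aper; have JR : 0 < J%:R :> R by rewrite ltr0n.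
have aper' j k : j != k -> \sum_a r a * cos (2 * (j%:R - k%:R) * alpha a) != 1.
  move=> jk; wlog kj : j k jk / (k < j)%N => [hw|].
    have [|jk'] := ltnP k j; first exact: hw.
    have kj : (j < k)%N by rewrite ltn_neqAle jk.
    have := hw k j; rewrite eq_sym => /(_ jk kj).
    suff -> : \sum_a r a * cos (2 * (k%:R - j%:R) * alpha a) =
        \sum_a r a * cos (2 * (j%:R - k%:R) * alpha a) by [].
    apply: eq_bigr => a _; rewrite -cosN; congr (_ * cos _); ring.
  by have := aper (j - k)%N; rewrite subn_gt0 kj natrB ?(ltnW kj) // => /(_ isT).
pose ind i : R := (window omega i (size w) == w)%:R.
pose e' := e / (2 * J%:R).
have e'0 : 0 < e' by rewrite divr_gt0 // mulr_gt0.
have small j k : j != k -> \forall n \near \oo, forall x : R,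
    `|\sum_(0 <= i < n) ind i * cos (2 * (j%:R - k%:R) * (x - turn i))| <= 2 * e' * n%:R.
  move=> jk; set ka := 2 * (j%:R - k%:R).
  have h phi := @twisted_word_mean ka (aper' _ _ jk) w phi e' e'0.
  near=> n => x.
  have h1 : `|\sum_(0 <= i < n) cos (ka * turn i + 0) * ind i| <= e' * n%:R.
    by near: n; exact: h.
  have h2 : `|\sum_(0 <= i < n) cos (ka * turn i + - (pi / 2)) * ind i| <= e' * n%:R.
    by near: n; exact: h.
  have -> : \sum_(0 <= i < n) ind i * cos (ka * (x - turn i)) =
     cos (ka * x) * (\sum_(0 <= i < n) cos (ka * turn i + 0) * ind i) +
     sin (ka * x) * (\sum_(0 <= i < n) cos (ka * turn i + - (pi / 2)) * ind i).
    rewrite !big_distrr /= -big_split /=; apply: eq_bigr => i _.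
    by rewrite addr0 cosBpihalf mulrBr cosB; ring.
  apply: le_trans (ler_normD _ _) _; rewrite !normrM.
  have -> : 2 * e' * n%:R = e' * n%:R + e' * n%:R by ring.
  apply: lerD.
    by apply: le_trans h1; rewrite ler_piMl // cos_max.
  by apply: le_trans h2; rewrite ler_piMl // sin_max.
have all_small : \forall n \near \oo, forall j k : 'I_J, j != k -> forall x : R,
    `|\sum_(0 <= i < n) ind i * cos (2 * (j%:R - k%:R) * (x - turn i))| <= 2 * e' * n%:R.
  apply: filter_forall => j; apply: filter_forall => k.
  case: (eqVneq j k) => [->|jk]; first by near=> n.
  near=> n => _; near: n; exact: small.
near=> n => x.
have hs : forall j k : 'I_J, j != k -> forall x : R,
    `|\sum_(0 <= i < n) ind i * cos (2 * (j%:R - k%:R) * (x - turn i))| <= 2 * e' * n%:R.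
  by near: n; exact: all_small.
have countE (a : pred nat) : (count a (iota 0 n))%:R = \sum_(0 <= i < n | a i) 1 :> R.
  by rewrite -sum1_count natr_sum /index_iota subn0.
rewrite !countE; set cnt := \sum_(_ <= _ < _ | _) 1; set nw := \sum_(_ <= _ < _ | _) 1.
pose F i := \sum_(0 <= j < J) \sum_(0 <= k < J) cos (2 * (j%:R - k%:R) * (x - turn i)).
have F0 i : 0 <= F i by rewrite /F -fejer_expand addr_ge0 ?sqr_ge0.
have low : J%:R ^+ 2 / 4 * cnt <= \sum_(0 <= i < n) ind i * F i.
  rewrite /cnt big_mkcond mulr_sumr.
  apply: ler_sum => i _; rewrite /ind; case: eqP => _ /=; last by rewrite mul0r mulr0.
  rewrite mul1r; case: ifP => h; last by rewrite mulr0.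
  by rewrite mulr1; apply: fejer_lower.
have up : \sum_(0 <= i < n) ind i * F i <= J%:R * (nw + e * n%:R).
  have -> : \sum_(0 <= i < n) ind i * F i = \sum_(j < J) \sum_(k < J)
     \sum_(0 <= i < n) ind i * cos (2 * (j%:R - k%:R) * (x - turn i)).
    under [RHS]eq_bigr do rewrite exchange_big /=.
    rewrite exchange_big /=; apply: eq_bigr => i _; rewrite /F big_mkord mulr_sumr.
    by apply: eq_bigr => j _; rewrite big_mkord mulr_sumr.
  apply: (@le_trans _ _ (\sum_(j < J) (nw + e * n%:R))); last first.
    by rewrite big_const_ord iter_addr_0 [leRHS]mulr_natl.
  apply: ler_sum => j _; rewrite (bigD1 j) //=; apply: lerD.
    rewrite /nw [leRHS]big_mkcond; apply: ler_sum => i _.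
    by rewrite subrr mulr0 mul0r cos0 mulr1 /ind; case: ifP.
  apply: (@le_trans _ _ (\sum_(k < J) 2 * e' * n%:R)).
    rewrite big_mkcond; apply: ler_sum => k _; case: ifP => kj.
      by apply: le_trans (ler_norm _) _; apply: hs; rewrite eq_sym.
    by rewrite !mulr_ge0 // ltW.
  rewrite big_const_ord iter_addr_0 -[leLHS]mulr_natl /e'.
  by apply: eqW; field; rewrite gt_eqF.
have := le_trans low up.
have -> : J%:R ^+ 2 / 4 * cnt = J%:R * (J%:R * cnt / 4) by field.
by rewrite ler_pM2l // ler_pdivrMr // [_ * 4]mulrC.
Unshelve. all: by end_near. Qed.

End equidistribution.

(** * Estimates for blocks *)

Section subadditive.
Context {R : realType} (g : nat -> nat -> R) (ka : R).
Hypothesis g_le0 : forall i n, g i n <= 0.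
Hypothesis g_sub : forall i n1 n2, g i (n1 + n2) <= ka + g i n1 + g (i + n1) n2.

Lemma subadditive_blocks i L T :
  g i (T * L) <= \sum_(0 <= t < T) (g (i + t * L) L + ka).
Proof.
elim: T => [|T IH]; first by rewrite big_nil.
rewrite big_nat_recr //= mulSn addnC; apply: le_trans (g_sub _ _ _) _.
by rewrite [ka + _]addrC -addrA lerD // addrC.
Qed.

Lemma sum_offsets (F : nat -> R) L T :
  \sum_(0 <= i < L) \sum_(0 <= t < T) F (i + t * L)%N = \sum_(0 <= i < T * L) F i.
Proof.
elim: T => [|T IH].
  by rewrite mul0n [RHS]big_nil big1 // => i _; rewrite big_nil.
under eq_bigr do rewrite big_nat_recr //=.
rewrite big_split /= IH [RHS](@big_cat_nat _ _ _ (T * L)) //=; last by rewrite mulSn leq_addl.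
congr (_ + _); rewrite -{2}(add0n (T * L)%N) big_addn mulSn addnK.
by [].
Qed.

Hypothesis ka_ge0 : 0 <= ka.

(** Cut at the multiples of [L] shifted by [i], and average over the [L] possible
    shifts: every window of length [L] occurs once. *)
Lemma subadditive_average L T d :
  L%:R * g 0 (T.+1 * L + d) <=
  \sum_(0 <= i < T * L) g i L + ka * (T * L)%:R + 3 * ka * L%:R.
Proof.
have one i : (i < L)%N -> g 0 (T.+1 * L + d) <=
    \sum_(0 <= t < T) (g (i + t * L) L + ka) + 3 * ka.
  move=> iL.
  have -> : (T.+1 * L + d = i + (T * L + (L - i + d)))%N by rewrite mulSn; lia.
  apply: le_trans (g_sub _ _ _) _.
  have h0 := g_le0 0 i; have h1 := g_sub (0 + i) (T * L) (L - i + d).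
  have h2 := g_le0 (0 + i + T * L) (L - i + d).
  have h3 := subadditive_blocks i L T.
  rewrite !add0n in h1 h2 *; move: h3; set S := \sum_(_ <= _ < _) _ => h3.
  have k0 := ka_ge0; move: (g 0 i) (g i (T * L)) (g i (T * L + (L - i + d))) h0 h1 h3.
  by move: (g (i + T * L) _) h2 => ? ? ? ? ?; lra.
apply: (@le_trans _ _ (\sum_(0 <= i < L) (\sum_(0 <= t < T) (g (i + t * L) L + ka) + 3 * ka))).
  have -> : L%:R * g 0 (T.+1 * L + d) = \sum_(0 <= i < L) g 0 (T.+1 * L + d).
    by rewrite big_const_nat iter_addr_0 subn0 mulr_natl.
  by rewrite big_nat [leRHS]big_nat; apply: ler_sum => i /= iL; apply: one.
rewrite big_split /= (sum_offsets (fun i => g i L + ka)) big_split /=.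
by rewrite !big_const_nat !iter_addr_0 !subn0 -[ka *+ _]mulr_natr -[(3 * ka) *+ _]mulr_natr.
Qed.

End subadditive.

Section deviations.
Context {R : realType} {I : finType} (r : I -> R) (omega : nat -> I).
Hypothesis r_ge0 : forall a, 0 <= r a.
Hypothesis r_sum : \sum_a r a = 1.
Hypothesis freq : has_word_frequencies r omega.

(** The deviations of all subblocks of a block are dominated simultaneously by
    the sum of the absolute values of short block averages over the block, by
    [smoothing_le]; this takes the place of a maximal inequality. *)
Lemma block_deviation (D : I -> R) (e : R) : \sum_a r a * D a = 0 -> 0 < e ->
  exists2 c : R, 0 <= c & exists2 dev : nat -> nat -> R,
    (forall i L l n, (l + n <= L)%N ->
       `|\sum_(0 <= j < n) D (omega (i + l + j)%N)| <= dev i L) &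
    forall L, \forall n \near \oo, \sum_(0 <= i < n) dev i L <= (e * L%:R + c) * n%:R.
Proof.
move=> D0 e0; have e20 : 0 < e / 2 by rewrite divr_gt0.
have [K K0 hK] := martingale_small r_ge0 r_sum freq D0 0 e20.
pose B := \sum_a `|D a|.
have DB a : `|D a| <= B by rewrite /B (bigD1 a) //= lerDl sumr_ge0.
have B0 : 0 <= B by rewrite sumr_ge0.
have KR : 0 < K%:R :> R by rewrite ltr0n.
pose m j := `|\sum_(0 <= k < K) D (omega (j + k)%N)|.
have m0 j : 0 <= m j by apply: normr_ge0.
exists (2 * B * K%:R); first by rewrite !mulr_ge0.
exists (fun i L => K%:R^-1 * \sum_(0 <= j < L) m (i + j)%N + 2 * B * K%:R).
  move=> i L l n lnL.
  apply: le_trans (smoothing_le n K0 (fun j => DB (omega (i + l + j)%N))) _.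
  rewrite lerD2r ler_wpM2l ?invr_ge0 //.
  rewrite [leRHS](@big_cat_nat _ _ _ l) //=; last by apply: leq_trans lnL; rewrite leq_addr.
  rewrite ler_wpDl ?sumr_ge0 //.
  rewrite [leRHS](@big_cat_nat _ _ _ (l + n)) //= ?leq_addr // ler_wpDr ?sumr_ge0 //.
  rewrite [leRHS](_ : _ = \sum_(0 <= j < n) m (i + (j + l))%N); last first.
    by rewrite -{1}(add0n l) big_addn addKn.
  apply: eqW; apply: eq_bigr => j _.
  by rewrite /m; congr `|_|; apply: eq_bigr => k _; congr (D (omega _)); lia.
move=> L.
have [n0 _ hn0] : \forall n \near \oo, \sum_(0 <= i < n) m i <= e / 2 * K%:R * n%:R.
  have := hK (fun=> 1) (fun=> eqW (normr1 _)); apply: filterS => n'.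
  apply: le_trans; apply: eqW; apply: eq_bigr => i _; rewrite /m.
  rewrite (martingaleE D _ _ (omega 0%N)) size_window addn0; congr `|_|.
  by rewrite big_nat [RHS]big_nat; apply: eq_bigr => k /= kK; rewrite mul1r nth_window.
near=> n.
have h1 : \sum_(0 <= i < n + L) m i <= e / 2 * K%:R * (n + L)%:R.
  apply: hn0 => /=; apply: leq_trans (leq_addr _ _).
  by near: n; exact: nbhs_infty_ge.
have nL : (L <= n)%N by near: n; exact: nbhs_infty_ge.
rewrite big_split /= -mulr_sumr big_const_nat iter_addr_0 subn0 [leRHS]mulrDl.
rewrite -[(2 * B * K%:R) *+ n]mulr_natr lerD2r exchange_big /=.
apply: (@le_trans _ _ (K%:R^-1 * \sum_(0 <= j < L) (e / 2 * K%:R * (n + L)%:R))).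
  rewrite ler_wpM2l ?invr_ge0 // big_nat [leRHS]big_nat; apply: ler_sum => j /= jL.
  apply: le_trans h1.
  rewrite [leRHS](@big_cat_nat _ _ _ j) //=; last by lia.
  rewrite ler_wpDl ?sumr_ge0 //.
  rewrite [leRHS](@big_cat_nat _ _ _ (j + n)) //=; [|lia|lia].
  rewrite ler_wpDr ?sumr_ge0 //.
  rewrite [leRHS](_ : _ = \sum_(0 <= i < n) m (i + j)%N) //.
  by rewrite -{1}(add0n j) big_addn addKn.
rewrite big_const_nat iter_addr_0 subn0 -[_ *+ L]mulr_natr natrD.
have -> : K%:R^-1 * (e / 2 * K%:R * (n%:R + L%:R) * L%:R) = (e / 2 * L%:R) * (n%:R + L%:R).
  by field; rewrite gt_eqF.
have -> : e * L%:R * n%:R = (e / 2 * L%:R) * (n%:R + n%:R) by field.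
apply: ler_wpM2l; first by rewrite mulr_ge0 // ltW.
by rewrite lerD2l ler_nat.
Unshelve. all: by end_near. Qed.

End deviations.

Section block_estimates.
Context {R : realType} {I A : finType} (M : planar_ifs R I A) (s : R).
Hypothesis s01 : 0 < s <= 1.
Context (r : I -> R) (omega : nat -> I).
Hypothesis r_ge0 : forall a, 0 <= r a.
Hypothesis r_sum : \sum_a r a = 1.
Hypothesis freq : has_word_frequencies r omega.
Hypothesis aperiodic : forall m, (0 < m)%N ->
  \sum_a r a * cos (2 * m%:R * angle M a) != 1.

Local Notation phase := (turn omega (angle M)).

Lemma moment_gt0 i : 0 < moment M s i.
Proof.
have s1 : 1 + s != 0 by case/andP: s01 => s0 _; rewrite gt_eqF // addr_gt0.
rewrite lt_neqAle moment_ge0 andbT.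
apply/eqP => /esym /eqP; rewrite psumr_eq0 => [/allP h|a _]; last exact: powR_ge0.
have := prob_sum M i; rewrite big1 => [/esym /eqP|a _]; first by rewrite oner_eq0.
by have := h a (mem_index_enum _); rewrite powR_eq0 => /andP[/eqP].
Qed.

Lemma moment_le1 i : moment M s i <= 1.
Proof.
rewrite -(prob_sum M i); apply: ler_sum => a _; rewrite (powR1D s01) ?prob_ge0 //.
rewrite ler_piMr ?prob_ge0 //.
have -> : 1 = 1 `^ s :> R by rewrite powR1.
apply: ler_powRs; rewrite ?prob_ge0 //.
by rewrite -(prob_sum M i) (bigD1 a) //= lerDl sumr_ge0 // => b _; apply: prob_ge0.
Qed.

(** The sum described at [energy_bound] has [(size w).+1] terms. *)
Lemma energy_bound_le w (T : R) :
  (forall w1 w2, w = w1 ++ w2 ->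
    \sum_(i <- w1) ln (moment M s i) + \sum_(i <- w2) s * ln (ratio M i) <= T) ->
  energy_bound M s w (ratios M w) <= (size w).+1%:R * expR T.
Proof.
elim: w T => [|i w IH] T h /=.
  have := h [::] [::] erefl; by rewrite !big_nil addr0 mul1r -[X in X <= expR T]expR0 ler_expR.
have [l0 l1] := andP (ratio_itv M i); have m0 := moment_gt0 i.
have -> : ratios M (i :: w) / ratio M i = ratios M w.
  by rewrite /ratios big_cons mulrC mulKf // gt_eqF.
rewrite -[(size w).+2%:R]natr1 mulrDl mul1r addrC lerD //.
  have -> : expR T = moment M s i * expR (T - ln (moment M s i)).
    by rewrite expRD expRN lnK ?posrE // mulrCA divff ?gt_eqF // mulr1.
  rewrite mulrCA ler_pM2l //; apply: IH => w1 w2 e.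
  have := h (i :: w1) w2; rewrite e big_cons => /(_ erefl); lra.
have := h [::] (i :: w) erefl; rewrite big_nil add0r -ler_expR; apply: le_trans.
have rw := ratios_gt0 M (i :: w).
rewrite -[leLHS]lnK ?posrE ?powR_gt0 // ler_expR ln_powR -mulr_sumr.
rewrite ler_pM2l; last by case/andP: s01.
rewrite /ratios; elim: (i :: w) => [|j v IHv]; first by rewrite !big_nil ln1.
rewrite !big_cons lnM ?posrE ?lerD //; [by case/andP: (ratio_itv M j)|exact: ratios_gt0].
Qed.

(** A strip of relative width [d / |z|] is the one of [strip_count] for the
    largest [J] below [|z| / (2 d)].  As only relative widths above [eta]
    matter, finitely many [J] occur, whence a common threshold for [n]. *)
Lemma strip_equidistributed_window (w : seq I) (eta e : R) : 0 < eta -> 0 < e ->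
  \forall n \near \oo, forall th, strip_equidistributed
   [seq th - phase i | i <- iota 0 n & window omega i (size w) == w]
   ((count (fun i => window omega i (size w) == w) (iota 0 n))%:R + e * n%:R) eta.
Proof.
move=> eta0 e0; pose Jmax := (Num.truncn (eta^-1)).+1.
have all_J : \forall n \near \oo, forall J : 'I_Jmax, (0 < J)%N -> forall x : R,
  J%:R * (count (fun i => (window omega i (size w) == w) &&
      (2 * J%:R * `|sin (x - phase i)| <= 1)) (iota 0 n))%:R <=
  4 * ((count (fun i => window omega i (size w) == w) (iota 0 n))%:R + e * n%:R).
  apply: filter_forall => J; case: (posnP J) => [J0|J0]; first by near=> n.
  near=> n => _; near: n; exact: (strip_count r_ge0 r_sum freq w J0 e0 aperiodic).
near=> n => th z d a zd.
have hJ : forall J : 'I_Jmax, (0 < J)%N -> forall x : R,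
  J%:R * (count (fun i => (window omega i (size w) == w) &&
      (2 * J%:R * `|sin (x - phase i)| <= 1)) (iota 0 n))%:R <=
  4 * ((count (fun i => window omega i (size w) == w) (iota 0 n))%:R + e * n%:R).
  by near: n; exact: all_J.
set nw := count _ (iota 0 n) in hJ *.
have nh0 : 0 <= nw%:R + e * n%:R by rewrite addr_ge0 // mulr_ge0 // ltW.
have d0 : 0 <= d by apply: le_trans zd; rewrite mulr_ge0 ?enorm_ge0 // ltW.
have z0 := enorm_ge0 z.
rewrite count_map count_filter.
set cnt := count _ _.
have [zd2|dz] := leP (enorm z) (2 * d).
  apply: (@le_trans _ _ (2 * d * nw%:R)).
    apply: ler_pM => //; rewrite ler_nat /cnt /nw; apply: sub_count => i /=.
    by case/andP.
  apply: (@le_trans _ _ (2 * d * (nw%:R + e * n%:R))).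
    by rewrite ler_wpM2l ?mulr_ge0 // lerDl mulr_ge0 // ltW.
  by rewrite ler_wpM2r // ler_wpM2r // ler_nat.
have zp : 0 < enorm z by apply: le_lt_trans dz; rewrite mulr_ge0.
have dp : 0 < d by apply: lt_le_trans zd; rewrite mulr_gt0.
have q0 : 0 <= enorm z / (2 * d) by rewrite divr_ge0 // mulr_ge0.
pose J := Num.truncn (enorm z / (2 * d)).
have /andP[J1 J2] := truncn_itv q0; rewrite -/J in J1 J2.
have q1 : 1 < enorm z / (2 * d) by rewrite ltr_pdivlMr ?mulr_gt0 // mul1r.
have Jpos : (0 < J)%N by rewrite /J truncn_gt0 ltW.
have JR : 0 < J%:R :> R by rewrite ltr0n.
have Jm : (J < Jmax)%N.
  rewrite ltnS /J; apply: le_truncn; rewrite ler_pdivrMr ?mulr_gt0 //.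
  rewrite ler_pdivlMl //; apply: le_trans zd _.
  by rewrite ler_peMl // ?ler1n.
have [be zbe] := polar z.
have := hJ (Ordinal Jm) Jpos (th - a - be + pi / 2).
set cnt' := count _ _ => /= h.
have cc : (cnt <= cnt')%N.
  apply: sub_count => i /= /andP[hd ->]; rewrite andTb.
  have e1 : dot z (dir (th - phase i - a)) = enorm z * sin (th - a - be + pi / 2 - phase i).
    have -> : th - a - be + pi / 2 - phase i = th - phase i - a - be + pi / 2 by ring.
    rewrite {1}zbe sinDpihalf; move: (enorm z) (th - phase i - a) => n' x.
    by rewrite cosB /dot /dir /= /GRing.scale /=; ring.
  move: hd; rewrite e1 normrM (ger0_norm z0) => hd.
  move: J1; rewrite ler_pdivlMr ?mulr_gt0 // => J1.
  rewrite -(ler_pM2l dp) mulr1; apply: le_trans hd.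
  have -> : d * (2 * J%:R * `|sin (th - a - be + pi / 2 - phase i)|) =
     J%:R * (2 * d) * `|sin (th - a - be + pi / 2 - phase i)| by ring.
  by rewrite ler_wpM2r.
have {}h : J%:R * cnt%:R <= 4 * (nw%:R + e * n%:R).
  by apply: le_trans h; rewrite ler_wpM2l // ler_nat.
have zJ : enorm z <= 4 * d * J%:R.
  move: J2; rewrite ltr_pdivrMr ?mulr_gt0 // => /ltW /le_trans; apply.
  have J1' : 1 <= J%:R :> R by rewrite ler1n.
  have -> : 4 * d * J%:R = (J%:R + J%:R) * (2 * d) by ring.
  by rewrite ler_wpM2r ?mulr_ge0 // -natr1 lerD2l.
apply: (@le_trans _ _ (4 * d * J%:R * cnt%:R)); first by rewrite ler_wpM2r.
have -> : 16 * d * (nw%:R + e * n%:R) = 4 * d * (4 * (nw%:R + e * n%:R)) by ring.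
by rewrite -mulrA ler_wpM2l ?mulr_ge0.
Unshelve. all: by end_near. Qed.

End block_estimates.

(** * Growth of the energies along the orbit *)

Lemma near_all_seq (T : eqType) (W : seq T) (Q : T -> nat -> Prop) :
  (forall x, \forall n \near \oo, Q x n) ->
  \forall n \near \oo, forall x, x \in W -> Q x n.
Proof.
move=> h; elim: W => [|x W IH]; first by near=> n.
apply: filterS2 (h x) IH => n hx hW y.
by rewrite inE => /predU1P[->//|]; exact: hW.
Unshelve. all: by end_near. Qed.

Section growth.
Context {R : realType} {I A : finType} (M : planar_ifs R I A) (s : R).
Hypothesis s01 : 0 < s <= 1.
Context (r : I -> R) (omega : nat -> I).
Hypothesis r_ge0 : forall a, 0 <= r a.
Hypothesis r_sum : \sum_a r a = 1.
Hypothesis freq : has_word_frequencies r omega.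
Hypothesis aperiodic : forall m, (0 < m)%N ->
  \sum_a r a * cos (2 * m%:R * angle M a) != 1.

Local Notation phase := (turn omega (angle M)).
Local Notation win := (window omega).
Local Notation bound w := (energy_bound M s w (ratios M w)).

Definition orbit_energy (th : R) (i L : nat) : R :=
  Lq_energy M s (win i L) (th - phase i).

Lemma energy_bound_gt0 w d : 0 < d -> 0 < energy_bound M s w d.
Proof.
case: w => [|i w] d0 //=.
by rewrite ltr_wpDr ?powR_gt0 // mulr_ge0 ?moment_ge0 ?energy_bound_ge0.
Qed.

Lemma averaging_const_ge1 : 1 <= averaging_const M s.
Proof. by rewrite lerDl powR_ge0. Qed.

Lemma sum_over_windows n L (F : seq I -> nat -> R) :
  \sum_(w <- @words I L) \sum_(i <- iota 0 n | win i L == w) F w i =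
  \sum_(i <- iota 0 n) F (win i L) i.
Proof.
rewrite (exchange_big_dep predT) //=; apply: eq_bigr => i _.
have wL : win i L \in @words I L by rewrite -{2}(size_window omega i L) mem_words.
rewrite big_mkcond (bigD1_seq _ wL (@words_uniq I L)) /= eqxx big1 ?addr0 // => w.
by rewrite eq_sym => /negbTE ->.
Qed.

(** Sort the positions by the word that is read there.  The excess [e] is chosen
    so small that its total over the finitely many words is at most [n]. *)
Lemma average_energy_ratio L : \forall n \near \oo, forall th,
  \sum_(i <- iota 0 n) orbit_energy th i L / bound (win i L) <=
  2 * averaging_const M s * n%:R.
Proof.
pose W := @words I L; pose e : R := (size W)%:R^-1.
have C1 := averaging_const_ge1; set C := averaging_const M s in C1 *.
have W0 : (0 < size W)%N.
  have : win 0 L \in W by rewrite /W -{2}(size_window omega 0 L) mem_words.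
  by case: (W).
have e0 : 0 < e by rewrite invr_gt0 ltr0n.
pose nw w n : nat := count (fun i => win i (size w) == w) (iota 0 n).
have all_w : \forall n \near \oo, forall w, w \in W -> forall th,
    \sum_(i <- iota 0 n | win i L == w) Lq_energy M s w (th - phase i) <=
    C * ((nw w n)%:R + e * n%:R) * bound w.
  have rad0 := radius_gt0 M.
  have near_strip w : \forall n \near \oo, forall th, strip_equidistributed
      [seq th - phase i | i <- iota 0 n & win i (size w) == w]
      ((nw w n)%:R + e * n%:R) (ratios M w / (2 * radius M)); last first.
    move: (near_all_seq W near_strip); apply: filterS => n h w wW th; have {}h := h w wW th.
    have rw := ratios_gt0 M w.
    have eta0 : 0 <= ratios M w / (2 * radius M) by rewrite divr_ge0 ?mulr_ge0 ?ltW.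
    have hsz : (size [seq th - phase i | i <- iota 0 n & win i (size w) == w])%:R <=
        (nw w n)%:R + e * n%:R.
      by rewrite size_map size_filter lerDl mulr_ge0 // ltW.
    have hd : ratios M w / (2 * radius M) * (2 * radius M) <= ratios M w.
      by rewrite divfK // gt_eqF // mulr_gt0.
    have := close_energy_le s01 w hsz h eta0 rw hd; apply: le_trans.
    apply: le_trans (Lq_energy_le_close M s01 _ w).
    by rewrite big_map big_filter (size_words wW).
  apply: (strip_equidistributed_window r_ge0 r_sum freq aperiodic) => //.
  by rewrite divr_gt0 ?mulr_gt0 ?ratios_gt0.
near=> n => th.
have hw : forall w, w \in W -> forall th,
    \sum_(i <- iota 0 n | win i L == w) Lq_energy M s w (th - phase i) <=
    C * ((nw w n)%:R + e * n%:R) * bound w by near: n; exact: all_w.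
rewrite -(sum_over_windows n L (fun w i => Lq_energy M s w (th - phase i) / bound w)).
apply: (@le_trans _ _ (\sum_(w <- W) C * ((nw w n)%:R + e * n%:R))).
  rewrite big_seq [leRHS]big_seq; apply: ler_sum => w wW.
  rewrite -mulr_suml ler_pdivrMr ?energy_bound_gt0 ?ratios_gt0 //; exact: hw.
rewrite -mulr_sumr big_split /= big_const_seq iter_addr_0 count_predT.
have -> : \sum_(w <- W) (nw w n)%:R = n%:R :> R.
  transitivity (\sum_(w <- W) \sum_(i <- iota 0 n | win i L == w) (1 : R)).
    rewrite big_seq [RHS]big_seq; apply: eq_bigr => w wW.
    by rewrite /nw (size_words wW) -sum1_count natr_sum.
  by rewrite (sum_over_windows n L (fun _ _ => 1)) big_const_seq iter_addr_0 count_predT size_iota.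
rewrite -[(e * _) *+ _]mulr_natl mulrA divff ?pnatr_eq0 -?lt0n // mul1r.
by apply: eqW; ring.
Unshelve. all: by end_near. Qed.

Definition mean_log_moment : R := \sum_i r i * ln (moment M s i).
Definition mean_log_ratio : R := \sum_i r i * ln (ratio M i).

Local Notation a := mean_log_moment.
Local Notation b := (s * mean_log_ratio).

Lemma ratio_ln_lt0 i : ln (ratio M i) < 0.
Proof. exact/ln_lt0/ratio_itv. Qed.

Lemma mean_log_ratio_lt0 : mean_log_ratio < 0.
Proof.
have [i ri] : exists i, r i != 0.
  apply/existsP; rewrite -negb_forall; apply/negP => /forallP h.
  move: r_sum; rewrite big1 => [/esym/eqP|i _]; first by rewrite oner_eq0.
  exact/eqP.
rewrite /mean_log_ratio (bigD1 i) //= ltr_wnDr //.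
  by rewrite sumr_le0 // => j _; rewrite mulr_ge0_le0 // ltW // ratio_ln_lt0.
by rewrite pmulr_rlt0 ?ratio_ln_lt0 // lt_neqAle eq_sym ri r_ge0.
Qed.

Lemma mean_log_moment_le0 : a <= 0.
Proof.
rewrite sumr_le0 // => i _; rewrite mulr_ge0_le0 // ln_le0 //.
exact: moment_le1.
Qed.

Lemma centered (f : I -> R) : \sum_i r i * (f i - \sum_j r j * f j) = 0.
Proof.
by under eq_bigr do rewrite mulrBr; rewrite sumrB -mulr_suml r_sum mul1r subrr.
Qed.

(** For a typical position and every way to cut the window into two parts, the
    logarithmic sums of the two parts are close to [l * a] and [(L - l) * b],
    and [l * a + (L - l) * b <= L * max a b]. *)
Lemma average_log_bound (e : R) : 0 < e -> exists2 c : R, 0 <= c & forall L,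
  \forall n \near \oo, \sum_(i <- iota 0 n) ln (bound (win i L)) <=
   n%:R * (L%:R * (Num.max a b + e) + c + ln L.+1%:R).
Proof.
move=> e0; have e20 : 0 < e / 2 by rewrite divr_gt0.
have [s0 _] := andP s01.
have h1 := centered (fun i => ln (moment M s i)).
have h2 := centered (fun i => s * ln (ratio M i)).
have [c1 c10 [dev1 dev1P near1]] := block_deviation r_ge0 r_sum freq h1 e20.
have [c2 c20 [dev2 dev2P near2]] := block_deviation r_ge0 r_sum freq h2 e20.
have bE : \sum_j r j * (s * ln (ratio M j)) = b.
  by rewrite /mean_log_ratio mulr_sumr; apply: eq_bigr => i _; rewrite mulrCA.
exists (c1 + c2); first by rewrite addr_ge0.
move=> L; move: (near1 L) (near2 L); apply: filterS2 => n n1 n2.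
have one i : ln (bound (win i L)) <=
    ln L.+1%:R + (L%:R * Num.max a b + (dev1 i L + dev2 i L)).
  have L1 : 0 < L.+1%:R :> R by rewrite ltr0n.
  set T := L%:R * _ + _.
  have -> : ln L.+1%:R + T = ln (L.+1%:R * expR T).
    by rewrite lnM ?posrE ?expR_gt0 // expRK.
  rewrite ler_ln ?posrE ?mulr_gt0 ?expR_gt0 ?energy_bound_gt0 ?ratios_gt0 //.
  rewrite -[in L.+1%:R](size_window omega i L); apply: energy_bound_le => // w1 w2 ew.
  have sz : (size w1 + size w2)%N = L by rewrite -size_cat -ew size_window.
  have w1E : w1 = win (i + 0) (size w1).
    by rewrite addn0 -(@take_window _ omega i (size w1) L) ?ew ?take_size_cat // -sz leq_addr.
  have w2E : w2 = win (i + size w1) (size w2).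
    by have := drop_window omega i (size w1) L; rewrite ew drop_size_cat // -[X in (X - _)%N]sz addKn.
  have sumE (f : I -> R) k m : \sum_(j <- win k m) f j = \sum_(0 <= j < m) f (omega (k + j)%N).
    rewrite /window big_map; rewrite -{1}(addn0 k) iotaDl big_map.
    by rewrite /index_iota subn0.
  have d1 := dev1P i L 0%N (size w1) _; have d2 := dev2P i L (size w1) (size w2) _.
  have {}d1 := d1 (leq_trans (leq_addr _ _) (eq_leq sz)).
  have {}d2 := d2 (eq_leq sz).
  rewrite {1}w1E {1}w2E !sumE.
  move: d1 d2; rewrite bE !sumrB !big_const_nat !iter_addr_0 !subn0.
  rewrite -[a *+ _]mulr_natl -[b *+ _]mulr_natl.
  move=> /(le_trans (ler_norm _)) d1 /(le_trans (ler_norm _)) d2.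
  have m1 : (size w1)%:R * a <= (size w1)%:R * Num.max a b.
    by rewrite ler_wpM2l // le_max lexx.
  have m2 : (size w2)%:R * b <= (size w2)%:R * Num.max a b.
    by rewrite ler_wpM2l // le_max lexx orbT.
  have -> : T = (size w1)%:R * Num.max a b + (size w2)%:R * Num.max a b + (dev1 i L + dev2 i L).
    by rewrite /T -mulrDl -natrD sz.
  set x1 := \sum_(0 <= _ < size w1) _ in d1 *; set x2 := \sum_(0 <= _ < size w2) _ in d2 *.
  move: d1 d2 m1 m2; rewrite -/a; clear.
  move: x1 x2 (dev1 i L) (dev2 i L) ((size w1)%:R * a) ((size w2)%:R * b) => x1 x2 y1 y2 z1 z2.
  move: (_ * Num.max a b) (_ * Num.max a b) => m1 m2 *; lra.
apply: (le_trans (@ler_sum _ _ _ predT _ _ (fun i _ => one i))).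
have iotaE (x : nat -> R) : \sum_(i <- iota 0 n) x i = \sum_(0 <= i < n) x i.
  by rewrite /index_iota subn0.
rewrite iotaE !big_split /= !big_const_nat !iter_addr_0 !subn0.
rewrite -[ln _ *+ _]mulr_natl -[(L%:R * _) *+ _]mulr_natl.
have -> : n%:R * (L%:R * (Num.max a b + e) + (c1 + c2) + ln L.+1%:R) =
  n%:R * ln L.+1%:R + (n%:R * (L%:R * Num.max a b) + ((e / 2 * L%:R + c1) * n%:R +
   (e / 2 * L%:R + c2) * n%:R)) by field.
by rewrite !lerD.
Unshelve. all: by end_near. Qed.

Lemma orbit_energy_gt0 th i L : 0 < orbit_energy th i L.
Proof. exact: Lq_energy_gt0. Qed.

Lemma submul_const_ge1 : 1 <= submul_const M.
Proof.
rewrite /submul_const -natrM -[1]/(1%:R) ler_nat; lia.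
Qed.

Lemma orbit_energy_sub th i n1 n2 : ln (orbit_energy th i (n1 + n2)) <=
  ln (submul_const M) + ln (orbit_energy th i n1) + ln (orbit_energy th (i + n1) n2).
Proof.
have c0 : 0 < submul_const M by apply: lt_le_trans submul_const_ge1.
rewrite -!lnM ?posrE ?mulr_gt0 ?orbit_energy_gt0 //.
rewrite ler_ln ?posrE ?mulr_gt0 ?orbit_energy_gt0 //.
rewrite /orbit_energy window_cat turnD opprD addrA.
exact: Lq_energy_submul.
Qed.

Lemma log_small (k0 e : R) : 0 < e -> exists2 L : nat, (0 < L)%N &
  k0 + ln L.+1%:R <= e * L%:R.
Proof.
move=> e0; have d0 : 0 < e / 2 by rewrite divr_gt0.
pose c := `|k0 + e / 2 - ln (e / 2)| / (e / 2).
exists (Num.truncn c).+1 => //; set L := (Num.truncn c).+1.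
have c0 : 0 <= c by rewrite divr_ge0 // ltW.
have /andP[_ cL] := truncn_itv c0; rewrite -/L in cL.
have L0 : 0 < L.+1%:R :> R by rewrite ltr0n.
have := @ln_sublinear R (e / 2 * L.+1%:R); rewrite mulr_gt0 // => /(_ isT).
rewrite lnM ?posrE // -[L.+1%:R in X in _ < X -> _]natr1 => h.
have : k0 + e / 2 - ln (e / 2) <= e / 2 * L%:R.
  apply: le_trans (ler_norm _) _; rewrite [leRHS]mulrC -ler_pdivrMr //; exact: ltW.
have -> : e * L%:R = e / 2 * L%:R + e / 2 * L%:R by field.
by move: h; rewrite mulrDr mulr1; move: (e / 2 * L%:R) => x; lra.
Qed.

Lemma orbit_growth (e : R) : 0 < e -> \forall m \near \oo, forall th,
  ln (Lq_energy M s (win 0 m) th) <= m%:R * (Num.max a b + e).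
Proof.
move=> e0; have e10 : 0 < e / 4 by rewrite divr_gt0.
have [c c0 hc] := average_log_bound e10.
set mx := Num.max a b in hc *; set C := 2 * averaging_const M s.
have mx0 : mx <= 0.
  rewrite /mx ge_max mean_log_moment_le0 /= nmulr_lle0 ?mean_log_ratio_lt0 //.
  by case/andP: s01 => /ltW.
have C0 : 0 < C by rewrite mulr_gt0 // (lt_le_trans _ averaging_const_ge1).
set ka := ln (submul_const M).
(* one window of length [L] costs [ln C + c + ka + ln L.+1], made small
   relative to [L] *)
have ka0 : 0 <= ka by apply/ln_ge0/submul_const_ge1.
have [L L0 hL] := log_small (ln C + c + ka) e10.
have LR : 0 < L%:R :> R by rewrite ltr0n.
have [n1 _ hn1] := average_energy_ratio L.
have [n2 _ hn2] := hc L.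
near=> m => th.
pose T := (m %/ L).-1; pose d := (m %% L)%N.
have mL : (L <= m)%N by near: m; exact: nbhs_infty_ge.
have mE : m = (T.+1 * L + d)%N by rewrite /T prednK ?divn_gt0 // -divn_eq.
have dL : (d < L)%N by rewrite ltn_pmod.
(* the windows start in the first [T * L] positions; what is left of the
   word is shorter than [2 * L] *)
have nbig : (n1 + n2 <= T * L)%N.
  have : (n1 + n2 + 2 * L <= m)%N by near: m; exact: nbhs_infty_ge.
  by rewrite {1}mE mulSn; clear -dL; lia.
have bigm : 3 * ka - 2 * L%:R * mx <= e / 2 * m%:R.
  by rewrite -ler_pdivrMl ?divr_gt0 //; near: m; exact: nbhs_infty_ger.
set n := (T * L)%N in nbig.
have h1 := hn1 n (leq_trans (leq_addr _ _) nbig) th.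
have h2 := hn2 n (leq_trans (leq_addl _ _) nbig).
pose g i k := ln (orbit_energy th i k).
have g0 i k : g i k <= 0 by apply/ln_le0/Lq_energy_le1.
have := @subadditive_average R g ka g0 (orbit_energy_sub th) ka0 L T d.
rewrite -mE -/n.
have -> : g 0%N m = ln (Lq_energy M s (win 0 m) th).
  by rewrite /g /orbit_energy /turn big_nil subr0.
have hg : \sum_(0 <= i < n) g i L <= n%:R * ln C + n%:R * (L%:R * (mx + e / 4) + c + ln L.+1%:R).
  have Bp i : 0 < bound (win i L) by apply/energy_bound_gt0/ratios_gt0.
  have := @jensen_ln R nat (iota 0 n) (fun i => orbit_energy th i L / bound (win i L)) C C0.
  rewrite size_iota => h; have {h} h := h (fun i => divr_gt0 (orbit_energy_gt0 th i L) (Bp i)) h1.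
  apply: le_trans (lerD h h2); rewrite -big_split /= /index_iota subn0.
  apply: ler_sum => i _; rewrite ln_div ?posrE ?orbit_energy_gt0 //.
  by rewrite subrK.
move=> main.
have nR : n%:R * (ln C + c + ka + ln L.+1%:R) <= n%:R * (e / 4 * L%:R).
  by rewrite ler_wpM2l.
have {main hg nR h1 h2} main : L%:R * ln (Lq_energy M s (win 0 m) th) <=
    L%:R * (n%:R * (mx + e / 2) + 3 * ka).
  apply: le_trans main _.
  have -> : L%:R * (n%:R * (mx + e / 2) + 3 * ka) =
     n%:R * (L%:R * mx) + n%:R * (e / 4 * L%:R) + n%:R * (e / 4 * L%:R) + 3 * ka * L%:R by field.
  rewrite lerD2r; move: hg nR; rewrite !mulrDr; move: (\sum_(_ <= _ < _) _) => S.
  rewrite [L%:R * (e / 4)]mulrC [ka * _]mulrC.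
  move: (n%:R * ln C) (n%:R * c) (n%:R * ka) (n%:R * (L%:R * mx)) (n%:R * (e / 4 * L%:R)) (n%:R * ln L.+1%:R).
  by move=> *; lra.
move: main; rewrite ler_pM2l // => /le_trans; apply.
have nm : n%:R <= m%:R :> R by rewrite ler_nat mE /n mulSn; clear; lia.
have mn : m%:R - 2 * L%:R <= n%:R :> R.
  by rewrite lerBlDr -natrM -natrD ler_nat mE /n mulSn; clear -dL; lia.
have p1 : n%:R * mx <= (m%:R - 2 * L%:R) * mx by rewrite ler_wnM2r.
have p2 : n%:R * (e / 2) <= m%:R * (e / 2) by rewrite ler_wpM2r // divr_ge0 // ltW.
rewrite mulrDr [leRHS]mulrDr.
have -> : m%:R * e = m%:R * (e / 2) + e / 2 * m%:R by field.
move: p1; rewrite mulrBl.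
move: p2 bigm.
move: (n%:R * (e / 2)) (m%:R * (e / 2)) (n%:R * mx) (m%:R * mx) (2 * L%:R * mx) (e / 2 * m%:R) (3 * ka).
by move=> *; lra.
Unshelve. all: by end_near. Qed.

End growth.

(** * Generic sequences and irrational angles *)

Section trees.
Context (T : nat -> pointedType).

Lemma nbhs_tree (x : tree_of T) (n : nat) :
  nbhs x [set y : tree_of T | forall i, (i < n)%N -> y i = x i].
Proof.
elim: n => [|n IH]; first by apply: filterS filterT => y _ i.
have hn : nbhs x [set y : tree_of T | y n = x n].
  have := @proj_continuous _ (fun n => discrete_topology (T n)) n x.
  by move=> /(_ [set x n]); apply; rewrite nbhs_principalE.
apply: filterS2 IH hn => y h1 h2 i; rewrite ltnS leq_eqVlt => /predU1P[->//|].
exact: h1.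
Qed.

Lemma open_tree_locally (U : set (tree_of T)) :
  (forall x, U x -> exists n, forall y : tree_of T,
     (forall i, (i < n)%N -> y i = x i) -> U y) -> open U.
Proof.
move=> h; rewrite openE => x /h[n hn]; apply: filterS (nbhs_tree x n).
exact: hn.
Qed.

Lemma open_cylinder n (a : tree_of T) :
  open [set x : tree_of T | forall i, (i < n)%N -> x i = a i].
Proof.
apply: open_tree_locally => x xa; exists n => y yx i iN.
by rewrite yx // xa.
Qed.

Lemma cylinder_indic_continuous (R : realType) n (a : tree_of T) : continuous
  (\1_[set x : tree_of T | forall i, (i < n)%N -> x i = a i] : tree_of T -> R).
Proof.
move=> x; apply: (@cvg_near_cst _ _ _ _ (nbhs (x : tree_of T)) (nbhs_filter _)).
have := nbhs_tree x n; apply: filterS => y yx.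
rewrite !indicE; congr (_%:R); congr nat_of_bool.
by apply/idP/idP; rewrite !inE /= => h i iN; have := h i iN; rewrite yx.
Qed.

End trees.

Section generic.
Context {R : realType} (N : nat) (r : 'I_N.+1 -> R) (mu : probability (borel (driving N)) R).
Context (omega : driving N).
Hypothesis r_ge0 : forall a, 0 <= r a.
Hypothesis r_sum : \sum_a r a = 1.

Lemma iter_shift k i : iter k (@shift N) omega i = omega (k + i)%N.
Proof. by elim: k i => //= k IH i; rewrite /shift IH addnS. Qed.

(** Indicators of cylinders are continuous, so they are admissible test
    functions.  The empirical measures start at the first iterate of the shift;
    starting at the sequence itself changes the sums by a bounded amount. *)
Lemma generic_word_frequencies : is_product_measure (fun=> r) mu ->
  generic mu omega -> has_word_frequencies r (omega : nat -> 'I_N.+1).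
Proof.
move=> bernoulli gen w.
pose C : set (driving N) := [set x | forall i, (i < size w)%N -> x i = nth ord0 w i].
have muC : mu C = (\prod_(a <- w) r a)%:E.
  have := bernoulli (size w) (fun i => nth ord0 w i : 'I_N.+1); rewrite /C => ->.
  by rewrite (big_nth ord0) big_mkord.
have mC : measurable (C : set (borel (driving N))).
  by apply: sub_sigma_algebra; exact: open_cylinder.
have Cint (nu : {measure set (borel (driving N)) -> \bar R}) :
    (\int[nu]_x (\1_C x)%:E)%E = nu C.
  by rewrite integral_indic ?setIT // -?setTE; exact: measurableT.
have := gen (\1_C) (@cylinder_indic_continuous _ R (size w) _).
have bnd : exists B : R, forall x, `|\1_C x| <= B :> R.
  exists 1 => x; rewrite indicE; case: (_ \in _) => /=; first by rewrite normr1.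
  by rewrite normr0.
move=> /(_ bnd); under eq_fun do rewrite Cint; rewrite Cint => lim.
have {}lim : (fun n => empirical R omega n C) @ \oo --> (\prod_(a <- w) r a)%:E.
  by rewrite -muC; exact: lim.
pose x i : R := (window omega i (size w) == w)%:R - \prod_(a <- w) r a.
have inC k : (\1_C (iter k (@shift N) omega) : R) = (window omega k (size w) == w)%:R.
  rewrite indicE; congr (_%:R); congr nat_of_bool; apply/idP/eqP; rewrite inE /=.
    move=> h; apply: (@eq_from_nth _ ord0); rewrite size_window // => i iw.
    by rewrite nth_window // -h // iter_shift.
  by move=> h i iw; rewrite iter_shift -[in RHS]h nth_window.
have empE n : fine (empirical R omega n C) =
    n%:R^-1 * \sum_(0 <= k < n) (window omega k.+1 (size w) == w)%:R.
  rewrite /empirical /= /mscale /= /msum /= /dirac sumEFin -EFinM /=.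
  by rewrite big_mkord; congr (_ * _); apply: eq_bigr => k _; rewrite -inC.
have {}lim : (fine \o (fun n => empirical R omega n C)) @ \oo --> \prod_(a <- w) r a.
  by apply: fine_cvg; exact: lim.
move=> e e0; have e20 : 0 < e / 2 by rewrite divr_gt0.
have := lim; move=> /cvgrPdist_le /(_ _ e20) hl.
have xB i : `|x i| <= 2.
  rewrite /x; apply: le_trans (ler_normB _ _) _.
  have p0 : 0 <= \prod_(a <- w) r a by rewrite prodr_ge0.
  have p1 : \prod_(a <- w) r a <= 1.
    apply: prodr_ile1 => a; rewrite r_ge0 /= -r_sum (bigD1 a) //= lerDl sumr_ge0 //.
  rewrite (ger0_norm p0); case: (_ == _) => /=; rewrite ?normr1 ?normr0; lra.
near=> n.
have hd : `|\prod_(a <- w) r a - fine (empirical R omega n C)| <= e / 2 by near: n; exact: hl.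
have n0 : 0 < n%:R :> R by rewrite ltr0n; near: n; exact: nbhs_infty_gt.
have h1 : `|\sum_(0 <= i < n) x (i + 1)%N| <= e / 2 * n%:R.
  rewrite -ler_pdivrMr // -[n%:R in X in X <= _]gtr0_norm // -normf_div.
  move: hd; rewrite empE distrC; apply: le_trans; apply: eqW; congr `|_|.
  rewrite /x sumrB big_const_nat iter_addr_0 subn0 -[_ *+ n]mulr_natr mulrBl mulfK ?gt_eqF //.
  rewrite mulrC; congr (_ * _ - _); apply: eq_bigr => i _; rewrite addn1 //.
have h2 := shift_sum_le n 1 xB.
have h3 : 2 * 2 * 1%:R <= e / 2 * n%:R.
  by rewrite -ler_pdivrMl //; near: n; exact: nbhs_infty_ger.
have -> : e * n%:R = e / 2 * n%:R + e / 2 * n%:R by field.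
rewrite -[X in `|X|](subrK (\sum_(0 <= i < n) x (i + 1)%N)).
by apply: le_trans (ler_normD _ _) _; rewrite lerD // (le_trans h2).
Unshelve. all: by end_near. Qed.

End generic.

Section aperiodicity.
Context {R : realType}.

Lemma sin_eq0 (x : R) : sin x = 0 -> exists k : int, x = k%:~R * pi.
Proof.
move=> sx; pose k := Num.floor (x / pi); exists k.
have pi0 := pi_gt0 R.
have := floor_itv (x / pi); rewrite -/k ler_pdivlMr // ltr_pdivrMr // intrD mulrDl mul1r.
move=> /andP[h1 h2].
have sk (n : nat) (y : R) : `|sin (y + n%:R * pi)| = `|sin y|.
  elim: n y => [|n IH] y; first by rewrite mul0r addr0.
  by rewrite -[n.+1%:R]natr1 mulrDl mul1r addrA sinDpi normrN IH.
have skz (y : R) : `|sin (y - k%:~R * pi)| = `|sin y|.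
  case: (k) => n; first by rewrite -(sk n (y - _)) -pmulrn subrK.
  by rewrite NegzE mulrNz mulNr opprK -pmulrn sk.
have s0 : sin (x - k%:~R * pi) = 0 by apply/eqP; rewrite -normr_eq0 skz sx normr0.
apply/eqP; rewrite -subr_eq0; apply/eqP; set y := x - _ in s0 *.
have y0 : 0 <= y by rewrite subr_ge0.
have y1 : y < pi by rewrite ltrBlDr addrC.
move: y0; rewrite le_eqVlt => /predU1P[//|y0].
by have := @sin_gt0_pi R y; rewrite y0 y1 s0 ltxx => /(_ isT).
Qed.

(** The double angle formula reduces [cos (2 x) = 1] to [sin x = 0]. *)
Lemma irrational_cos (al : R) (m : nat) : irrational (al / pi) -> (0 < m)%N ->
  cos (2 * m%:R * al) != 1.
Proof.
move=> irr m0; apply/negP => /eqP c1; apply: irr.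
have : sin (m%:R * al) = 0.
  have : cos ((m%:R * al) *+ 2) = 1 by rewrite -mulr_natl mulrA c1.
  rewrite cos_mulr2n cos2sin2 => h.
  have : sin (m%:R * al) ^+ 2 = 0.
    by move: h; move: (sin _ ^+ 2) => y; rewrite mulr2n; lra.
  by move=> /eqP; rewrite sqrf_eq0 => /eqP.
move=> /sin_eq0[k hk]; exists (k%:~R / m%:R) => //.
have pi0 := pi_gt0 R; have mR : m%:R != 0 :> R by rewrite pnatr_eq0 -lt0n.
rewrite fmorph_div /= ratr_int ratr_nat.
have -> : al = k%:~R * pi / m%:R by rewrite -hk mulrAC divff // mul1r.
by rewrite [_ * pi / _]mulrAC mulfK // gt_eqF.
Qed.

Lemma aperiodic_of_irrational (I : finType) (r al : I -> R) :
  (forall i, 0 <= r i) -> \sum_i r i = 1 ->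
  (exists i, 0 < r i /\ irrational (al i / pi)) ->
  forall m, (0 < m)%N -> \sum_i r i * cos (2 * m%:R * al i) != 1.
Proof.
move=> r0 r1 [i [ri irr]] m m0; rewrite lt_eqF // -[ltRHS]r1.
rewrite (bigD1 i) //= [ltRHS](bigD1 i) //= ltr_leD //.
  rewrite gtr_pMr // lt_neqAle cos_le1 andbT; exact: irrational_cos.
by apply: ler_sum => j _; rewrite ler_piMr // cos_le1.
Qed.

End aperiodicity.

(** * The given maps as a planar system *)

Lemma finite_lower_bound (R : realType) (T : finType) (F : T -> R) :
  exists2 g : R, 0 < g & forall x, 0 < F x -> g <= F x.
Proof.
pose G x := if 0 < F x then (F x)^-1 else 0.
have G0 x : 0 <= G x by rewrite /G; case: ifP => // h; rewrite invr_ge0 ltW.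
have S0 : 0 <= \sum_x G x by rewrite sumr_ge0.
exists ((1 + \sum_x G x)^-1) => [|x Fx]; first by rewrite invr_gt0 ltr_wpDr.
rewrite -[F x]invrK lef_pV2 ?posrE ?invr_gt0 ?ltr_wpDr //.
have -> : (F x)^-1 = G x by rewrite /G Fx.
by rewrite (bigD1 x) //= ler_wpDl // lerDl sumr_ge0.
Qed.

Section similarities.
Context {R : realType}.
Implicit Types x y : R * R.

Lemma enormZ c x : enorm (c *: x) = `|c| * enorm x.
Proof.
rewrite /enorm -sqrtr_sqr -sqrtrM ?sqr_ge0 //; congr Num.sqrt.
by rewrite /dot /= /GRing.scale /=; ring.
Qed.

Lemma enorm_rot a x : enorm (rot a x) = enorm x.
Proof.
rewrite /enorm; congr Num.sqrt; rewrite /dot /rot /=.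
have h := cos2Dsin2 a; set c := cos a in h *; set s := sin a in h *.
transitivity ((c ^+ 2 + s ^+ 2) * (x.1 * x.1 + x.2 * x.2)); first by ring.
by rewrite h mul1r.
Qed.

Lemma rotK a x : rot a (rot (- a) x) = x.
Proof.
rewrite /rot cosN sinN /=; have h := cos2Dsin2 a.
set c := cos a in h *; set s := sin a in h *; case: x => x1 x2 /=; congr pair.
  transitivity ((c ^+ 2 + s ^+ 2) * x1); first by ring.
  by rewrite h mul1r.
transitivity ((c ^+ 2 + s ^+ 2) * x2); first by ring.
by rewrite h mul1r.
Qed.

Lemma simil_surj l a t x : l != 0 ->
  exists2 z, simil l a t z = x & enorm z = `|l|^-1 * enorm (x - t).
Proof.
move=> l0; exists (rot (- a) (l^-1 *: (x - t))).
  by rewrite /simil rotK scalerA divff // scale1r subrK.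
by rewrite enorm_rot enormZ normfV.
Qed.

(** Otherwise the midpoint of the centres lies in both images of the disk. *)
Lemma disjoint_disks_gap l a (t t' : R * R) rad : 0 < l -> 0 < rad ->
  (forall z z', enorm z <= rad -> enorm z' <= rad ->
     simil l a t z = simil l a t' z' -> False) ->
  0 < enorm (t - t') - 2 * l * rad.
Proof.
move=> l0 rad0 disj; rewrite subr_gt0 ltNge; apply/negP => close.
pose y := 2^-1 *: (t + t').
have yt : enorm (y - t) <= l * rad.
  have -> : y - t = (- 2^-1) *: (t - t').
    by apply: injective_projections; rewrite /y /= /GRing.scale /=; field.
  rewrite enormZ normrN gtr0_norm ?invr_gt0 // ler_pdivrMl //.
  by apply: le_trans close _; apply: eqW; ring.
have yt' : enorm (y - t') <= l * rad.
  have -> : y - t' = 2^-1 *: (t - t').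
    by apply: injective_projections; rewrite /y /= /GRing.scale /=; field.
  rewrite enormZ gtr0_norm ?invr_gt0 // ler_pdivrMl //.
  by apply: le_trans close _; apply: eqW; ring.
have [z zE nz] := simil_surj a t y (lt0r_neq0 l0).
have [z' zE' nz'] := simil_surj a t' y (lt0r_neq0 l0).
apply: (disj z z'); rewrite ?zE ?zE' //.
  by rewrite nz gtr0_norm // ler_pdivrMl.
by rewrite nz' gtr0_norm // ler_pdivrMl.
Qed.

End similarities.

Section letters.
Context {R : realType} (N : nat) (k : 'I_N.+1 -> nat).
Context (lam alpha : 'I_N.+1 -> R) (t : forall i, 'I_(k i).+1 -> R * R) (rad : R).
Context (p : forall i, 'I_(k i).+1 -> R).

(** The disjoint union of the alphabets serves as a common alphabet for all
    driving letters: a letter of the wrong kind gets probability zero and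
    translation zero. *)
Definition letter : finType := {i : 'I_N.+1 & 'I_(k i).+1}.

Definition letter_value (V : nmodType) (F : forall i, 'I_(k i).+1 -> V)
  (i : 'I_N.+1) (a : letter) : V :=
  if tag a == i then F (tag a) (tagged a) else 0.

Lemma letter_valueT (V : nmodType) (F : forall i, 'I_(k i).+1 -> V) i (j : 'I_(k i).+1) :
  letter_value F i (Tagged (fun i => 'I_(k i).+1) j) = F i j.
Proof. by rewrite /letter_value eqxx. Qed.

Lemma sum_letter (F : forall i, 'I_(k i).+1 -> R) i (g : R -> R) : g 0 = 0 ->
  \sum_(a : letter) g (letter_value F i a) = \sum_j g (F i j).
Proof.
move=> g0.
have := @sig_big_dep _ _ _ _ (fun i => 'I_(k i).+1) predT (fun _ => predT)
  (fun i' j => g (letter_value F i (Tagged (fun i => 'I_(k i).+1) j))).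
rewrite /=.
have -> : \sum_(a : letter) g (letter_value F i a) =
  \sum_(a : letter) g (letter_value F i (Tagged (fun i => 'I_(k i).+1) (tagged a))).
  by apply: eq_bigr => -[i' j] _.
move=> <-; rewrite (bigD1 i) //= [X in _ + X]big1 ?addr0 => [|i' ii'].
  by apply: eq_bigr => j _; rewrite letter_valueT.
by rewrite big1 // => j _; rewrite /letter_value /= (negbTE ii').
Qed.

Hypothesis lam01 : forall i, 0 < lam i < 1.
Hypothesis rad0 : 0 < rad.
Hypothesis stable : forall i j, simil (lam i) (alpha i) (@t i j) @` edisk rad `<=` edisk rad.
Hypothesis disj : forall i, trivIset [set: 'I_(k i).+1]
  (fun j => simil (lam i) (alpha i) (@t i j) @` edisk rad).
Hypothesis p_prob : forall i, prob_vector (@p i).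

(** Finitely many pairs of disjoint disks have a common positive gap. *)
Lemma planar_ifs_of_maps : exists M : planar_ifs R 'I_N.+1 letter,
  [/\ ratio M = lam, angle M = alpha, trans M = letter_value (@t),
      prob M = letter_value (@p) & radius M = rad].
Proof.
have [g g0 gP] := finite_lower_bound (fun x : 'I_N.+1 * letter * letter =>
  enorm (letter_value (@t) x.1.1 x.1.2 - letter_value (@t) x.1.1 x.2) - 2 * lam x.1.1 * rad).
have prob0 i a : 0 <= letter_value (@p) i a.
  by rewrite /letter_value; case: ifP => // _; have [] := p_prob (tag a).
have prob1 i : \sum_a letter_value (@p) i a = 1.
  by rewrite (sum_letter (@p) i (g := id)) //; have [] := p_prob i.
have disk i (a : letter) z : enorm z <= rad ->
    enorm (simil (lam i) (alpha i) (letter_value (@t) i a) z) <= rad.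
  move=> zr; rewrite /letter_value; case: eqP => [<-|_].
    by apply: (stable (j := tagged a)); exists z.
  have [l0 l1] := andP (lam01 i).
  rewrite /simil addr0 enormZ enorm_rot gtr0_norm //.
  by rewrite -[leRHS]mul1r ler_pM ?enorm_ge0 ?(ltW l0) ?(ltW l1).
have gap i (a b : letter) z z' : a != b -> 0 < letter_value (@p) i a -> 0 < letter_value (@p) i b ->
    enorm z <= rad -> enorm z' <= rad ->
    g <= enorm (simil (lam i) (alpha i) (letter_value (@t) i a) z -
                simil (lam i) (alpha i) (letter_value (@t) i b) z').
  move=> ab pa pb zr zr'; have [l0 l1] := andP (lam01 i).
  have tg (c : letter) : 0 < letter_value (@p) i c -> tag c = i.
    by rewrite /letter_value; case: eqP => //; rewrite ltxx.
  have := gP (i, a, b); rewrite /= => /(_ _)/le_trans; apply.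
    move: ab (tg _ pa) (tg _ pb) => {pa pb}; case: a => ia ja; case: b => ib jb /= ab ea eb.
    subst ia ib; rewrite !letter_valueT.
    apply: (disjoint_disks_gap (a := alpha i)) => // z1 z2 h1 h2 e.
    have e' : ja = jb; last by subst jb; rewrite eqxx in ab.
    apply: (@disj i ja jb I I).
    by exists (simil (lam i) (alpha i) (@t i ja) z1); split; [exists z1|exists z2].
  set ta := letter_value (@t) i a; set tb := letter_value (@t) i b.
  rewrite lerBlDr.
  have -> : ta - tb = (simil (lam i) (alpha i) ta z - simil (lam i) (alpha i) tb z') -
     (lam i *: rot (alpha i) z - lam i *: rot (alpha i) z').
    by rewrite /simil; set x := _ *: _; set y := _ *: rot _ z'; rewrite opprD addrACA opprB; ring.
  apply: le_trans (enormB _ _) _; rewrite lerD2l.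
  apply: le_trans (enormB _ _) _; rewrite !enormZ !enorm_rot gtr0_norm //.
  by rewrite -mulrDr [2 * _]mulrC -mulrA ler_pM2l // mulrDl mul1r lerD.
by exists (PlanarIFS lam01 prob0 prob1 rad0 disk g0 gap).
Qed.

End letters.

(** * The coding map *)

Lemma nested_intervals (R : realType) (a d : nat -> R) :
  (forall m n, (n <= m)%N -> `|a m - a n| <= d n) ->
  exists c, forall n, `|c - a n| <= d n.
Proof.
move=> h; pose E := [set x | exists n, x = a n - d n].
have d0 n : 0 <= d n by apply: le_trans (h n n (leqnn _)).
have cross m n : a m - d m <= a n + d n.
  have [nm|/ltnW mn] := leqP n m.
    by have := h _ _ nm; rewrite ler_norml => /andP[_]; have := d0 m; lra.
  by have := h _ _ mn; rewrite ler_norml => /andP[+ _]; have := d0 n; lra.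
have E0 : E !=set0 by exists (a 0%N - d 0%N), 0%N.
exists (sup E) => n; rewrite ler_norml; apply/andP; split.
  rewrite lerBrDr addrC; apply: ub_le_sup; last by exists n.
  by exists (a 0%N + d 0%N) => x [m ->].
by rewrite lerBlDr addrC; apply: ge_sup => // x [m ->].
Qed.

Section contraction.
Context {R : realType} {I A : finType} (M : planar_ifs R I A) (omega : nat -> I).

Lemma ratios_window_small (e : R) : 0 < e ->
  exists m0, forall m, (m0 <= m)%N -> ratios M (window omega 0 m) < e.
Proof.
move=> e0; have [g g0 gP] := finite_lower_bound (fun i => 1 - ratio M i).
have g1 : g < 1.
  have := gP (omega 0%N); have := ratio_itv M (omega 0%N).
  by move=> /andP[i0 i1]; rewrite subr_gt0 i1 => /(_ isT); lra.
have bound m : ratios M (window omega 0 m) <= (1 - g) ^+ m.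
  elim: m => [|m IH]; first by rewrite /ratios big_nil expr0.
  rewrite window_rcons -cats1 ratios_cat exprSr /ratios big_seq1 -/(ratios M _).
  have /andP[i0 i1] := ratio_itv M (omega (0 + m)%N).
  apply: ler_pM => //; [exact/ltW/ratios_gt0|exact: ltW|].
  by have := gP (omega (0 + m)%N); rewrite subr_gt0 i1 => /(_ isT); lra.
have cv : (fun m => (1 - g) ^+ m) @ \oo --> (0 : R).
  by apply: cvg_expr; rewrite ger0_norm; lra.
move: cv => /cvgrPdist_lt /(_ _ e0)[m0 _ hm0]; exists m0 => m m0m.
apply: le_lt_trans (bound m) _; have := hm0 m m0m.
by rewrite /= sub0r normrN; apply: le_lt_trans; rewrite ler_norm.
Qed.

End contraction.

Section coding.
Context {R : realType} (N : nat) (k : 'I_N.+1 -> nat) (M : planar_ifs R 'I_N.+1 (letter k)).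
Context (t : forall i : 'I_N.+1, 'I_(k i).+1 -> R * R).
Hypothesis transE : trans M = letter_value (@t).
Context (omega : driving N).

Let om : nat -> 'I_N.+1 := omega.
Let f := fun i (j : 'I_(k i).+1) => simil (ratio M i) (angle M i) (@t i j).

Definition code_letter (u : coding k omega) (n : nat) : letter k :=
  Tagged (fun i => 'I_(k i).+1) (u n : 'I_(k (omega n)).+1).

Lemma iter_mapsE (u : coding k omega) m z :
  iter_maps f u m z = act M (window om 0 m) (window (code_letter u) 0 m) z.
Proof.
elim: m z => [|m IH] z; first by [].
rewrite [LHS]/= IH !window_rcons -!cats1 act_cat ?size_window //= transE.
by rewrite letter_valueT.
Qed.

(** The centres [x m] are Cauchy with explicit moduli.  Nested intervals give the
    coordinates of the limit, and the distance of the limit to [x m] is tested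
    by projecting to the direction that realizes it. *)
Lemma coding_map_mem (u : coding k omega) n : exists2 z, enorm z <= radius M &
  coding_map f (radius M) u = act M (window om 0 n) (window (code_letter u) 0 n) z.
Proof.
have r0 := radius_gt0 M.
suff [x hx] : exists x, (\bigcap_(n in [set n | (0 < n)%N])
    (iter_maps f u n @` edisk (radius M))) x.
  have := @getPex _ (\bigcap_(n in [set n | (0 < n)%N]) (iter_maps f u n @` edisk (radius M))).
  move=> /(_ (ex_intro _ x hx)) => h.
  have {}h m : (0 < m)%N -> exists2 z, enorm z <= radius M &
      coding_map f (radius M) u = act M (window om 0 m) (window (code_letter u) 0 m) z.
    by move=> m0; have [z zr ez] := h m m0; exists z; rewrite // -iter_mapsE.
  case: n => [|n]; last exact: h.
  have [z zr ->] := h 1%N isT; exists (act M (window om 0 1) (window (code_letter u) 0 1) z) => //.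
  exact: act_disk.
pose x m := act M (window om 0 m) (window (code_letter u) 0 m) 0.
pose d n := ratios M (window om 0 n) * radius M.
have zero_disk : enorm (0 : R * R) <= radius M by rewrite enorm0 ltW.
have xdot m l th : (m <= l)%N -> `|dot (x l - x m) (dir th)| <= d m.
  move=> ml; rewrite dotBl -(subnKC ml) /x !window_cat act_cat ?size_window //.
  rewrite dot_act ?size_window // [dot (act M _ _ 0) _]/(pos M _ _ _) addrAC subrr add0r.
  rewrite normrM gtr0_norm ?ratios_gt0 // ler_wpM2l //; first exact/ltW/ratios_gt0.
  by apply: le_trans (dot_dir_le _ _) _; apply: act_disk.
have [c1 hc1] : exists c, forall n, `|c - (x n).1| <= d n.
  apply: nested_intervals => l m ml; have := xdot m l 0 ml.
  by rewrite /dot /dir /= cos0 sin0 mulr1 mulr0 addr0.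
have [c2 hc2] : exists c, forall n, `|c - (x n).2| <= d n.
  apply: nested_intervals => l m ml; have := xdot m l (pi / 2) ml.
  by rewrite /dot /dir /= cos_pihalf sin_pihalf mulr1 mulr0 add0r.
exists (c1, c2) => m m0.
have close : enorm ((c1, c2) - x m) <= d m.
  apply/ler_addgt0Pr => e e0; have [th eth] := polar ((c1, c2) - x m).
  have e20 : 0 < e / (2 * radius M) by rewrite divr_gt0 // mulr_gt0.
  have [l0 hl] := ratios_window_small M om e20.
  pose l := maxn l0 m; have lm : (m <= l)%N by rewrite leq_maxr.
  have {hl} hl : d l <= e / 2.
    have := hl l (leq_maxl _ _); rewrite ltr_pdivlMr ?mulr_gt0 // => /ltW.
    by rewrite /d; lra.
  have -> : enorm ((c1, c2) - x m) = dot ((c1, c2) - x m) (dir th).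
    rewrite {2}eth /dot /dir /= /GRing.scale /=; have h := cos2Dsin2 th.
    transitivity (enorm ((c1, c2) - x m) * (cos th ^+ 2 + sin th ^+ 2)); first by rewrite h mulr1.
    by rewrite mulrDr !expr2 !mulrA.
  have -> : (c1, c2) - x m = ((c1, c2) - x l) + (x l - x m) by rewrite addrA subrK.
  rewrite dotDl addrC; apply: lerD; first by apply: le_trans (xdot m l th lm); rewrite ler_norm.
  have b1 : (c1 - (x l).1) * cos th <= d l.
    apply: le_trans (ler_norm _) _; rewrite normrM; apply: le_trans (hc1 l).
    by rewrite ler_piMr // cos_max.
  have b2 : (c2 - (x l).2) * sin th <= d l.
    apply: le_trans (ler_norm _) _; rewrite normrM; apply: le_trans (hc2 l).
    by rewrite ler_piMr // sin_max.
  by rewrite /dot /dir /=; lra.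
have affine (w : seq 'I_N.+1) (v : seq (letter k)) (y : R * R) : size v = size w ->
    exists2 z, act M w v z = y & ratios M w * enorm z = enorm (y - act M w v 0).
  elim: w v y => [|i w IH] [|a v] y //= e.
    by exists y; rewrite // subr0 /ratios big_nil mul1r.
  have [i0 i1] := andP (ratio_itv M i).
  have [y' y'E _] := simil_surj (angle M i) (trans M i a) y (lt0r_neq0 i0).
  have [z zE nz] := IH v y' (succn_inj e).
  exists z; first by rewrite zE.
  rewrite /ratios big_cons -/(ratios M w) -mulrA nz -y'E.
  have -> : simil (ratio M i) (angle M i) (trans M i a) y' -
    simil (ratio M i) (angle M i) (trans M i a) (act M w v 0) =
    ratio M i *: rot (angle M i) (y' - act M w v 0).
    apply: injective_projections; rewrite /simil /rot /= /GRing.scale /=; ring.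
  by rewrite enormZ enorm_rot gtr0_norm.
have sz : size (window (code_letter u) 0 m) = size (window om 0 m) by rewrite !size_window.
have [z zE nz] := affine _ _ (c1, c2) sz.
exists z; last by rewrite iter_mapsE zE.
by rewrite /edisk /= -(ler_pM2l (ratios_gt0 M (window om 0 m))) nz.
Qed.

Definition projection (th : R) (u : coding k omega) : R :=
  dot (coding_map f (radius M) u) (dir th).

Lemma projection_pos th u n :
  `|projection th u - pos M (window om 0 n) th (window (code_letter u) 0 n)| <=
  ratios M (window om 0 n) * radius M.
Proof.
have [z zr] := coding_map_mem u n; rewrite /projection => ->.
rewrite dot_act ?size_window // addrAC subrr add0r normrM gtr0_norm ?ratios_gt0 //.
rewrite ler_wpM2l // ?(ltW (ratios_gt0 _ _)) //.
by apply: le_trans (dot_dir_le _ _) _.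
Qed.

(** The projection varies little on a cylinder. *)
Lemma open_projection_lt th c : open [set u | projection th u < c].
Proof.
apply: open_tree_locally => u /= uc.
have e0 : 0 < (c - projection th u) / (2 * radius M).
  by rewrite divr_gt0 ?subr_gt0 // mulr_gt0 // radius_gt0.
have [m hm] := ratios_window_small M om e0; exists m => v vu.
have := hm m (leqnn _); rewrite ltr_pdivlMr ?mulr_gt0 ?radius_gt0 //.
have -> : 2 * radius M = radius M + radius M by ring.
rewrite mulrDr.
have := projection_pos th u m; have := projection_pos th v m.
have -> : window (code_letter v) 0 m = window (code_letter u) 0 m.
  rewrite /window; apply/eq_in_map => j; rewrite mem_iota => /andP[_ jm].
  by rewrite /code_letter vu.
rewrite !ler_norml => /andP[_ v2] /andP[u1 _] h.
by lra.
Qed.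

Lemma measurable_projection_itv th (x y : R) :
  measurable ([set u | x <= projection th u < y] : set (borel (coding k omega))).
Proof.
have mlt c : measurable ([set u | projection th u < c] : set (borel (coding k omega))).
  by apply: sub_sigma_algebra; apply: open_projection_lt.
have -> : [set u | x <= projection th u < y] =
   [set u | projection th u < y] `\` [set u | projection th u < x].
  apply/seteqP; split => u /=; first by move=> /andP[h ->]; rewrite ltNge h.
  by move=> [-> /negP]; rewrite -leNgt andbT.
exact: measurableD.
Qed.

Lemma measurable_cylinder n (a : coding k omega) :
  measurable ([set u | forall i, (i < n)%N -> u i = a i] : set (borel (coding k omega))).
Proof. by apply: sub_sigma_algebra; apply: open_cylinder. Qed.

End coding.

(** * Dyadic sums of the projected measure *)

Section real_mass.
Context d (T : measurableType d) (R : realType) (m : probability T R).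

Definition mass (B : set T) : R := fine (m B).

Lemma massE B : measurable B -> m B = (mass B)%:E.
Proof. by move=> mB; rewrite /mass fineK // fin_num_measure. Qed.

Lemma mass_ge0 B : 0 <= mass B.
Proof. by rewrite /mass fine_ge0. Qed.

Lemma mass_le B C : measurable B -> measurable C -> B `<=` C -> mass B <= mass C.
Proof.
move=> mB mC BC; rewrite -lee_fin -!massE //.
by apply: le_measure; rewrite ?inE.
Qed.

Lemma mass_sum (K : choiceType) (S : seq K) (F : K -> set T) (B : set T) :
  uniq S -> trivIset setT F -> (forall x, measurable (F x)) -> measurable B ->
  \sum_(x <- S) mass (B `&` F x) = mass (B `&` \bigcup_(x in [set` S]) F x).
Proof.
move=> uS tF mF mB.
have fS : finite_set [set` S] := finite_seq S.
have mS x : [set` S] x -> measurable (B `&` F x) by move=> _; apply: measurableI.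
have tS : trivIset [set` S] (fun x => B `&` F x).
  exact: sub_trivIset (@subsetT _ _) (trivIset_setIl tF).
apply: EFin_inj; rewrite setI_bigcupr -massE; last exact: fin_bigcup_measurable.
rewrite (measure_fin_bigcup _ fS tS mS).
rewrite -(fsbig_seq _ (fun x => m (B `&` F x))) // -sumEFin.
by apply: eq_bigr => x _; rewrite massE //; apply: measurableI.
Qed.

End real_mass.

Section dyadic_energy.
Context {R : realType} (N : nat) (k : 'I_N.+1 -> nat) (M : planar_ifs R 'I_N.+1 (letter k)).
Context (t : forall i : 'I_N.+1, 'I_(k i).+1 -> R * R) (p : forall i : 'I_N.+1, 'I_(k i).+1 -> R).
Hypothesis transE : trans M = letter_value (@t).
Hypothesis probE : prob M = letter_value (@p).
Context (omega : driving N) (etabar : probability (borel (coding k omega)) R).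
Hypothesis etabarP : is_product_measure (fun n => @p (omega n)) etabar.
Context (s : R).
Hypothesis s01 : 0 < s <= 1.

Let om : nat -> 'I_N.+1 := omega.
Let Omega := borel (coding k omega).
Let code (u : coding k omega) (m : nat) := window (code_letter u) 0 m.
Let f := fun i (j : 'I_(k i).+1) => simil (ratio M i) (angle M i) (@t i j).

Definition cylinder m (v : seq (letter k)) : set Omega := [set u | code u m = v].

Lemma code_eq (u v : coding k omega) m :
  code u m = code v m <-> forall i, (i < m)%N -> u i = v i.
Proof.
split=> [e i im|h].
  have : code_letter u i = code_letter v i.
    have := congr1 (fun w => nth (code_letter u 0) w i) e.
    by rewrite /code !nth_window.
  by move=> /eqP; rewrite /code_letter eq_Tagged /= => /eqP.
rewrite /code /window; apply/eq_in_map => j; rewrite mem_iota => /andP[_ jm].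
by rewrite /code_letter h.
Qed.

(** If the letters of [v] belong to the driving letters, [v] is the code of a
    sequence; otherwise the cylinder is empty and the weight vanishes. *)
Lemma cylinder_mass m v : v \in @words (letter k) m ->
  etabar (cylinder m v) = (weight (prob M) (window om 0 m) v)%:E.
Proof.
move=> /size_words sv.
have a0 : letter k := Tagged (fun i => 'I_(k i).+1) (ord0 : 'I_(k ord0).+1).
have weightE : weight (prob M) (window om 0 m) v = \prod_(i < m) prob M (om i) (nth a0 v i).
  rewrite /weight (big_nth (om 0%N, a0)) size_zip size_window sv minnn big_mkord.
  apply: eq_bigr => i _; rewrite nth_zip ?size_window //=.
  by rewrite nth_window // add0n.
pose u0 : coding k omega := fun n =>
  tagged_as (Tagged (fun i => 'I_(k i).+1) (ord0 : 'I_(k (omega n)).+1)) (nth a0 v n).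
have [/allP match_v|] := boolP (all (fun i => tag (nth a0 v i) == om i) (iota 0 m)).
  have u0E i : (i < m)%N -> code_letter u0 i = nth a0 v i.
    move=> im; have := match_v i; rewrite mem_iota im => /(_ isT).
    rewrite /code_letter /u0; case: (nth a0 v i) => j x /= /eqP e.
    by subst j; rewrite tagged_asE.
  have codeE : code u0 m = v.
    apply: (@eq_from_nth _ a0) => [|i]; rewrite size_window ?sv // => im.
    by rewrite nth_window // add0n u0E.
  have -> : cylinder m v = [set x | forall i, (i < m)%N -> x i = u0 i].
    by apply/seteqP; split => u; rewrite /cylinder /= -codeE => /code_eq.
  rewrite etabarP weightE; congr EFin; apply: eq_bigr => i _.
  by rewrite -u0E // probE letter_valueT.
move=> /allPn[i]; rewrite mem_iota /= add0n => im mis.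
have -> : cylinder m v = set0.
  apply/seteqP; split => u //; rewrite /cylinder /= => e; move: mis.
  by rewrite -e /code nth_window // add0n eqxx.
rewrite measure0 weightE (bigD1 (Ordinal im)) //= probE /letter_value.
by rewrite (negbTE mis) mul0r.
Qed.

Lemma measurable_code_cylinder m v : measurable (cylinder m v).
Proof.
have [[u0 u0v]|none] := pselect (exists u0, code u0 m = v).
  have -> : cylinder m v = [set x | forall i, (i < m)%N -> x i = u0 i].
    by apply/seteqP; split => u; rewrite /cylinder /= -u0v => /code_eq.
  exact: measurable_cylinder.
have -> : cylinder m v = set0; last exact: measurable0.
by apply/seteqP; split => u //; rewrite /cylinder /= => e; apply: none; exists u.
Qed.

Lemma trivIset_cylinder m : trivIset setT (cylinder m).
Proof. by move=> v w _ _ [u [/= <- <-]]. Qed.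

Lemma bigcup_cylinder m : \bigcup_(v in [set` @words (letter k) m]) cylinder m v = setT.
Proof.
apply/seteqP; split => u // _; exists (code u m) => //=.
by rewrite -{2}(size_window (code_letter u) 0 m) mem_words.
Qed.

Variables (th : R) (n : nat).
Let eps : R := 2 ^- n.
Let eps_gt0 : 0 < eps. Proof. by rewrite invr_gt0 exprn_gt0. Qed.

Let h (u : Omega) : R := projection M t th u.

Definition dyadic_set (j : int) : set Omega := [set u | eps * j%:~R <= h u < eps * (j + 1)%:~R].

Lemma measurable_dyadic_set j : measurable (dyadic_set j).
Proof. exact: measurable_projection_itv. Qed.

Lemma dyadic_setP u j : dyadic_set j u <-> Num.floor (h u / eps) = j.
Proof.
rewrite /dyadic_set /=; split=> [hu|<-].
  apply: floor_def; rewrite ler_pdivlMr // ltr_pdivrMr //.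
  by rewrite ![_ * eps]mulrC.
have := floor_itv (h u / eps); rewrite ler_pdivlMr // ltr_pdivrMr //.
by rewrite ![_ * eps]mulrC.
Qed.

Lemma trivIset_dyadic_set : trivIset setT dyadic_set.
Proof. by move=> i j _ _ [u [/dyadic_setP <- /dyadic_setP <-]]. Qed.

Lemma eta_proj_dyadic j :
  eta_proj f (radius M) etabar (dir th) (dyadic n j) = (mass etabar (dyadic_set j))%:E.
Proof.
rewrite -massE; last exact: measurable_dyadic_set.
congr (etabar _); apply/seteqP; split => u; rewrite /dyadic /= in_itv //.
Qed.

Let q := 1 + s.
Let C := Cq (eta_proj f (radius M) etabar (dir th)) q n.

Lemma Cq_le (B : R) :
  (forall S, uniq S -> \sum_(j <- S) mass etabar (dyadic_set j) `^ q <= B) -> (C <= B%:E)%E.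
Proof.
move=> hB; rewrite /C /Cq /esum; apply: ge_ereal_sup => _ [D [finD _] <-].
rewrite fsbig_finite //=.
under eq_bigr do rewrite eta_proj_dyadic poweR_EFin.
by rewrite sumEFin lee_fin; apply: hB; apply: finmap.fset_uniq.
Qed.

Lemma le_Cq S : uniq S ->
  ((\sum_(j <- S) mass etabar (dyadic_set j) `^ q)%:E <= C)%E.
Proof.
move=> uS; rewrite /C /Cq /esum; apply: ereal_sup_ubound.
exists [set` S]; first by split => //; exact: finite_seq.
rewrite -(fsbig_seq _ (fun j => (eta_proj f (radius M) etabar (dir th) (dyadic n j) `^ q)%E)) //.
under eq_bigr do rewrite eta_proj_dyadic poweR_EFin.
by rewrite sumEFin.
Qed.

Variable m : nat.
Let w := window om 0 m.
Let Lam := ratios M w.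
Let X := @words (letter k) m.
Let wt := weight (prob M) w.

Let wt_ge0 v : 0 <= wt v. Proof. exact/weight_ge0/prob_ge0. Qed.

Lemma cylinder_massE v : v \in X -> mass etabar (cylinder m v) = wt v.
Proof. by move=> vX; rewrite /mass cylinder_mass. Qed.

(** An upper bound for the number of unit cells that meet an interval of length
    [D + 2 * radius M]: a dyadic interval of length [D] in units of the cells,
    and the radius of a piece on each side. *)
Definition window_size (D : R) : nat := (Num.truncn (D + 2 * radius M) + 2)%N.

Lemma window_sizeP D : 0 <= D -> D + 2 * radius M + 1 <= (window_size D)%:R.
Proof.
move=> D0; have r0 := radius_gt0 M.
have c0 : 0 <= D + 2 * radius M by rewrite addr_ge0 // mulr_ge0 // ltW.
have /andP[_ c1] := truncn_itv c0.
rewrite /window_size natrD; move: (D + _) c1 => x; rewrite -[(Num.truncn x).+1%:R]natr1.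
by move: ((Num.truncn x)%:R) => y; lra.
Qed.

(** A dyadic interval receives mass only from the words whose cells lie in a
    window of bounded size.  Since cells are not longer than dyadic intervals,
    the windows of different intervals start at different cells. *)
Lemma Cq_upper D : Lam <= eps -> eps <= D * Lam ->
  (C <= ((window_size D)%:R ^+ 2 * Lq_energy M s w th)%:E)%E.
Proof.
move=> Le eL; have L0 : 0 < Lam := ratios_gt0 M w; have r0 := radius_gt0 M.
pose rho := eps / Lam.
have rho1 : 1 <= rho by rewrite ler_pdivlMr // mul1r.
have rhoD : rho <= D by rewrite ler_pdivrMr.
have D0 : 0 <= D by apply: le_trans rhoD; apply: le_trans rho1.
apply: Cq_le => S uS.
pose a (j : int) := Num.floor (j%:~R * rho - radius M).
have ainj : injective a.
  have lt_a i j : i < j -> a i < a j.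
    move=> ij; have := floor_itv (j%:~R * rho - radius M).
    rewrite -/(a j) => /andP[_ h2]; have := floor_itv (i%:~R * rho - radius M).
    rewrite -/(a i) => /andP[h1 _].
    have ij' : (i%:~R + 1 : R) <= j%:~R by rewrite -[1]/(1%:~R) -intrD ler_int -ltzD1 ltrD2r.
    have := ler_wpM2r (le_trans ler01 rho1) ij'; rewrite mulrDl mul1r => h3.
    have : (a i)%:~R + 1 < (a j + 1)%:~R :> R by lra.
    by rewrite intrD ltrD2r ltr_int.
  move=> i j e; case: (ltgtP i j) => // /lt_a; rewrite e ltxx //.
have := sum_window_le s01 X wt_ge0 (cell M w th) (window_size D) uS ainj.
rewrite /Lq_energy size_window; apply: le_trans.
apply: ler_sum => j _; apply: ler_powR1s => //; first exact: mass_ge0.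
have mI v : measurable (dyadic_set j `&` cylinder m v).
  by apply: measurableI; [exact: measurable_dyadic_set|exact: measurable_code_cylinder].
pose B (v : seq (letter k)) := `[< exists u, dyadic_set j u /\ code u m = v >].
apply: (@le_trans _ _ (\sum_(v <- X | B v) wt v)).
  rewrite -[dyadic_set j]setIT -(bigcup_cylinder m).
  rewrite -(mass_sum _ (words_uniq m) (@trivIset_cylinder m) (@measurable_code_cylinder m)
    (measurable_dyadic_set j)).
  rewrite [leRHS]big_mkcond big_seq [leRHS]big_seq; apply: ler_sum => v vX.
  rewrite /B; case: ifP => [_|/negbT /asboolPn none].
    rewrite -cylinder_massE //; apply: mass_le => //; exact: measurable_code_cylinder.
  have -> : dyadic_set j `&` cylinder m v = set0.
    by apply/seteqP; split => u // [h1 h2]; apply: none; exists u.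
  by rewrite /mass measure0.
apply: mass_le_window => // v vX /asboolP[u [hu uv]].
have := projection_pos transE th u m; rewrite -/(h u) -/w -/Lam.
rewrite -/(code u m) uv => hpos.
have cellE : cell M w th v = Num.floor (pos M w th v / Lam) by [].
rewrite cellE; set y := pos M w th v in hpos cellE *.
have yL : `|h u / Lam - y / Lam| <= radius M.
  by rewrite -mulrBl normrM normfV (gtr0_norm L0) ler_pdivrMr // mulrC.
move: hu; rewrite /dyadic_set /= => /andP[h1 h2].
have {}h1 : j%:~R * rho <= h u / Lam.
  by rewrite /rho mulrA ler_pM2r ?invr_gt0 // mulrC.
have {}h2 : h u / Lam < j%:~R * rho + rho.
  rewrite -[X in _ + X]mul1r -mulrDl /rho mulrA ltr_pM2r ?invr_gt0 //.
  by rewrite mulrC -[1]/(1%:~R) -intrD.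
move: yL; rewrite ler_norml => /andP[y1 y2].
have ws := window_sizeP D0.
have := floor_itv (j%:~R * rho - radius M); rewrite -/(a j) intrD => /andP[a1 a2].
have := floor_itv (y / Lam); rewrite intrD; set c := Num.floor (y / Lam) => /andP[c1 c2].
apply/andP; split.
  rewrite -ltzD1 -(ltr_int R) intrD.
  by apply: le_lt_trans a1 _; apply: le_lt_trans c2; lra.
rewrite -(ltr_int R) intrD -pmulrn.
move: (h u / Lam) (y / Lam) (j%:~R * rho) h1 h2 y1 y2 a1 a2 c1 c2 ws rhoD.
by move=> ? ? ? *; lra.
Qed.

(** The mass of each word is spread over boundedly many dyadic intervals, and the
    [1 + s]-th power is superadditive in the words. *)
Lemma Cq_lower_words : Lam <= eps ->
  ((\prod_(i <- w) moment M s i)%:E <= (window_size 0)%:R%:E * C)%E.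
Proof.
move=> Le; have r0 := radius_gt0 M; have L0 : 0 < Lam := ratios_gt0 M w.
set W := window_size 0.
pose b v := Num.floor ((pos M w th v - Lam * radius M) / eps).
pose S := undup (flatten [seq [seq b v + i%:Z | i <- iota 0 W] | v <- X]).
have uS : uniq S := undup_uniq _.
apply: (@le_trans _ _ (W%:R%:E * (\sum_(j <- S) mass etabar (dyadic_set j) `^ q)%:E)%E); last first.
  by apply: lee_wpmul2l; rewrite ?lee_fin //; apply: le_Cq.
rewrite -EFinM lee_fin.
have mI v j : measurable (cylinder m v `&` dyadic_set j).
  by apply: measurableI; [exact: measurable_code_cylinder|exact: measurable_dyadic_set].
have s1 : 1 + s != 0 by case/andP: s01 => s0 _; rewrite gt_eqF // addr_gt0.
have -> : \prod_(i <- w) moment M s i = \sum_(v <- X) wt v `^ q.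
  rewrite /X -(size_window om 0 m).
  rewrite (@sum_weightX _ _ _ _ (prob_ge0 M) (fun x => x `^ q)) ?powR1 //.
  by move=> x y x0 y0; rewrite powRM.
have step v : v \in X -> wt v `^ q <=
    W%:R * \sum_(j <- S) mass etabar (cylinder m v `&` dyadic_set j) `^ q.
  move=> vX; pose Sv := [seq b v + i%:Z | i <- iota 0 W].
  have uSv : uniq Sv by rewrite map_inj_uniq ?iota_uniq // => x y /addrI [].
  have cover : cylinder m v `<=` \bigcup_(j in [set` Sv]) dyadic_set j.
    move=> u uv; exists (Num.floor (h u / eps)); last exact/dyadic_setP.
    have := projection_pos transE th u m; rewrite -/(h u) -/w -/Lam.
    rewrite -/(code u m) uv ler_norml => /andP[p1 p2].
    have := floor_itv (h u / eps); rewrite intrD; set g := Num.floor _ => /andP[g1 g2].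
    have := floor_itv ((pos M w th v - Lam * radius M) / eps).
    rewrite -/(b v) intrD => /andP[b1 b2].
    have i1 : b v <= g.
      rewrite -ltzD1 -(ltr_int R) intrD; apply: le_lt_trans b1 _; apply: le_lt_trans g2.
      by rewrite ler_pM2r ?invr_gt0 //; lra.
    have i2 : g < b v + W%:Z.
      rewrite -(ltr_int R) intrD -pmulrn.
      have ws := window_sizeP (lexx 0); rewrite -/W in ws.
      have : h u / eps <= (pos M w th v - Lam * radius M) / eps + 2 * radius M.
        rewrite -lerBlDl -mulrBl ler_pdivrMr //.
        have : Lam * radius M <= eps * radius M by rewrite ler_wpM2r // ltW.
        have -> : 2 * radius M * eps = 2 * (eps * radius M) by ring.
        by move: (Lam * radius M) (eps * radius M) (h u) p2 => x y z p2 xy; lra.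
      by lra.
    rewrite /= /Sv; apply/mapP; exists `|g - b v|%N; last by rewrite gez0_abs ?subr_ge0 // subrKC.
    by rewrite mem_iota /= add0n -ltz_nat gez0_abs ?subr_ge0 // ltrBlDl.
  have wtE : wt v = \sum_(j <- Sv) mass etabar (cylinder m v `&` dyadic_set j).
    rewrite mass_sum //; last 3 first.
    - exact: trivIset_dyadic_set.
    - exact: measurable_dyadic_set.
    - exact: measurable_code_cylinder.
    by rewrite (setIidl cover) cylinder_massE.
  rewrite wtE; apply: le_trans (powR_sum_le s01 _ (fun j => mass_ge0 _ _)) _.
  rewrite size_map size_iota; apply: ler_pM; rewrite ?powR_ge0 ?powR_nat_le //.
    by rewrite sumr_ge0 // => j _; rewrite powR_ge0.
  have sub : {subset Sv <= S}.
    by move=> j jS; rewrite mem_undup; apply/flatten_mapP; exists v.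
  rewrite [leRHS](bigID (fun j => j \in Sv)) /= ler_wpDr ?sumr_ge0 // => [j _|]; first exact: powR_ge0.
  rewrite -[leRHS]big_filter; apply: eqW; apply: perm_big.
  apply: uniq_perm => [//||j]; first exact: filter_uniq.
  by rewrite mem_filter andb_idr // => /sub.
apply: (@le_trans _ _ (\sum_(v <- X) W%:R * \sum_(j <- S) mass etabar (cylinder m v `&` dyadic_set j) `^ q)).
  by rewrite big_seq [leRHS]big_seq; apply: ler_sum => v vX; apply: step.
rewrite -mulr_sumr ler_wpM2l // exchange_big /=; apply: ler_sum => j _.
apply: le_trans (powR_sum_superadd s01 _ _ (fun v => mass_ge0 _ _)) _.
apply: ler_powR1s => //; first by rewrite sumr_ge0 // => v _; apply: mass_ge0.
under eq_bigr do rewrite setIC.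
rewrite (mass_sum _ (words_uniq m) (@trivIset_cylinder m) (@measurable_code_cylinder m)
    (measurable_dyadic_set j)).
by rewrite bigcup_cylinder setIT.
Qed.

Definition covering_const : R := 2 * (Num.truncn (radius M)).+1%:R.

(** Mass one is spread over a number of dyadic intervals proportional to
    [2 ^ n]. *)
Lemma Cq_lower_cover : (1 <= ((covering_const * 2 ^+ n) `^ s)%:E * C)%E.
Proof.
have r0 := radius_gt0 M; set c := (Num.truncn (radius M)).+1.
have rc : radius M < c%:R by have /andP[] := truncn_itv (ltW r0).
pose K := (2 * c * 2 ^ n)%N; pose a : int := - (c * 2 ^ n)%:Z.
pose S := [seq a + i%:Z | i <- iota 0 K].
have uS : uniq S by rewrite map_inj_uniq ?iota_uniq // => x y /addrI [].
have KE : covering_const * 2 ^+ n = K%:R by rewrite /covering_const /K !natrM natrX.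
apply: (@le_trans _ _ ((K%:R `^ s)%:E * (\sum_(j <- S) mass etabar (dyadic_set j) `^ q)%:E)%E); last first.
  by rewrite KE; apply: lee_wpmul2l; rewrite ?lee_fin ?powR_ge0 //; apply: le_Cq.
rewrite -EFinM lee_fin.
have total : 1 = \sum_(j <- S) mass etabar (dyadic_set j).
  have mT : measurable (setT : set Omega) by exact: measurableT.
  have := mass_sum etabar uS trivIset_dyadic_set measurable_dyadic_set mT.
  have -> : setT `&` \bigcup_(j in [set` S]) dyadic_set j = setT.
    apply/seteqP; split => u // _; split => //; exists (Num.floor (h u / eps)); last exact/dyadic_setP.
    have := projection_pos transE th u 0.
    rewrite /ratios /= big_nil mul1r /pos /= {1}/dot /= !mul0r addr0 subr0 -/(h u).
    rewrite ler_norml => /andP[p1 p2].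
    have epsE : (c * 2 ^ n)%:R * eps = c%:R.
      by rewrite natrM natrX -mulrA divff ?mulr1 // gt_eqF // exprn_gt0.
    have h1 : - (c * 2 ^ n)%:R <= h u / eps.
      by rewrite ler_pdivlMr // mulNr epsE; lra.
    have h2 : h u / eps < (c * 2 ^ n)%:R by rewrite ltr_pdivrMr // epsE; lra.
    set g := Num.floor _.
    have g1 : a <= g by rewrite /g floor_ge_int mulrNz -pmulrn.
    have g2 : g < a + K%:Z.
      have -> : a + K%:Z = (c * 2 ^ n)%:Z by rewrite /a /K -mulnA mul2n -addnn PoszD; ring.
      by rewrite /g floor_lt_int -pmulrn.
    rewrite /=; apply/mapP; exists `|g - a|%N; last by rewrite gez0_abs ?subr_ge0 // subrKC.
    by rewrite mem_iota /= add0n -ltz_nat gez0_abs ?subr_ge0 // ltrBlDl.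
  rewrite {2}/mass probability_setT /= => <-.
  by apply: eq_bigr => j _; rewrite setTI.
have := powR_sum_le s01 S (fun j => mass_ge0 etabar (dyadic_set j)).
by rewrite -total powR1 size_map size_iota.
Qed.

End dyadic_energy.

(** * Asymptotics *)

Lemma ln_prod (R : realType) (T : Type) (r : seq T) (x : T -> R) : (forall i, 0 < x i) ->
  ln (\prod_(i <- r) x i) = \sum_(i <- r) ln (x i).
Proof.
move=> x0; elim: r => [|i r IH]; first by rewrite !big_nil ln1.
rewrite !big_cons lnM ?posrE ?IH //.
by elim/big_ind: _ => // y z; apply: mulr_gt0.
Qed.

Lemma cesaro_letter (R : realType) (I : finType) (r : I -> R) (omega : nat -> I) (h : I -> R) :
  \sum_a r a = 1 -> has_word_frequencies r omega ->
  forall e, 0 < e -> \forall m \near \oo,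
    `|\sum_(i <- window omega 0 m) h i - m%:R * \sum_a r a * h a| <= e * m%:R.
Proof.
move=> r1 freq e e0.
have := cesaro_mean freq 1 (fun w => if w is a :: _ then h a else 0) e0.
apply: filterS => m; rewrite /= sumrB big_const_nat iter_addr_0 subn0 [in m%:R * _]mulr_natl.
apply: le_trans; apply: eqW; congr `|_ - _|.
by rewrite /window big_map /index_iota subn0.
Qed.

Section asymptotics.
Context {R : realType} (N : nat) (k : 'I_N.+1 -> nat) (M : planar_ifs R 'I_N.+1 (letter k)).
Context (t : forall i : 'I_N.+1, 'I_(k i).+1 -> R * R) (p : forall i : 'I_N.+1, 'I_(k i).+1 -> R).
Hypothesis transE : trans M = letter_value (@t).
Hypothesis probE : prob M = letter_value (@p).
Context (omega : driving N) (etabar : probability (borel (coding k omega)) R).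
Hypothesis etabarP : is_product_measure (fun n => @p (omega n)) etabar.
Context (s : R).
Hypothesis s01 : 0 < s <= 1.
Context (r : 'I_N.+1 -> R).
Hypothesis r_ge0 : forall a, 0 <= r a.
Hypothesis r_sum : \sum_a r a = 1.
Hypothesis freq : has_word_frequencies r (omega : nat -> 'I_N.+1).
Hypothesis aperiodic : forall m, (0 < m)%N ->
  \sum_a r a * cos (2 * m%:R * angle M a) != 1.

Let om : nat -> 'I_N.+1 := omega.
Let f := fun i (j : 'I_(k i).+1) => simil (ratio M i) (angle M i) (@t i j).
Let rho th := eta_proj f (radius M) etabar (dir th).
Let a : R := mean_log_moment M s r.
Let beta : R := mean_log_ratio M r.
Let mx : R := Num.max a (s * beta).

(** The first prefix whose ratio is at most [2 ^- n].  The last bound makes its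
    length tend to infinity with [n]. *)
Lemma stopping_time : exists2 D : R, 1 < D & forall n, exists m,
  [/\ ratios M (window om 0 m) <= 2 ^- n, 2 ^- n <= D * ratios M (window om 0 m) &
      n%:R * ln 2 <= m%:R * ln D].
Proof.
have [g g0 gP] := finite_lower_bound (ratio M).
have g1 : g < 1.
  have /andP[i0 i1] := ratio_itv M (om 0%N).
  by apply: le_lt_trans i1; apply: gP.
have D1 : 1 < g^-1 by rewrite invf_gt1.
have gi0 : 0 < g^-1 by rewrite invr_gt0.
exists g^-1 => // n.
have e0 : 0 < 2 ^- n :> R by rewrite invr_gt0 exprn_gt0.
have ex : exists m, ratios M (window om 0 m) <= 2 ^- n.
  by have [m hm] := ratios_window_small M om e0; exists m; apply/ltW/hm.
exists (ex_minn ex); case: ex_minnP => m hm min_m.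
have lower j : g ^+ j <= ratios M (window om 0 j).
  elim: j => [|j IH]; first by rewrite /ratios big_nil expr0.
  rewrite window_rcons -cats1 ratios_cat exprSr /ratios big_seq1 -/(ratios M _).
  apply: ler_pM => //; rewrite ?exprn_ge0 ?(ltW g0) //.
  by apply: gP; case/andP: (ratio_itv M (om (0 + j)%N)).
split=> //.
  case: m hm min_m => [|m] hm min_m.
    rewrite /ratios big_nil mulr1; apply: le_trans (ltW D1).
    by rewrite invf_le1 ?exprn_gt0 // exprn_ege1 // ler1n.
  have gt : 2 ^- n < ratios M (window om 0 m).
    by rewrite ltNge; apply/negP => /min_m; rewrite ltnn.
  apply: (le_trans (ltW gt)).
  rewrite window_rcons -cats1 ratios_cat mulrCA ler_peMr ?(ltW (ratios_gt0 _ _)) //.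
  rewrite ler_pdivlMl // mulr1 /ratios big_seq1.
  by apply: gP; case/andP: (ratio_itv M (om (0 + m)%N)).
have := le_trans (lower m) hm.
rewrite -ler_ln ?posrE ?exprn_gt0 // lnV ?posrE ?exprn_gt0 // lnV ?posrE // !lnXn //.
rewrite -[ln g *+ m]mulr_natl -[ln 2 *+ n]mulr_natl mulrN.
by move: (m%:R * ln g) (n%:R * ln 2) => x y; lra.
Qed.

Lemma Cq_log_bounds (D : R) (n m : nat) (th : R) :
  let w := window om 0 m in
  ratios M w <= 2 ^- n -> 2 ^- n <= D * ratios M w ->
  let c := fine (Cq (rho th) (1 + s) n) in
  [/\ ln c <= 2 * ln (window_size M D)%:R + ln (Lq_energy M s w th),
      \sum_(i <- w) ln (moment M s i) <= ln (window_size M 0)%:R + ln c &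
      - (s * (ln (covering_const M) + n%:R * ln 2)) <= ln c].
Proof.
move=> w Le eL c.
have up := Cq_upper transE probE etabarP s01 th Le eL.
have lw := Cq_lower_words transE probE etabarP s01 th Le.
have lc := Cq_lower_cover transE etabar s01 th n.
rewrite -/f -/(rho th) in up lw lc.
have cov0 : 0 < covering_const M by rewrite mulr_gt0.
have K0 : 0 < (covering_const M * 2 ^+ n) `^ s by rewrite powR_gt0 // mulr_gt0 // exprn_gt0.
have [cE c0] : Cq (rho th) (1 + s) n = c%:E /\ 0 < c.
  have Cfin : Cq (rho th) (1 + s) n \is a fin_num.
    rewrite fin_numE; apply/andP; split; apply/eqP => e.
      by move: lc; rewrite e gt0_muleNy ?lte_fin // lee_fin.
    by move: up; rewrite e leye_eq.
  have cE : Cq (rho th) (1 + s) n = c%:E by rewrite fineK.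
  split=> //; move: lc; rewrite cE -EFinM lee_fin => h.
  have := lt_le_trans ltr01 h; by rewrite pmulr_rgt0.
rewrite cE in up lw lc.
move: up lw lc; rewrite -!EFinM !lee_fin => up lw lc.
have W0 D' : 0 < (window_size M D')%:R :> R by rewrite ltr0n /window_size addn2.
have G0 : 0 < Lq_energy M s w th := Lq_energy_gt0 M s01 w th.
have m0 i : 0 < moment M s i := moment_gt0 M s01 i.
split.
- have WD := W0 D; have WD2 : 0 < (window_size M D)%:R ^+ 2 :> R by rewrite exprn_gt0.
  rewrite mulr_natl -(lnXn _ WD) -lnM ?posrE //.
  by rewrite ler_ln ?posrE // mulr_gt0.
- have p0 : 0 < \prod_(i <- w) moment M s i.
    by elim/big_ind: _ => // y z; apply: mulr_gt0.
  rewrite -(ln_prod _ m0) -lnM ?posrE //.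
  by rewrite ler_ln ?posrE // mulr_gt0.
have := lc; rewrite -ler_ln ?posrE ?mulr_gt0 //.
rewrite ln1 lnM ?posrE // ln_powR lnM ?posrE ?exprn_gt0 // lnXn // -[ln 2 *+ n]mulr_natl.
by move: (s * _) => x; lra.
Qed.

(** At the stopping time all logarithms are linear in the length of the word,
    up to a small multiple of it and a constant. *)
Lemma log_asymptotics (e : R) : 0 < e -> exists2 K : R, 0 <= K & \forall n \near \oo,
  exists m : nat, `|n%:R * ln 2 + m%:R * beta| <= e * m%:R + K /\
  forall th, `|ln (fine (Cq (rho th) (1 + s) n)) - m%:R * mx| <= e * m%:R + K.
Proof.
move=> e0; have [D D1 hD] := stopping_time.
have lnD0 : 0 < ln D by apply: ln_gt0.
have s0 : 0 < s by case/andP: s01.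
have s1 : s <= 1 by case/andP: s01.
have [m1 _ h1] := cesaro_letter (fun i => ln (moment M s i)) r_sum freq e0.
have [m2 _ h2] := cesaro_letter (fun i => ln (ratio M i)) r_sum freq e0.
have [m3 _ h3] := orbit_growth s01 r_ge0 r_sum freq aperiodic e0.
pose K := ln D + `|2 * ln (window_size M D)%:R| + `|ln (window_size M 0)%:R| +
  `|s * ln (covering_const M)|.
have K0 : 0 <= K by rewrite !addr_ge0 // ltW.
exists K => //; near=> n; have [m [Le eL nm]] := hD n; exists m.
have ln20 : 0 < ln 2 :> R by apply: ln_gt0; rewrite ltr1n.
have mbig : (m1 + m2 + m3 <= m)%N.
  rewrite -(ler_nat R) -(ler_pM2r lnD0); apply: le_trans nm.
  rewrite -ler_pdivrMr //; near: n; exact: nbhs_infty_ger.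
have {}h1 := h1 m (leq_trans (leq_trans (leq_addr _ _) (leq_addr _ _)) mbig).
have {}h2 := h2 m (leq_trans (leq_trans (leq_addl _ _) (leq_addr _ _)) mbig).
have {}h3 := h3 m (leq_trans (leq_addl _ _) mbig).
set w := window om 0 m in Le eL h1 h2 h3.
have L0 : 0 < ratios M w := ratios_gt0 M w.
have lnL : ln (ratios M w) = \sum_(i <- w) ln (ratio M i).
  by rewrite /ratios ln_prod // => i; case/andP: (ratio_itv M i).
have e20 : 0 < 2 ^+ n :> R by rewrite exprn_gt0.
have l1 : ln (ratios M w) <= - (n%:R * ln 2).
  by move: Le; rewrite -ler_ln ?posrE ?invr_gt0 // lnV ?posrE // lnXn // mulr_natl.
have l2 : - (n%:R * ln 2) <= ln D + ln (ratios M w).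
  have D0 : 0 < D by apply: lt_trans D1.
  move: eL; rewrite -ler_ln ?posrE ?invr_gt0 ?mulr_gt0 // lnV ?posrE // lnXn //.
  by rewrite lnM ?posrE // mulr_natl.
rewrite -/(mean_log_ratio M r) -/beta -lnL in h2.
rewrite -/(mean_log_moment M s r) -/a in h1.
have em0 : 0 <= e * m%:R by rewrite mulr_ge0 // ltW.
have k1 := ler_norm (2 * ln (window_size M D)%:R : R).
have k2 := ler_norm (ln (window_size M 0)%:R : R).
have k3 := ler_norm (s * ln (covering_const M)).
have p1 := normr_ge0 (2 * ln (window_size M D)%:R : R).
have p2 := normr_ge0 (ln (window_size M 0)%:R : R).
have p3 := normr_ge0 (s * ln (covering_const M)).
move: h1 h2; rewrite !ler_norml => /andP[a1 a2] /andP[b1 b2].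
split=> [|th].
  by apply/andP; split; rewrite /K; lra.
have [c1 c2 c3] := Cq_log_bounds th Le eL.
rewrite -/w in c1 c2; move: c1 c2 c3; set lc := ln (fine _) => c1 c2 c3.
have {}h3 := h3 th; rewrite -/w -/a -/beta -/mx in h3.
rewrite ler_norml; apply/andP; split; last first.
  by move: h3; rewrite mulrDr [m%:R * e]mulrC /K; lra.
have [sb|sa] := leP a (s * beta).
  have -> : mx = s * beta by apply/max_idPr.
  have sn : s * (n%:R * ln 2) <= s * (- (m%:R * beta) + e * m%:R + ln D).
    by rewrite ler_pM2l //; lra.
  have se : s * (e * m%:R + ln D) <= e * m%:R + ln D by rewrite ler_piMl // addr_ge0 // ltW.
  rewrite /K [m%:R * (s * beta)]mulrCA.
  by move: c3 sn se; rewrite !mulrDr mulrN; lra.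
have -> : mx = a by apply/max_idPl/ltW.
by rewrite /K; lra.
Unshelve. all: by end_near. Qed.

Lemma quotient_cvg (e : R) : 0 < e -> \forall n \near \oo, forall th,
  `|mx / (s * beta) - Lq_quotient (rho th) (1 + s) n| <= e.
Proof.
move=> e0; have s0 : 0 < s by case/andP: s01.
have b0 : beta < 0 := mean_log_ratio_lt0 M r_ge0 r_sum.
have ln20 : 0 < ln 2 :> R by apply: ln_gt0; rewrite ltr1n.
pose d := mx / (s * beta).
have sb0 : s * beta < 0 by rewrite pmulr_rlt0.
have mx0 : mx <= 0.
  by rewrite ge_max (mean_log_moment_le0 M s01 r_ge0) ltW.
have d0 : 0 <= d by rewrite /d mulr_le0 // invr_le0 ltW.
have ds0 : 0 <= d * s by apply: mulr_ge0 d0 (ltW s0).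
have dE : mx = d * s * beta by rewrite -mulrA /d divfK // lt_eqF.
pose G := 1 + d * s.
have G0 : 0 < G by rewrite ltr_wpDr.
(* the first bound on [e1] makes the word length at most a constant times [n],
   the second makes the resulting error at most [e / 2] *)
pose e1 := Num.min (- beta / 2) (e * s * (- beta) / (8 * G)).
have e10 : 0 < e1.
  rewrite lt_min; apply/andP; split; first by rewrite divr_gt0 // oppr_gt0.
  by rewrite divr_gt0 ?mulr_gt0 // oppr_gt0.
have [K K0 hK] := log_asymptotics e10.
pose B := 2 * e1 * K / - beta * G + K * G.
near=> n => th.
have [m [hn hc]] : exists m : nat, `|n%:R * ln 2 + m%:R * beta| <= e1 * m%:R + K /\
  forall th, `|ln (fine (Cq (rho th) (1 + s) n)) - m%:R * mx| <= e1 * m%:R + K.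
  by near: n; exact: hK.
have {}hc := hc th; set lc := ln _ in hc.
have n0 : 0 < n%:R :> R by rewrite ltr0n; near: n; exact: nbhs_infty_gt.
have nbig : B <= e * s * ln 2 / 2 * n%:R.
  rewrite -ler_pdivrMl ?divr_gt0 ?mulr_gt0 //; near: n; exact: nbhs_infty_ger.
have -> : mx / (s * beta) - Lq_quotient (rho th) (1 + s) n =
    (lc - m%:R * mx + d * s * (n%:R * ln 2 + m%:R * beta)) / (s * (n%:R * ln 2)).
  rewrite -/d /Lq_quotient /log2 -/lc dE; field.
  by rewrite !gt_eqF.
have den : 0 < s * (n%:R * ln 2) by rewrite !mulr_gt0.
rewrite normrM normfV (gtr0_norm den) ler_pdivrMr //.
apply: le_trans (ler_normD _ _) _; rewrite normrM (ger0_norm ds0).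
apply: (@le_trans _ _ ((e1 * m%:R + K) * G)).
  rewrite /G mulrDr mulr1 lerD // [leRHS]mulrC ler_wpM2l //.
have m_le : m%:R <= (n%:R * ln 2 + K) * (2 / - beta).
  have e1b : e1 * m%:R <= - beta / 2 * m%:R.
    by rewrite ler_wpM2r // /e1 ge_min lexx.
  have nb0 : 0 < - beta by rewrite oppr_gt0.
  rewrite mulrA ler_pdivlMr //; move: hn; rewrite ler_norml => /andP[hn _].
  by move: e1b hn; rewrite mulrN; lra.
apply: (@le_trans _ _ ((e1 * ((n%:R * ln 2 + K) * (2 / - beta)) + K) * G)).
  by rewrite ler_wpM2r ?(ltW G0) // lerD2r ler_wpM2l // ltW.
have bn : beta != 0 by rewrite lt_eqF.
have -> : (e1 * ((n%:R * ln 2 + K) * (2 / - beta)) + K) * G =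
   2 * e1 * G / - beta * (n%:R * ln 2) + B by rewrite /B; field.
have -> : e * (s * (n%:R * ln 2)) = e * s / 2 * (n%:R * ln 2) + e * s * ln 2 / 2 * n%:R by field.
apply: lerD => //; rewrite ler_wpM2r ?mulr_ge0 ?(ltW ln20) //.
rewrite ler_pdivrMr ?oppr_gt0 //.
have e1G : e1 * (8 * G) <= e * s * - beta.
  by rewrite -ler_pdivlMr ?mulr_gt0 // /e1 ge_min lexx orbT.
have es : 0 <= e * s * - beta by rewrite !mulr_ge0 ?(ltW e0) ?(ltW s0) // oppr_ge0 ltW.
have -> : e * s / 2 * - beta = e * s * - beta / 2 by ring.
have -> : 2 * e1 * G = e1 * (8 * G) / 4 by field.
by move: (e1 * (8 * G)) (e * s * - beta) e1G es => x y; lra.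
Unshelve. all: by end_near. Qed.

End asymptotics.

Lemma ecircle_dir (R : realType) (v : R * R) : ecircle v -> exists th, v = dir th.
Proof.
by rewrite /ecircle /= => v1; have [th ->] := polar v; exists th; rewrite v1 scale1r.
Qed.

Lemma uniform_cvg_dist (R : realType) (T : choiceType) (E : set T) (F : nat -> T -> R) (l : R) :
  (forall e, 0 < e -> \forall n \near \oo, forall x, E x -> `|l - F n x| <= e) ->
  {uniform E, F @ \oo --> (fun=> l)}.
Proof.
move=> h P /uniform_nbhs[U [entU subP]].
move: entU; rewrite -entourage_ballE => -[e /= e0 ballU].
have e20 : 0 < e / 2 by rewrite divr_gt0.
have := h _ e20; apply: filterS => n hn; apply: subP => x Ex; apply: ballU.
rewrite /= /ball /=; apply: le_lt_trans (hn x Ex) _.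
by rewrite ltr_pdivrMr // ltr_pMr // ltr1n.
Qed.

Lemma similarity_dimE (R : realType) (N : nat) (k : 'I_N.+1 -> nat)
    (M : planar_ifs R 'I_N.+1 (letter k)) (p : forall i : 'I_N.+1, 'I_(k i).+1 -> R)
    (r : 'I_N.+1 -> R) (q : R) : prob M = letter_value (@p) -> 1 < q ->
  (forall a, 0 <= r a) -> \sum_a r a = 1 ->
  let b := (q - 1) * mean_log_ratio M r in
  Num.min (similarity_dim (ratio M) r (@p) q) 1 =
  Num.max (mean_log_moment M (q - 1) r) b / b.
Proof.
move=> probE q1 r0 r1 b; have q0 : 0 < q - 1 by rewrite subr_gt0.
have b0 : b < 0 by rewrite pmulr_rlt0 // mean_log_ratio_lt0.
have ln20 : ln 2 != 0 :> R by rewrite gt_eqF // ln_gt0 // ltr1n.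
have qq : 1 + (q - 1) = q by ring.
have momentE i : moment M (q - 1) i = \sum_j p i j `^ q.
  rewrite /moment qq probE (sum_letter (@p) i (g := fun x => x `^ q)) //.
  by rewrite powR0 // gt_eqF // (lt_trans ltr01).
have simE : similarity_dim (ratio M) r (@p) q = mean_log_moment M (q - 1) r / b.
  rewrite /similarity_dim /log2.
  have -> : \sum_i r i * (ln (\sum_j p i j `^ q) / ln 2) = mean_log_moment M (q - 1) r / ln 2.
    by rewrite /mean_log_moment mulr_suml; apply: eq_bigr => i _; rewrite momentE mulrA.
  have -> : \sum_i r i * (ln (ratio M i) / ln 2) = mean_log_ratio M r / ln 2.
    by rewrite /mean_log_ratio mulr_suml; apply: eq_bigr => i _; rewrite mulrA.
  rewrite /b; field.
  by rewrite ln20 !(gt_eqF q0, lt_eqF (mean_log_ratio_lt0 M r0 r1)).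
rewrite simE; have [ab|ba] := leP (mean_log_moment M (q - 1) r) b.
  by rewrite divff ?lt_eqF // min_r // ler_ndivlMr // mul1r.
by rewrite min_l // ler_ndivrMr // mul1r ltW.
Qed.

Theorem corollary6p4 (R : realType) (N : nat) (k : 'I_N.+1 -> nat)
    (lam alpha : 'I_N.+1 -> R) (t : forall i, 'I_(k i).+1 -> R * R)
    (rad : R) (p : forall i, 'I_(k i).+1 -> R) (r : 'I_N.+1 -> R)
    (mu : probability (borel (driving N)) R) :
  let f := fun i (j : 'I_(k i).+1) => simil (lam i) (alpha i) (t i j) in
  (forall i, 0 < lam i < 1) ->
  (forall i, 0 <= alpha i < 2 * pi) ->
  0 < rad ->
  (forall i j, f i j @` edisk rad `<=` edisk rad) ->
  (forall i, trivIset [set: 'I_(k i).+1] (fun j => f i j @` edisk rad)) ->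
  (forall i, prob_vector (p i)) ->
  prob_vector r ->
  is_product_measure (fun=> r) mu ->
  (exists i, 0 < r i /\ irrational (alpha i / pi)) ->
  forall q : R, 1 < q <= 2 ->
  forall omega : driving N, generic mu omega ->
  forall etabar : probability (borel (coding k omega)) R,
    is_product_measure (fun n => p (omega n)) etabar ->
  let D := Num.min (similarity_dim lam r p q) 1 in
  (forall v, ecircle v -> is_Lq_dim (eta_proj f rad etabar v) q D) /\
  {uniform ecircle,
    (fun n v => Lq_quotient (eta_proj f rad etabar v) q n) @ \oo --> (fun=> D)}.
Proof.
move=> f lam01 _ rad0 stable disj p_prob [r0 r1] bernoulli irr q /andP[q1 q2].
move=> omega gen etabar etabarP D.
have [M [ratioE angleE transE probE radE]] := planar_ifs_of_maps lam01 rad0 stable disj p_prob.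
subst lam alpha rad.
have s01 : 0 < q - 1 <= 1 by rewrite subr_gt0 q1 lerBlDr.
have freq := generic_word_frequencies r0 r1 bernoulli gen.
have aper := aperiodic_of_irrational r0 r1 irr.
have close e : 0 < e -> \forall n \near \oo, forall v, ecircle v ->
    `|D - Lq_quotient (eta_proj f (radius M) etabar v) q n| <= e.
  move=> e0; rewrite /D (similarity_dimE probE q1 r0 r1).
  have := quotient_cvg transE probE etabarP s01 r0 r1 freq aper e0.
  apply: filterS => n hn v /ecircle_dir[th ->].
  by have := hn th; have -> : 1 + (q - 1) = q by ring.
split; last exact: uniform_cvg_dist.
move=> v cv; apply/cvgrPdist_le => e e0.
by have := close e e0; apply: filterS => n; apply.
Qed.
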